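(* Let $N\geqslant 4$ be an even integer, let $K\geqslant 0$ be an integer, and put $L=N-1+2K$. Let $\gamma(N,L)\in B_N$ be the positive braid on $N$ strands defined in the context. Then $$|SC(\gamma(N,L))|\ \geqslant\ 2(L-1)\cdot\binom{K+N-3}{N-3}\ =\ 2(L-1)\cdot\binom{\frac{L-5+N}{2}}{N-3}.$$ Thus, for any fixed even $N\geqslant 4$, the size of the sliding circuit set $|SC(\gamma(N,L))|$, as a function of the odd integer $L\geqslant N-1$, grows at least like a polynomial of degree $N-2$ in $L$ (that is, there is a constant $c_N>0$ such that $|SC(\gamma(N,L))|\geqslant c_N L^{N-2}$ for all sufficiently large odd $L$).
   Context: **Braids and normal forms.** $B_N$ is the braid group on $N$ strands with Artin generators $\sigma_1,\dots,\sigma_{N-1}$; words are read from left to right (top to bottom of the braid), and $\sigma_i$ is a positive crossing of the strands in positions $i$ and $i+1$. A braid is positive if it is a product of the $\sigma_i$ (no inverses). A braid is simple (a positive permutation braid) if it is positive and any two strands cross at most once; simple braids are in bijection with permutations of $\{1,\dots,N\}$: to a permutation $\pi$ corresponds the unique simple braid whose strand starting in top position $j$ ends in bottom position $\pi(j)$, for all $j$. $\Delta$ is the half-twist, i.e. the simple braid with $\pi(j)=N+1-j$. A product $x_1.x_2$ of two simple braids is left-weighted if $x_1$ contains as many crossings as possible among all writings of the braid $x_1x_2$ as a product of two simple braids. Every braid has a unique normal form $x=\Delta^k.x_1.x_2.\cdots.x_\ell$ with $k\in\mathbb Z$, each $x_i$ simple, $x_i\neq 1,\Delta$, and each $x_i.x_{i+1}$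 left-weighted. **Rigid braids and sliding circuit sets.** A braid with normal form $\Delta^k.x_1.\cdots.x_\ell$, $\ell\geqslant 1$, is rigid if $x_\ell.x_1$ is left-weighted (when $k$ is even), respectively if $x_\ell.(\Delta^{-1}x_1\Delta)$ is left-weighted (when $k$ is odd). For a positive braid $x$ which is conjugate to a rigid braid, the sliding circuit set $SC(x)$ is the set of all rigid braids conjugate to $x$ in $B_N$; it is finite. (The braids $\gamma(N,L)$ below are rigid.) **Down-up sequences.** A down-up sequence is an arrangement of the labels $1,\dots,N$ consisting of a (possibly empty) decreasing sequence followed by a (possibly empty) increasing sequence. For $A\subseteq\{1,\dots,N\}$ and a down-up sequence $S$, ''making all labels in $A$ switch sides'' produces the down-up sequence $\phi_A(S)$ in which every label in $A$ switches its position (left/right) relative to all lower labels, while every label not in $A$ keeps its position relative to all lower labels. For instance with $N=8$, $A=\{2,4,6,8\}$: $\phi_A(8\,7\,4\,3\,2\,1\,5\,6)=(7\,6\,3\,1\,2\,4\,5\,8)$. **The braid $\gamma(N,L)$** ($N\geqslant4$ even, $L=N-1+2K$, $K\geqslant 0$). First define down-up sequences $S_1,\dots,S_{L+1}$, where $L+1=N+2K$: - $S_1$ consists of the integers in $\{1,\dots,N\}$ congruent to $0$ or $3$ modulo $4$ in descending order, followed by the remaining integers in ascending order. - $S_2$ is the reverse of $S_1$. - For $i=N,N-1,\dots,3$ successively, the next sequence $S_{N-i+3}$ is obtained from $S_{N-i+2}$ as follows: if $i$ is even, all even labels except $i$ switch sides; if $i$ is odd, all even labels and also label $i$ switch sides.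 This produces $S_3,\dots,S_N$. - For $j=N,\dots,N+2K-1$, $S_{j+1}$ is obtained from $S_j$ by making all even labels switch sides. Then $\gamma(N,L)=y_1y_2\cdots y_L$, where $y_j$ is the simple braid whose strands connect the entries of $S_j$ (top positions) to those of $S_{j+1}$ (bottom positions) according to the following rule: - For $j=1$ (so that $y_1=\Delta$) and for $j\geqslant N$, each strand connects the position of a label in $S_j$ to the position of the same label in $S_{j+1}$. - For $2\leqslant j\leqslant N-1$, put $i=N+2-j$ (the label treated exceptionally in the step from $S_j$ to $S_{j+1}$): the strand starting at label $i$ in $S_j$ ends at label $i-1$ in $S_{j+1}$, the strand starting at label $i-1$ in $S_j$ ends at label $i$ in $S_{j+1}$, and all other strands connect equal labels. For example, $\gamma(4,3+2K)=\Delta\cdot\sigma_1\sigma_3\cdot\sigma_1\sigma_2\sigma_3\sigma_2\sigma_1\cdot(\sigma_1\sigma_2\sigma_3\sigma_2\cdot\sigma_2\sigma_3\sigma_2\sigma_1)^K$. *)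

(* Defs.v *)
From HB Require Import structures.
From mathcomp Require Import all_boot all_order all_algebra all_fingroup.
From mathcomp Require Import zify.
From mathcomp Require Import boolp classical_sets functions cardinality reals.
Set Implicit Arguments.
Unset Strict Implicit.
Unset Printing Implicit Defensive.
Import Order.TTheory GRing.Theory Num.Theory.
Local Open Scope group_scope.

(* Positions and generators are numbered from 0: the generator [i : 'I_N.-1]
   crosses the strands in positions [i] and [i + 1] among [0, ..., N - 1]. *)

Lemma pos_l_subproof N (i : 'I_N.-1) : i < N.
Proof. by case: i => /= *; lia. Qed.
Lemma pos_r_subproof N (i : 'I_N.-1) : i.+1 < N.
Proof. by case: i => /= *; lia. Qed.

Definition pos_l N (i : 'I_N.-1) : 'I_N := Ordinal (pos_l_subproof i).
Definition pos_r N (i : 'I_N.-1) : 'I_N := Ordinal (pos_r_subproof i).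

(* The letter [(i, true)] is the i-th Artin generator, [(i, false)] is its
   inverse. *)
Definition word N := seq ('I_N.-1 * bool).

Definition pos_word N (w : seq 'I_N.-1) : word N := [seq (i, true) | i <- w].

(* Artin's presentation. *)
Inductive braid_rel N : word N -> word N -> Prop :=
| braid_refl u : braid_rel u u
| braid_sym u v : braid_rel u v -> braid_rel v u
| braid_trans u v w : braid_rel u v -> braid_rel v w -> braid_rel u w
| braid_cat a b u v : braid_rel u v -> braid_rel (a ++ u ++ b) (a ++ v ++ b)
| braid_free i e : braid_rel [:: (i, e); (i, ~~ e)] [::]
| braid_far (i j : 'I_N.-1) : i.+1 < j ->
    braid_rel (pos_word [:: i; j]) (pos_word [:: j; i])
| braid_adj (i j : 'I_N.-1) : j = i.+1 :> nat ->
    braid_rel (pos_word [:: i; j; i]) (pos_word [:: j; i; j]).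

Definition braid_eqb N (u v : word N) : bool := `[< braid_rel u v >].

Lemma braid_eqb_equiv N : equiv_class_of (@braid_eqb N).
Proof.
split=> [u|u v|v u w].
- exact/asboolP/braid_refl.
- by apply/asboolP/asboolP; apply: braid_sym.
- by move=> /asboolP uv /asboolP vw; apply/asboolP/(braid_trans uv vw).
Qed.

Canonical braid_equiv N := EquivRelPack (braid_eqb_equiv N).

Definition braid N := {eq_quot (braid_equiv N)}%qT.
HB.instance Definition _ N := Choice.on (braid N).
HB.instance Definition _ N := EqQuotient.on (braid N).

Definition of_word N (w : word N) : braid N := (\pi_(braid N) w)%qT.

(* A word representing [x], chosen by the quotient structure. *)
Definition braid_word N (x : braid N) : word N := generic_quotient.repr x.

Lemma of_wordP N (u v : word N) : of_word u = of_word v <-> braid_rel u v.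
Proof.
rewrite /of_word; split=> [/eqP|uv].
  by rewrite eqmodE => /asboolP.
by apply/eqP; rewrite eqmodE; apply/asboolP.
Qed.

Lemma repr_of_word N (w : word N) :
  braid_rel (braid_word (of_word w)) w.
Proof. by apply/of_wordP; rewrite /of_word reprK. Qed.

Lemma of_wordK N (x : braid N) : of_word (braid_word x) = x.
Proof. by rewrite /of_word reprK. Qed.

Lemma braid_rel_cat N (u u' v v' : word N) :
  braid_rel u u' -> braid_rel v v' -> braid_rel (u ++ v) (u' ++ v').
Proof.
move=> uu' vv'; apply: (@braid_trans _ _ (u' ++ v)).
  exact: (@braid_cat _ [::] v).
by have := braid_cat u' [::] vv'; rewrite !cats0.
Qed.

Definition word_inv N (w : word N) : word N :=
  rev [seq (a.1, ~~ a.2) | a <- w].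

Lemma word_inv_cat N (u v : word N) :
  word_inv (u ++ v) = word_inv v ++ word_inv u.
Proof. by rewrite /word_inv map_cat rev_cat. Qed.

Lemma word_invK N : involutive (@word_inv N).
Proof.
move=> w; rewrite /word_inv map_rev revK -map_comp map_id_in //.
by case=> i e _ /=; rewrite negbK.
Qed.

Lemma word_mulVw N (w : word N) : braid_rel (word_inv w ++ w) [::].
Proof.
elim: w => [|[i e] w IH]; first exact: braid_refl.
rewrite -cat1s word_inv_cat -catA [[:: (i, e)] ++ w]cat1s.
apply: (braid_trans _ IH).
have := braid_cat (word_inv w) w (braid_free i (~~ e)).
by rewrite negbK.
Qed.

Lemma word_mulwV N (w : word N) : braid_rel (w ++ word_inv w) [::].
Proof. by rewrite -{1}(word_invK w); apply: word_mulVw. Qed.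

Lemma word_inv_rel N (u v : word N) :
  braid_rel u v -> braid_rel (word_inv u) (word_inv v).
Proof.
move=> uv; apply: (@braid_trans _ _ (word_inv u ++ (v ++ word_inv v))).
  rewrite -{1}[word_inv u]cats0; apply: braid_rel_cat (braid_refl _) _.
  exact/braid_sym/word_mulwV.
rewrite catA -{2}[word_inv v]cat0s; apply: braid_rel_cat (braid_refl _).
apply: (@braid_trans _ _ (word_inv u ++ u)); last exact: word_mulVw.
exact: braid_rel_cat (braid_refl _) (braid_sym uv).
Qed.

Definition braid_mul N (x y : braid N) : braid N :=
  of_word (braid_word x ++ braid_word y).
Definition braid_inv N (x : braid N) : braid N :=
  of_word (word_inv (braid_word x)).

Lemma of_word_cat N (u v : word N) :
  of_word (u ++ v) = braid_mul (of_word u) (of_word v).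
Proof. by apply/of_wordP/braid_rel_cat; apply/braid_sym/repr_of_word. Qed.

Lemma of_word_inv N (w : word N) : of_word (word_inv w) = braid_inv (of_word w).
Proof. exact/of_wordP/word_inv_rel/braid_sym/repr_of_word. Qed.

Lemma braid_mulA N : associative (@braid_mul N).
Proof.
move=> x y z; rewrite -[x]of_wordK -[y]of_wordK -[z]of_wordK.
by rewrite -!of_word_cat catA.
Qed.

Lemma braid_mul1 N : left_id (of_word [::]) (@braid_mul N).
Proof. by move=> x; rewrite -[x]of_wordK -of_word_cat. Qed.

Lemma braid_mulr1 N : right_id (of_word [::]) (@braid_mul N).
Proof. by move=> x; rewrite -[x]of_wordK -of_word_cat cats0. Qed.

Lemma braid_mulV N : left_inverse (of_word [::]) (@braid_inv N) (@braid_mul N).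
Proof.
move=> x; rewrite -[x]of_wordK -of_word_inv -of_word_cat.
exact/of_wordP/word_mulVw.
Qed.

Lemma braid_mulrV N :
  right_inverse (of_word [::]) (@braid_inv N) (@braid_mul N).
Proof.
move=> x; rewrite -[x]of_wordK -of_word_inv -of_word_cat.
exact/of_wordP/word_mulwV.
Qed.

HB.instance Definition _ N := isGroup.Build (braid N)
  (@braid_mulA N) (@braid_mul1 N) (@braid_mulr1 N)
  (@braid_mulV N) (@braid_mulrV N).

Lemma of_wordM N (u v : word N) : of_word (u ++ v) = of_word u * of_word v.
Proof. exact: of_word_cat. Qed.

Definition braid_zexp N (x : braid N) (k : int) : braid N :=
  match k with Posz n => x ^+ n | Negz n => x ^- n.+1 end.

(* [s * t] is "first s, then t" both for words and for ['S_N]. *)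
Definition word_perm N (w : word N) : 'S_N :=
  \prod_(a <- w) tperm (pos_l a.1) (pos_r a.1).

(* The strand starting in top position [p] ends in position [braid_perm x p]. *)
Definition braid_perm N (x : braid N) : 'S_N := word_perm (braid_word x).

(* [y] is the position reached from position [x] through the generator [i]. *)
Definition step (i x y : nat) : Prop :=
  x = i /\ y = i.+1 \/ x = i.+1 /\ y = i \/ x <> i /\ x <> i.+1 /\ y = x.

Lemma stepP N (i : 'I_N.-1) (x : 'I_N) :
  step i x (tperm (pos_l i) (pos_r i) x).
Proof.
case: tpermP => [->|->|xl xr]; [by left|by right; left|].
by right; right; split=> [xE|]; [apply: xl|split=> // xE; apply: xr];
  apply: val_inj.
Qed.

Lemma step_far i j x a b c d : i.+1 < j ->
  step i x a -> step j a b -> step j x c -> step i c d -> b = d.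
Proof. by rewrite /step; lia. Qed.

Lemma step_adj i j x a b c a' b' c' : j = i.+1 ->
  step i x a -> step j a b -> step i b c ->
  step j x a' -> step i a' b' -> step j b' c' -> c = c'.
Proof. by rewrite /step; lia. Qed.

Lemma word_perm_rel N (u v : word N) :
  braid_rel u v -> word_perm u = word_perm v.
Proof.
rewrite /word_perm; elim=> //.
- by move=> ? ? ? _ -> _ ->.
- by move=> a b u1 v1 _ IH; rewrite !big_cat /= IH.
- by move=> i e; rewrite !big_cons !big_nil mulg1 tperm2.
- move=> i j ij; rewrite !big_cons !big_nil /= !mulg1.
  apply/permP => x; rewrite !permM; apply/val_inj => /=.
  by apply: (step_far ij); apply: stepP.
- move=> i j ij; rewrite !big_cons !big_nil /= !mulg1.
  apply/permP => x; rewrite !permM; apply/val_inj => /=.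
  by apply: (step_adj ij); apply: stepP.
Qed.

Lemma braid_perm_word N (w : word N) : braid_perm (of_word w) = word_perm w.
Proof. exact/word_perm_rel/repr_of_word. Qed.

Lemma braid_permM N (x y : braid N) :
  braid_perm (x * y) = braid_perm x * braid_perm y.
Proof.
rewrite -[x]of_wordK -[y]of_wordK -of_wordM !braid_perm_word.
by rewrite /word_perm big_cat.
Qed.

Definition word_expsum N (w : word N) : int :=
  (\sum_(a <- w) (if a.2 then 1 else -1))%R.

(* The exponent sum.  For a positive braid this is its number of crossings, i.e.
   the length of any positive word representing it ([crossing_number_pos]). *)
Definition crossing_number N (x : braid N) : int := word_expsum (braid_word x).

Lemma word_expsum_rel N (u v : word N) :
  braid_rel u v -> word_expsum u = word_expsum v.
Proof.
rewrite /word_expsum; elim=> //.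
- by move=> ? ? ? _ -> _ ->.
- by move=> a b u1 v1 _ IH; rewrite !big_cat /= IH.
- by move=> i [] /=; rewrite !big_cons !big_nil.
- by move=> i j ij; rewrite !big_cons !big_nil.
- by move=> i j ij; rewrite !big_cons !big_nil.
Qed.

Lemma crossing_number_word N (w : word N) :
  crossing_number (of_word w) = word_expsum w.
Proof. exact/word_expsum_rel/repr_of_word. Qed.

Lemma crossing_number_pos N (w : seq 'I_N.-1) :
  crossing_number (of_word (pos_word w)) = Posz (size w).
Proof.
rewrite crossing_number_word /word_expsum big_map big_const_seq count_predT.
by elim: (size w) => //= n ->.
Qed.

(* The number of times the strands starting in positions [a] and [b] cross each
   other in the positive braid word [w]. *)
Fixpoint crossings N (w : seq 'I_N.-1) (a b : 'I_N) : nat :=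
  if w is i :: w' then
    ([set a; b] == [set pos_l i; pos_r i]) +
    crossings w' (tperm (pos_l i) (pos_r i) a) (tperm (pos_l i) (pos_r i) b)
  else 0.

Definition simple N (x : braid N) : Prop :=
  exists2 w : seq 'I_N.-1, x = of_word (pos_word w) &
    forall a b, a != b -> crossings w a b <= 1.

(* The unique simple braid with permutation [s].  It exists by [simple_braidP],
   so that the default value [1] is not used. *)
Definition simple_braid N (s : 'S_N) : braid N :=
  xget 1 [set x | simple x /\ braid_perm x = s]%classic.

Definition Delta N : braid N := simple_braid (perm (@rev_ord_inj N)).

Definition left_weighted N (x1 x2 : braid N) : Prop :=
  [/\ simple x1, simple x2 &
    forall z1 z2, simple z1 -> simple z2 -> z1 * z2 = x1 * x2 ->
      (crossing_number z1 <= crossing_number x1)%R].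

Definition normal_form N (x : braid N) (k : int) (xs : seq (braid N)) : Prop :=
  [/\ x = braid_zexp (Delta N) k * \prod_(y <- xs) y,
      forall y, y \in xs -> [/\ simple y, y <> 1 & y <> Delta N] &
      forall i, i.+1 < size xs -> left_weighted (nth 1 xs i) (nth 1 xs i.+1)].

Definition rigid N (x : braid N) : Prop :=
  exists k x1 xs, normal_form x k (x1 :: xs) /\
    left_weighted (last x1 xs) (if odd `|k|%N then x1 ^ Delta N else x1).

Definition SC N (x : braid N) : set (braid N) :=
  [set y | rigid y /\ exists g, y = x ^ g]%classic.

(* The labels in [1, ..., N] satisfying [P] in descending order, followed by the
   others in ascending order. *)
Definition down_up N (P : pred nat) : seq nat :=
  rev [seq l <- iota 1 N | P l] ++ [seq l <- iota 1 N | ~~ P l].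

Definition left_of_lower (S : seq nat) (l : nat) : bool :=
  all (fun m => index l S < index m S) (iota 1 l.-1).

(* Label 1 has no lower label, and the arrangement does not depend on the side
   it is put on: it is always the last label of the descending part or the first
   label of the ascending one. *)
Definition switch N (A : pred nat) (S : seq nat) : seq nat :=
  down_up N (fun l => A l (+) left_of_lower S l).

(* The exceptional label in the step from S_j to S_(j+1), 2 <= j <= N - 1. *)
Definition special N j := N + 2 - j.

Definition switched_labels N j : pred nat := fun l =>
  if j < N then
    if odd (special N j) then ~~ odd l || (l == special N j)
    else ~~ odd l && (l != special N j)
  else ~~ odd l.

(* [label_seq N j] is S_j for [1 <= j]; [label_seq N 0] is a dummy value. *)
Fixpoint label_seq N (j : nat) : seq nat :=
  match j with
  | 0 => [::]
  | 1 => down_up N (fun l => (l %% 4 == 0) || (l %% 4 == 3))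
  | (1 as j').+1 => rev (label_seq N j')
  | j'.+1 => switch N (switched_labels N j') (label_seq N j')
  end.

(* The strand of [factor N j] = y_j starting at label [l] of S_j ends at label
   [end_label N j l] of S_(j+1). *)
Definition end_label N j (l : nat) : nat :=
  if 2 <= j < N then
    if l == special N j then (special N j).-1
    else if l == (special N j).-1 then special N j
    else l
  else l.

(* The permutation carrying each position [p] of [S] to the position in [T] of
   the label [f l], where [l] is the label at [p].  It exists in the cases used
   below: see [connecting_permP] and [factorP]. *)
Definition connecting_perm N (S T : seq nat) (f : nat -> nat) : 'S_N :=
  odflt 1 [pick s : 'S_N | [forall p, nth 0 T (s p) == f (nth 0 S p)]].

Definition factor N j : braid N :=
  simple_braid
    (connecting_perm N (label_seq N j) (label_seq N j.+1) (end_label N j)).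

Definition gamma N L : braid N := \prod_(1 <= j < L.+1) factor N j.

Lemma perm_increasing1 N (s : 'S_N) :
  (forall i : 'I_N.-1, s (pos_l i) < s (pos_r i)) -> s = 1.
Proof.
move=> sP; have lb k (hk : k < N) : k <= s (Ordinal hk).
  elim: k hk => // k IH hk; have hk' : k < N.-1 by lia.
  apply: (@leq_ltn_trans (s (pos_l (Ordinal hk')))); last first.
    rewrite (_ : Ordinal hk = pos_r (Ordinal hk')); first exact: sP.
    exact: val_inj.
  rewrite (_ : pos_l _ = Ordinal (ltnW hk)); first exact: IH.
  exact: val_inj.
have [_] : (\sum_(i : 'I_N) (i : nat) <= \sum_(i : 'I_N) (s i : nat)
    ?= iff [forall (i : 'I_N | true), (i : nat) == s i])%N.
  by apply: leqif_sum => -[k hk] _; split=> //; apply: lb.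
rewrite [X in (X == _)%N](reindex_inj (@perm_inj _ s)) eqxx => /esym/forallP sE.
by apply/permP => i; apply/val_inj; rewrite perm1; apply/esym/eqP/(sE i).
Qed.

Lemma pos_word_of_perm N (s : 'S_N) : exists2 w : seq 'I_N.-1,
  word_perm (pos_word w) = s &
  forall a b, a != b -> crossings w a b = (a < b) (+) (s a < s b).
Proof.
have [n] := ubnP (N ^ 3 - \sum_(i < N) i * s i)%N; elim: n s => // n IH s.
case: (pselect (forall i : 'I_N.-1, s (pos_l i) < s (pos_r i)))
  => [/perm_increasing1-> _|].
  by exists [::] => [|a b _]; rewrite /= ?perm1 ?addbb // /word_perm big_nil.
move=> /existsNP[i /negP]; rewrite -leqNgt leq_eqVlt => /orP[/eqP|].
  by move=> /val_inj/perm_inj /(congr1 val) /=; lia.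
move=> lt_s; set t := tperm (pos_l i) (pos_r i).
have lr : pos_l i != pos_r i by rewrite -val_eqE /=; lia.
have bound (u : 'S_N) : (\sum_(i < N) i * u i <= N ^ 3)%N.
  rewrite (_ : N ^ 3 = \sum_(i < N) N * N)%N; last first.
    by rewrite sum_nat_const card_ord; lia.
  by apply: leq_sum => j _; apply: leq_mul; apply: ltnW.
have grow : (\sum_(j < N) j * s j < \sum_(j < N) j * (t * s)%g j)%N.
  have split_sum (u : 'S_N) : (\sum_(j < N) j * u j = i * u (pos_l i) +
      (i.+1 * u (pos_r i) + \sum_(j < N | (j != pos_l i) && (j != pos_r i)) j * u j))%N.
    by rewrite (bigD1 (pos_l i)) // (bigD1 (pos_r i)) //= eq_sym.
  rewrite !split_sum !permM tpermL tpermR.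
  have -> : (\sum_(j < N | (j != pos_l i) && (j != pos_r i)) j * (t * s)%g j =
             \sum_(j < N | (j != pos_l i) && (j != pos_r i)) j * s j)%N.
    by apply: eq_bigr => j /andP[jl jr]; rewrite permM tpermD // eq_sym.
  move: lt_s; rewrite !mulSn; move: (\sum_(j < N | _) _)%N => m.
  move: (i * _)%N (i * _)%N => a b; move: (nat_of_ord _) (nat_of_ord _) => c d.
  by lia.
move=> lt_n; have [] := IH (t * s).
  move: (bound (t * s)) lt_n grow; move: (\sum_(j < N) _)%N => A.
  by move: (\sum_(j < N) _)%N (N ^ 3)%N => B C; lia.
move=> w wE cE; exists (i :: w) => [|a b ab /=].
  rewrite /word_perm /= big_cons /= -/t -/(word_perm (pos_word w)) wE.
  by rewrite mulgA tperm2 mul1g.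
rewrite -/t cE ?inj_eq //; last exact: perm_inj.
rewrite !permM !tpermK.
have sab : s a <> s b :> nat by move=> /val_inj/perm_inj/eqP; apply/negP.
have ltn_SnF : (i.+1 < i) = false by lia.
have [abE|NE] := eqVneq [set a; b] _.
  have : a \in [set pos_l i; pos_r i] by rewrite -abE !inE eqxx.
  have : b \in [set pos_l i; pos_r i] by rewrite -abE !inE eqxx orbT.
  rewrite !inE => /orP[]/eqP bE /orP[]/eqP aE; move: ab; rewrite aE bE ?eqxx //.
    by rewrite tpermL tpermR /= ltnSn ltn_SnF lt_s.
  by rewrite tpermL tpermR /= ltnSn ltn_SnF [s _ < _]ltnNge (ltnW lt_s).
have ord : (t a < t b) = (a < b).
  have H : ~ (a = i :> nat /\ b = i.+1 :> nat) /\ ~ (b = i :> nat /\ a = i.+1 :> nat).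
    split=> -[/= E1 E2]; move/negP: NE; apply; apply/eqP.
      by congr ([set _; _]); apply: val_inj.
    by rewrite finset.setUC; congr ([set _; _]); apply: val_inj.
  have : a <> b :> nat by move=> /val_inj/eqP; apply/negP.
  move: (stepP i a) (stepP i b) H; rewrite -/t /step.
  by move: (nat_of_ord (t a)) (nat_of_ord (t b)) => *; lia.
by rewrite ord.
Qed.

Lemma simple_braidP N (s : 'S_N) :
  simple (simple_braid s) /\ braid_perm (simple_braid s) = s.
Proof.
rewrite /simple_braid; case: xgetP => [_ _ //|/= none].
have [w wE cE] := pos_word_of_perm s; case: (none (of_word (pos_word w))).
split; last by rewrite braid_perm_word.
by exists w => // a b ab; rewrite cE //; case: addb.
Qed.

Lemma perm_down_up N P : perm_eq (down_up N P) (iota 1 N).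
Proof.
apply: perm_trans (permEl (perm_filterC P (iota 1 N))).
by rewrite /down_up perm_cat2r perm_rev.
Qed.

Lemma perm_label_seq N j : 0 < j -> perm_eq (label_seq N j) (iota 1 N).
Proof.
case: j => [//|[_|[_|j _]]] /=; try exact: perm_down_up.
by rewrite perm_rev; apply: perm_down_up.
Qed.

Lemma connecting_permP N (S T : seq nat) (f : nat -> nat) :
  perm_eq S (iota 1 N) -> perm_eq T (iota 1 N) ->
  {in iota 1 N, forall l, f l \in iota 1 N} -> {in iota 1 N &, injective f} ->
  forall p, nth 0 T (connecting_perm N S T f p) = f (nth 0 S p).
Proof.
move=> pS pT f_stable f_inj.
have szS : size S = N by rewrite (perm_size pS) size_iota.
have szT : size T = N by rewrite (perm_size pT) size_iota.
have memS (p : 'I_N) : nth 0 S p \in iota 1 N.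
  by rewrite -(perm_mem pS) mem_nth // szS.
have memT (p : 'I_N) : f (nth 0 S p) \in T by rewrite (perm_mem pT) f_stable.
have bound (p : 'I_N) : index (f (nth 0 S p)) T < N.
  by rewrite -[X in _ < X]szT index_mem.
have g_inj : injective (fun p => Ordinal (bound p)).
  move=> p q [] /(congr1 (nth 0 T)); rewrite !nth_index // => /f_inj E.
  have uS : uniq S by rewrite (perm_uniq pS) iota_uniq.
  have ltS (r : 'I_N) : r < size S by rewrite szS.
  apply/val_inj/eqP; rewrite -(nth_uniq 0 (ltS p) (ltS q) uS).
  by apply/eqP/E; apply: memS.
rewrite /connecting_perm; case: pickP => [s /forallP sP p|none]; first exact/eqP.
have /forallP[] := none (perm g_inj) => p.
by rewrite permE /= nth_index.
Qed.

Lemma factorP N j : 0 < j ->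
  simple (factor N j) /\
  forall p, nth 0 (label_seq N j.+1) (braid_perm (factor N j) p) =
            end_label N j (nth 0 (label_seq N j) p).
Proof.
move=> j_gt0; rewrite /factor; set s := connecting_perm _ _ _ _.
have [simp ->] := simple_braidP s; split=> // p.
apply: connecting_permP; rewrite ?perm_label_seq //.
- move=> l; rewrite !mem_iota /end_label /special.
  by do 3?case: ifP => ?; lia.
- move=> l l'; rewrite !mem_iota /end_label /special.
  by do 5?case: ifP => ?; lia.
Qed.

(* Main.v *)
Require Import Defs.
From mathcomp Require Import all_boot all_order all_algebra all_fingroup.
From mathcomp Require Import zify.
From mathcomp Require Import boolp classical_sets functions cardinality reals.
Set Implicit Arguments.
Unset Strict Implicit.
Unset Printing Implicit Defensive.
Import Order.TTheory GRing.Theory Num.Theory.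
Local Open Scope group_scope.

(* In gamma = Delta . X_N . X_(N-1) . ... . X_3 . P^K, the factor X_i exchanges
   the labels i - 1 and i, and P is a pair of steps in which all even labels
   switch sides.  The K copies of P may be distributed arbitrarily after the
   factors X_N, ..., X_3: this gives 'C(K + N - 3, N - 3) braids.  They are
   rigid because each factor only starts with crossings that end the previous
   one.
   They are conjugate to gamma: if T_b denotes the full twist of the strands
   with the b lowest labels, P is the product of the T_b with alternating signs
   (-1)^b, and X_i commutes with every T_b except T_(i-1); so P moves past X_i
   except for one factor T_(i-1)^(+-1), which reaches the other side of X_i by
   travelling once around the closed braid.
   Cycling these braids, with conjugation by Delta after each full turn, gives
   2 (L - 1) normal forms each.  They are all different because the numbers of
   crossings of the factors tell the X_i and P apart.  For N = 4 and K = 0 the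
   braid commutes with Delta and another rigid conjugate is rotated instead.
   Normal forms are told apart in the braid group, and not only in the monoid of
   positive braids, by letting the group act on left-weighted sequences, where
   the square of Delta acts as an injective shift. *)

(** * The weak order on permutations *)

(** The exchanged labels [i - 1] and [i] lie on the same side, so [X_i] concerns two neighbouring
    strands; a twist of the [b] lowest strands contains both or neither of them, unless [b = i - 1].
    The alternating signs come from the even labels: when label [B] switches sides and returns, its
    strand circles the [B - 1] lower ones, which is T_B T_(B-1)^(-1), and the double switch is the
    product over the even [B]. [X_i] has [i - 2] crossings more than a plain step if [i] is odd and
    [i - 2] fewer if [i] is even. So no exchange is mistaken for a plain step, and, [N] being even,
    the count of [X_N] occurs only once and marks the rotation. After [L - 1] rotations a list has
    become its conjugate by [Delta]: hence the factor 2, and the separate treatment of a list fixed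
    by that conjugation. The obstacle is uniqueness of normal forms in a group given by a
    presentation. [Delta] acts on infinite sequences by inserting a term at the front, which is
    injective but not invertible; an inverse letter can therefore act only up to a full twist, and
    such surplus twists have to be cancelled by injectivity. *)

Definition cross N (s : 'S_N) (a b : 'I_N) : bool := (a < b) (+) (s a < s b).

(** The condition under which the product of the simple braids of [s] and [t] is again simple, see
    [simple_braidM]. *)
Definition reduced N (s t : 'S_N) : Prop :=
  forall a b, cross s a b -> cross t (s a) (s b) -> False.

(** Inclusion of inversion sets, i.e. the weak order; by [reduced_quot] and [prefix_le_mul] it is
    divisibility among simple braids. *)
Definition prefix_le N (s t : 'S_N) : Prop :=
  forall a b, cross s a b -> cross t a b.

Lemma ord_neq N (a b : 'I_N) : a != b -> (a < b) = ~~ (b < a).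
Proof. by rewrite -val_eqE /= => ab; lia. Qed.

Lemma cross_lt N (s : 'S_N) (a b : 'I_N) : a < b -> cross s a b = (s b < s a).
Proof.
move=> ab; have ab' : a != b by rewrite -val_eqE neq_ltn ab.
by rewrite /cross ab addTb (ord_neq (_ : s a != s b)) ?negbK ?(inj_eq perm_inj).
Qed.

Lemma cross_id N (s : 'S_N) a : cross s a a = false.
Proof. by rewrite /cross !ltnn. Qed.

Lemma cross_sym N (s : 'S_N) a b : cross s a b = cross s b a.
Proof.
have [->//|ab] := eqVneq a b.
rewrite /cross (ord_neq ab) (@ord_neq _ (s a)) ?(inj_eq perm_inj) //.
by rewrite addbN addNb negbK.
Qed.

Lemma crossM N (s t : 'S_N) a b :
  cross (s * t) a b = cross s a b (+) cross t (s a) (s b).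
Proof. by rewrite /cross !permM addbA -(addbA (a < b)) addbb addbF. Qed.

Lemma cross1 N (a b : 'I_N) : cross 1 a b = false.
Proof. by rewrite /cross !perm1 addbb. Qed.

Lemma cross_inv N (s : 'S_N) a b : cross s^-1 (s a) (s b) = cross s a b.
Proof. by rewrite /cross !permK addbC. Qed.

Lemma crossM_reduced N (s t : 'S_N) a b : reduced s t ->
  cross (s * t) a b = cross s a b || cross t (s a) (s b).
Proof.
move=> /(_ a b); rewrite crossM.
by case: (cross s a b) => //=; case: cross => // /(_ isT isT).
Qed.

Lemma no_cross1 N (s : 'S_N) : (forall a b, cross s a b = false) -> s = 1.
Proof.
move=> s0; apply: perm_increasing1 => i.
by have := s0 (pos_l i) (pos_r i); rewrite /cross /= ltnS leqnn; case: (_ < _).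
Qed.

Lemma prefix_le_trans N (s t u : 'S_N) :
  prefix_le s t -> prefix_le t u -> prefix_le s u.
Proof. by move=> st tu a b /st/tu. Qed.

Lemma cross_quot N (s t : 'S_N) a b :
  cross (s^-1 * t) (s a) (s b) = cross s a b (+) cross t a b.
Proof. by rewrite crossM cross_inv !permK. Qed.

Lemma prefix_le_anti N (s t : 'S_N) : prefix_le s t -> prefix_le t s -> s = t.
Proof.
move=> st ts; suff /eqP: s^-1 * t = 1 by rewrite -eq_mulVg1 => /eqP.
apply: no_cross1 => a b; rewrite -[a](permKV s) -[b](permKV s) cross_quot.
move: (st (s^-1 a) (s^-1 b)) (ts (s^-1 a) (s^-1 b)).
by case: (cross s) => [/(_ isT)->|_]; case: (cross t) => // /(_ isT).
Qed.

Lemma reduced_quot N (s t : 'S_N) : prefix_le s t -> reduced s (s^-1 * t).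
Proof. by move=> st a b sab; rewrite cross_quot sab (st _ _ sab). Qed.

Lemma prefix_le_mul N (s t : 'S_N) : reduced s t -> prefix_le s (s * t).
Proof. by move=> st a b sab; rewrite crossM_reduced // sab. Qed.

Lemma prefix_le_mull N (s t u : 'S_N) :
  reduced s t -> reduced s u -> prefix_le t u -> prefix_le (s * t) (s * u).
Proof.
move=> st su tu a b; rewrite !crossM_reduced // => /orP[->//|/tu ->].
by rewrite orbT.
Qed.

Lemma prefix_le_mulK N (s t u : 'S_N) :
  reduced s t -> reduced s u -> prefix_le (s * t) (s * u) -> prefix_le t u.
Proof.
move=> st su tu a b tab; have := tu (s^-1 a) (s^-1 b).
rewrite !crossM_reduced // !permKV tab orbT => /(_ isT) /orP[sab|//].
by have := st _ _ sab; rewrite !permKV => /(_ tab).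
Qed.

Lemma reduced1 N (s : 'S_N) : reduced s 1.
Proof. by move=> a b _; rewrite cross1. Qed.
Arguments reduced1 [N] s.

Lemma prefix_le1 N (s : 'S_N) : prefix_le 1 s.
Proof. by move=> a b; rewrite cross1. Qed.
Arguments prefix_le1 [N] s.

(** Once [s] and [t] are reduced, both sides say that no two strands cross twice when [s], [t] and
    [u] are performed in a row. *)
Lemma reducedA N (s t u : 'S_N) : reduced s t ->
  reduced (s * t) u <-> reduced t u /\ reduced s (t * u).
Proof.
move=> st; split=> [stu|[tu stu] a b].
  have tu : reduced t u.
    move=> a b tab uab; apply: (stu (s^-1 a) (s^-1 b)).
      by rewrite crossM_reduced // !permKV tab orbT.
    by rewrite !permM !permKV.
  split=> // a b sab; rewrite crossM_reduced // => /orP[|uab].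
    exact: st.
  by apply: (stu a b); rewrite ?crossM_reduced ?sab // !permM.
rewrite crossM_reduced // !permM => /orP[sab|tab] uab; last exact: tu tab uab.
by apply: (stu a b) => //; rewrite crossM_reduced // uab orbT.
Qed.

Definition flip N : 'S_N := perm (@rev_ord_inj N).

Lemma flipE N a : flip N a = rev_ord a. Proof. by rewrite permE. Qed.

Lemma flipK N : flip N * flip N = 1.
Proof. by apply/permP => a; rewrite permM !flipE perm1 rev_ordK. Qed.

Lemma flipV N : (flip N)^-1 = flip N.
Proof. by apply/eqP; rewrite eq_invg_mul flipK. Qed.

Lemma cross_flip N (a b : 'I_N) : cross (flip N) a b = (a != b).
Proof.
rewrite /cross !flipE -val_eqE /=.
by case: a b => a aN [] b bN /=; rewrite /addb; case: ifP; lia.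
Qed.

Lemma cross_neq N (s : 'S_N) a b : cross s a b -> a != b.
Proof. by apply: contraTneq => ->; rewrite cross_id. Qed.

Lemma prefix_le_flip N (s : 'S_N) : prefix_le s (flip N).
Proof. by move=> a b /cross_neq; rewrite cross_flip. Qed.
Arguments prefix_le_flip [N] s.

Definition transp N (i : 'I_N.-1) : 'S_N := tperm (pos_l i) (pos_r i).

Lemma cross_transp N (i : 'I_N.-1) a b :
  cross (transp i) a b =
  ((a == i :> nat) && (b == i.+1 :> nat)) || ((b == i :> nat) && (a == i.+1 :>
    nat)).
Proof.
rewrite /cross; move: (stepP i a) (stepP i b); rewrite /step /transp.
move: (nat_of_ord (tperm _ _ a)) (nat_of_ord (tperm _ _ b)) => x y.
by rewrite /addb; case: ifP; lia.
Qed.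

Lemma discrete_ivt (Q : pred nat) lo hi : lo <= hi -> Q lo -> ~~ Q hi ->
  exists k, [/\ lo <= k, k < hi, Q k & ~~ Q k.+1].
Proof.
move=> lh Qlo; rewrite -(subnKC lh); elim: (hi - lo) => [|d IH].
  by rewrite addn0 Qlo.
rewrite addnS; case: (boolP (Q (lo + d))) => [Qd QSd|Qd _].
  by exists (lo + d)%N; split=> //; rewrite leq_addr.
by have [k [? ? ? ?]] := IH Qd; exists k; split=> //; lia.
Qed.

(* A common prefix that no single crossing extends is the greatest one.  If
   some common prefix [z] inverted a pair [a < b] not inverted by [m], then, for
   such a pair at minimal distance after [m], every strand lying between [a] and
   [b] after [m] started either before [a] or after [b]; two consecutive ones of
   different kinds would extend [m]. *)
Lemma prefix_meet N (u x : 'S_N) : exists m, [/\ prefix_le m u, prefix_le m x &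
  forall z, prefix_le z u -> prefix_le z x -> prefix_le z m].
Proof.
pose P m := `[< prefix_le m u /\ prefix_le m x >].
have P1 : P 1 by apply/asboolP; split; apply: prefix_le1.
pose F (m : 'S_N) := #|[set ab : 'I_N * 'I_N | cross m ab.1 ab.2]|.
have [m /asboolP[mu mx] mmax] := @arg_maxnP _ 1 P F P1.
(* Two strands adjacent after [m] and not crossed by it, but crossed by both [u] and [x], would give
   the larger common prefix [m']. *)
have local (a b : 'I_N) : a < b -> m b = (m a).+1 :> nat ->
    cross u a b -> cross x a b -> False.
  move=> ab mab uab xab; have iN : m a < N.-1 by have := ltn_ord (m b); lia.
  pose i := Ordinal iN; pose m' := m * transp i.
  have m'E c d : cross m' c d = cross m c d (+) ([&& c == a & d == b] || [&& d
    == a & c == b]).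
    rewrite crossM cross_transp /= -mab; congr (_ (+) _).
    by rewrite !val_eqE !(inj_eq perm_inj).
  have mabF : cross m a b = false by rewrite /cross ab mab ltnS leqnn.
  have m'P c d : cross m' c d = cross m c d || ([&& c == a & d == b] || [&& d
    == a & c == b]).
    rewrite m'E; case: (boolP (_ || _)) => [|_]; last by rewrite addbF orbF.
    by case/orP=> /andP[/eqP-> /eqP->]; rewrite 1?[cross m b a]cross_sym mabF.
  have lem' v : prefix_le m v -> cross v a b -> prefix_le m' v.
    move=> mv vab c d; rewrite m'P => /orP[/mv//|].
    by case/orP=> /andP[/eqP-> /eqP->] //; rewrite cross_sym.
  have := mmax m'; rewrite /P => /(_ _)/wrap[]; first by apply/asboolP; split;
    apply: lem'.
  apply/negP; rewrite -ltnNge; apply: proper_card; apply/properP; split.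
    by apply/fintype.subsetP => -[c d]; rewrite !inE m'P /= => ->.
  by exists (a, b); rewrite !inE /= ?m'P ?mabF // !eqxx orbT.
exists m; split=> // z zu zx.
have main n (a b : 'I_N) : m b - m a <= n -> a < b -> m a < m b -> z a < z b.
  elim: n a b => [|n IH] a b; first by lia.
  move=> dn ab mab; rewrite ltnNge; apply/negP; rewrite leq_eqVlt.
  case/orP=> [/eqP/val_inj/perm_inj ba|zba]; first by rewrite ba ltnn in ab.
  have kind (c : 'I_N) : m a < m c < m b -> b < c \/ c < a.
    move=> /andP[mac mcb].
    have [zbc|zcb] := ltnP (z b) (z c).
      left; rewrite ltnNge; apply/negP; rewrite leq_eqVlt => /orP[/eqP/val_inj
        cb|cb].
        by rewrite cb ltnn in mcb.
      by have := IH c b; lia.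
    right; rewrite ltnNge; apply/negP; rewrite leq_eqVlt => /orP[/eqP/val_inj
      ca|ac].
      by rewrite ca ltnn in mac.
    by have := IH a c; lia.
  have zab : cross z a b by rewrite /cross ab ltnNge (ltnW zba).
  pose Q k := [exists c : 'I_N, (m c == k :> nat) && (c <= a)].
  have Qa : Q (m a) by apply/existsP; exists a; rewrite eqxx leqnn.
  have QbF : ~~ Q (m b).
    by apply/existsP => -[c /andP[/eqP/val_inj/perm_inj-> ?]]; lia.
  have [k [ka kb /existsP[c /andP[/eqP mc ca]] QSk]] :=
    discrete_ivt (ltnW mab) Qa QbF.
  have kN : k.+1 < N by have := ltn_ord (m b); lia.
  pose d := m^-1 (Ordinal kN).
  have md : m d = k.+1 :> nat by rewrite permKV.
  have ad : a < d.
    rewrite ltnNge; apply: contra QSk => da; apply/existsP; exists d.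
    by rewrite md eqxx.
  (* [c] and [d] are neighbours after [m], and any [w] above both [m] and [z] crosses them because
     [w d <= w b < w a <= w c]. *)
  have cw w : prefix_le m w -> prefix_le z w -> cross w c d.
    move=> mw zw; have wba : w b < w a.
      by rewrite -cross_lt //; apply: zw.
    have wca : w a <= w c.
      have [->//|ac] := eqVneq c a.
      have lca : c < a by rewrite ltn_neqAle ca andbT val_eqE.
      have mac : m a < m c.
        by rewrite ltn_neqAle mc ka andbT -mc val_eqE (inj_eq perm_inj) eq_sym.
      by apply: ltnW; rewrite -cross_lt //; apply: mw; rewrite cross_lt.
    have wbd : w d <= w b.
      have [->//|bd] := eqVneq d b.
      have mdb : m d < m b.
        by rewrite ltn_neqAle md kb andbT -md val_eqE (inj_eq perm_inj).
      have [|lbd|lda] := kind d; [by rewrite mdb andbT md ltnS| |lia].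
      by apply: ltnW; rewrite -cross_lt //; apply: mw; rewrite cross_lt.
    by rewrite cross_lt; [lia|apply: leq_ltn_trans ad].
  by apply: (local c d); [lia|rewrite md mc|apply: cw|apply: cw].
have lt_main (a b : 'I_N) : a < b -> cross z a b -> cross m a b.
  move=> ab; rewrite !cross_lt // => zba; rewrite ltnNge; apply/negP.
  rewrite leq_eqVlt => /orP[/eqP/val_inj/perm_inj ba|mab].
    by rewrite ba ltnn in ab.
  by have := main _ _ _ (leqnn _) ab mab; lia.
move=> a b zab; have [ab|ba|/val_inj ab] := ltngtP a b; first exact: lt_main.
  by rewrite cross_sym; apply: lt_main; rewrite // cross_sym.
by rewrite ab cross_id in zab.
Qed.

(** * The action of the braid group on left-weighted sequences *)

(** The complement [s^-1 * flip N] crosses exactly the pairs that [s] has left uncrossed, so a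
    permutation can be appended to [s] when it lies below this complement. *)
Lemma reduced_flip N (s m : 'S_N) : reduced s m <-> prefix_le m (s^-1 * flip N).
Proof.
split=> [sm a b mab|ms a b sab /ms]; last first.
  by rewrite cross_quot cross_flip (cross_neq sab) sab.
rewrite -[a](permKV s) -[b](permKV s) cross_quot cross_flip (inj_eq perm_inj)
  (cross_neq mab) addbT.
by apply/negP => /sm; rewrite !permKV => /(_ mab).
Qed.

Lemma absorbed_ex N (s x : 'S_N) : exists m, [/\ reduced s m, prefix_le m x &
  forall z, reduced s z -> prefix_le z x -> prefix_le z m].
Proof.
have [m [mu mx mP]] := prefix_meet (s^-1 * flip N) x; exists m; split=> //.
  exact/reduced_flip.
by move=> z /reduced_flip; apply: mP.
Qed.

(* The largest prefix of [x] that can be appended to [s] with a simple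
   result. *)
Definition absorbed N (s x : 'S_N) : 'S_N := projT1 (cid (absorbed_ex s x)).

Lemma absorbedP N (s x : 'S_N) : [/\ reduced s (absorbed s x),
  prefix_le (absorbed s x) x &
  forall z, reduced s z -> prefix_le z x -> prefix_le z (absorbed s x)].
Proof. by rewrite /absorbed; case: cid. Qed.

Lemma reduced_absorbed N (s x : 'S_N) : reduced s (absorbed s x).
Proof. by have [] := absorbedP s x. Qed.
Arguments reduced_absorbed [N] s x.

Lemma absorbed_le N (s x : 'S_N) : prefix_le (absorbed s x) x.
Proof. by have [] := absorbedP s x. Qed.
Arguments absorbed_le [N] s x.

Lemma absorbed_max N (s x z : 'S_N) :
  reduced s z -> prefix_le z x -> prefix_le z (absorbed s x).
Proof. by have [_ _] := absorbedP s x; apply. Qed.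

Lemma absorbed_eq N (s x m : 'S_N) : reduced s m -> prefix_le m x ->
  (forall z, reduced s z -> prefix_le z x -> prefix_le z m) -> absorbed s x = m.
Proof.
move=> sm mx mP; apply: prefix_le_anti; last exact: absorbed_max.
by apply: mP; [apply: reduced_absorbed|apply: absorbed_le].
Qed.

(** What [s] absorbs from [t * absorbed t x] contains [t]; after division by [t] it is a prefix of
    [x] that can be appended to [s * t], and the greatest such prefix is attained. *)
Lemma absorbedM N (s t x : 'S_N) : reduced s t ->
  absorbed s (t * absorbed t x) = t * absorbed (s * t) x.
Proof.
move=> st; set m := absorbed (s * t) x; set y := t * _.
have [tm stm] := (reducedA m st).1 (reduced_absorbed _ _).
have ty : prefix_le t y by apply/prefix_le_mul/reduced_absorbed.
apply: absorbed_eq => // [|z sz zy].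
  by apply: prefix_le_mull; [|apply: reduced_absorbed|apply: absorbed_max =>
    //; apply: absorbed_le].
have tz : prefix_le t (absorbed s y) by apply: absorbed_max.
apply: prefix_le_trans (absorbed_max sz zy) _; set a := absorbed s y.
have taV := reduced_quot tz; rewrite -[X in prefix_le X](mulKVg t) -/a in taV *.
apply: prefix_le_mull => //.
apply: absorbed_max.
  by apply/reducedA => //; split=> //; rewrite mulKVg; apply: reduced_absorbed.
apply: prefix_le_trans (absorbed_le t x).
apply: (prefix_le_mulK taV (reduced_absorbed _ _)); rewrite mulKVg.
exact: absorbed_le.
Qed.

Definition residue N (s x : 'S_N) : 'S_N := (absorbed s x)^-1 * x.

Lemma absorbed_residue N (s x : 'S_N) : absorbed s x * residue s x = x.
Proof. by rewrite /residue mulKVg. Qed.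

Lemma residueM N (s t x : 'S_N) : reduced s t ->
  residue s (t * absorbed t x) * residue t x = residue (s * t) x.
Proof.
move=> st; rewrite /residue absorbedM // invMg !mulgA.
by rewrite -(mulgA _ t^-1) mulVg mulg1 -(mulgA _ (absorbed t x)) mulgV mulg1.
Qed.

Lemma reduced_residue N (s t x : 'S_N) : reduced s t ->
  reduced (residue s (t * absorbed t x)) (residue t x).
Proof.
move=> st; have [tm _] := (reducedA _ st).1 (reduced_absorbed (s * t) x).
have le_m : prefix_le (absorbed (s * t) x) (absorbed t x).
  exact: absorbed_max (absorbed_le _ _).
have := reduced_quot (absorbed_le t x).
rewrite -{1}(mulKVg (absorbed (s * t) x) (absorbed t x)).
case/(reducedA _ (reduced_quot le_m)) => mr _.
by rewrite /residue absorbedM // invMg -mulgA mulKg.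
Qed.

(** The remainder arriving at position [n]: it absorbs what it can from [f n], and the residue of
    [f n] travels on. Sequences are infinite, finite normal forms being padded with 1, so that no
    remainder runs off the end. *)
Fixpoint carry N (s : 'S_N) (f : nat -> 'S_N) n : 'S_N :=
  if n is n'.+1 then residue (carry s f n') (f n') else s.

(* Left multiplication by a simple braid, on sequences of simple braids. *)
Definition nf_act N (s : 'S_N) (f : nat -> 'S_N) n : 'S_N :=
  carry s f n * absorbed (carry s f n) (f n).

(** The invariant behind [nf_actM]: at each position the remainders of the two successive actions
    can be merged into the remainder of the action by [s * t]. *)
Lemma carryM N (s t : 'S_N) f n : reduced s t ->
  reduced (carry s (nf_act t f) n) (carry t f n) /\
  carry s (nf_act t f) n * carry t f n = carry (s * t) f n.
Proof.
move=> st; elim: n => [//|n [IHa IHm]] /=.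
by rewrite -IHm -residueM // /nf_act; split=> //; apply: reduced_residue.
Qed.

Lemma nf_actM N (s t : 'S_N) f : reduced s t -> nf_act s (nf_act t f) = nf_act
  (s * t) f.
Proof.
move=> st; apply/funext => n; rewrite {1 3}/nf_act.
have [sta <-] := carryM f n st.
by rewrite {2}/nf_act absorbedM // mulgA.
Qed.

Lemma absorbed1 N (x : 'S_N) : absorbed 1 x = x.
Proof. by apply: absorbed_eq => // a b; rewrite cross1. Qed.

Lemma nf_act1 N (f : nat -> 'S_N) : nf_act 1 f = f.
Proof.
apply/funext => n; rewrite /nf_act; suff -> : carry 1 f n = 1.
  by rewrite absorbed1 mul1g.
by elim: n => //= n ->; rewrite /residue absorbed1 mulVg.
Qed.

(* No crossing at the start of [t] can be moved to the end of [s]. *)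
Definition weighted N (s t : 'S_N) : Prop := absorbed s t = 1.

Definition weighted_seq N (f : nat -> 'S_N) : Prop :=
  forall n, weighted (f n) (f n.+1).

(** A nontrivial prefix of [t] that can be appended to [s] inverts two adjacent positions, so it
    suffices to compare the descents of [t] with those of [s^-1]. *)
Lemma weightedP N (s t : 'S_N) : 
  (forall i : 'I_N.-1, t (pos_r i) < t (pos_l i) -> s^-1 (pos_r i) < s^-1
    (pos_l i)) ->
  weighted s t.
Proof.
move=> st; apply: absorbed_eq; [exact: reduced1|exact: prefix_le1|].
move=> z sz zt; suff -> : z = 1 by [].
apply: perm_increasing1 => i; rewrite ltnNge leq_eqVlt negb_or; apply/andP;
  split.
  by rewrite val_eqE (inj_eq perm_inj) -val_eqE /=; lia.
have lr : pos_l i < pos_r i by rewrite /=.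
apply/negP => zlr; have zc : cross z (pos_l i) (pos_r i) by rewrite cross_lt.
have tlr := zt _ _ zc; rewrite cross_lt // in tlr.
have slr := st _ tlr.
by apply: (sz (s^-1 (pos_l i)) (s^-1 (pos_r i))); rewrite ?permKV // cross_sym
  cross_lt // !permKV.
Qed.

(** Suppose [e] can move left between two new entries. As [y] gives nothing to [x], [e] is a prefix
    of the residue [r] of [x]; then [mx * e] is a prefix of [x] that the remainder [c] can absorb,
    and maximality of [mx] forces [e = 1]. *)
Lemma nf_act_weighted N (s : 'S_N) f : weighted_seq f -> weighted_seq (nf_act s
  f).
Proof.
move=> fw n; rewrite /nf_act /=; set c := carry s f n; set x := f n.
set y := f n.+1; set r := residue c x.
apply: absorbed_eq; [exact: reduced1|exact: prefix_le1|] => e ce er.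
set mx := absorbed c x in ce *.
have mxr : reduced mx r by apply/reduced_quot/absorbed_le.
have [mxe cmxe] := (reducedA e (reduced_absorbed c x)).1 ce.
have le_r : prefix_le e r.
  have := absorbed_max mxe er; rewrite absorbedM // absorbed_residue.
  by rewrite (fw n : absorbed x y = 1) mulg1.
apply: (prefix_le_mulK mxe (reduced1 mx)); rewrite mulg1.
apply: absorbed_max => //; rewrite -[X in prefix_le _ X](absorbed_residue c).
exact: prefix_le_mull.
Qed.

Definition scons N (s : 'S_N) (f : nat -> 'S_N) n : 'S_N :=
  if n is n'.+1 then f n' else s.

Lemma nf_act_scons N (s : 'S_N) f :
  weighted_seq f -> weighted s (f 0) -> nf_act s f = scons s f.
Proof.
move=> fw sf; have cE n : carry s f n = scons s f n.
  by elim: n => //= -[_|n ->] /=; rewrite /residue ?sf ?fw invg1 mul1g.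
apply/funext => n; rewrite /nf_act cE.
by case: n => [|n] /=; rewrite ?sf ?fw mulg1.
Qed.

Lemma weighted_flipl N (s : 'S_N) : weighted (flip N) s.
Proof.
apply: weightedP => i _; rewrite flipV !flipE /=.
by have := ltn_ord i; lia.
Qed.

Lemma nf_act_flip N (f : nat -> 'S_N) :
  weighted_seq f -> nf_act (flip N) f = scons (flip N) f.
Proof. by move=> fw; apply: nf_act_scons => //; apply: weighted_flipl. Qed.

Definition conj_flip N (s : 'S_N) : 'S_N := flip N * s * flip N.

Lemma conj_flipK N : involutive (@conj_flip N).
Proof. by move=> s; rewrite /conj_flip !mulgA flipK mul1g -mulgA flipK mulg1.
  Qed.

(** [s] grows to [Delta] by absorbing its own complement, and what is left of the old [Delta] is the
    flip conjugate of [s]. *)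
Lemma nf_act_scons_flip N (s : 'S_N) f :
  nf_act s (scons (flip N) f) = scons (flip N) (nf_act (conj_flip s) f).
Proof.
have aE : absorbed s (flip N) = s^-1 * flip N.
  apply: absorbed_eq; first by apply/reduced_flip.
    exact: prefix_le_flip.
  by move=> z /reduced_flip.
have cE n : carry s (scons (flip N) f) n.+1 = carry (conj_flip s) f n.
  elim: n => [|n IH]; last by rewrite -[LHS]/(residue (carry s _ n.+1) (f n))
    IH.
  by rewrite /= /residue aE invMg invgK flipV.
apply/funext => -[|n]; first by rewrite /nf_act /= aE mulKVg.
by rewrite /nf_act cE.
Qed.

Lemma scons_inj N (s : 'S_N) : injective (scons s).
Proof. by move=> f g fg; apply/funext => n; have := congr1 (@^~ n.+1) fg. Qed.

Lemma weighted_scons N (s : 'S_N) f :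
  weighted_seq f -> weighted s (f 0) -> weighted_seq (scons s f).
Proof. by move=> fw sf [|n] //=; apply: fw. Qed.

(** * Letters, words and the defining relations *)

Lemma reduced_transp N (i : 'I_N.-1) (s : 'S_N) :
  reduced (transp i) s <-> s (pos_l i) < s (pos_r i).
Proof.
have lr : pos_l i < pos_r i by rewrite /=.
have rl : cross s (pos_r i) (pos_l i) = ~~ (s (pos_l i) < s (pos_r i)).
  rewrite cross_sym cross_lt // ord_neq // (inj_eq perm_inj) -val_eqE /=.
  by apply/eqP; lia.
split=> [ts|slr a b].
  rewrite -[_ < _]negbK -rl; apply/negP => rl_cross.
  apply: (ts (pos_l i) (pos_r i)); first by rewrite cross_transp /= !eqxx.
  by rewrite /transp tpermL tpermR.
rewrite cross_transp => /orP[]/andP[/eqP E1 /eqP E2].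
  have -> : a = pos_l i by apply: val_inj.
  have -> : b = pos_r i by apply: val_inj.
  by rewrite /transp tpermL tpermR rl slr.
have -> : a = pos_r i by apply: val_inj.
have -> : b = pos_l i by apply: val_inj.
by rewrite /transp tpermL tpermR cross_sym rl slr.
Qed.

(** An inverse generator acts as its product with the central square of [Delta]:
    [flip N * transp a.1] is the permutation of the simple braid [Delta] times the inverse
    generator. *)
Definition letter_act N (a : 'I_N.-1 * bool) (f : nat -> 'S_N) : nat -> 'S_N :=
  if a.2 then nf_act (transp a.1) f
  else nf_act (flip N) (nf_act (flip N * transp a.1) f).

Definition word_act N (w : word N) (f : nat -> 'S_N) : nat -> 'S_N :=
  foldr (@letter_act N) f w.

Definition full_twist_act N (f : nat -> 'S_N) : nat -> 'S_N :=
  nf_act (flip N) (nf_act (flip N) f).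

(** The number of surplus full twists in [word_act w]. *)
Definition negatives N (w : word N) : nat := count (fun a => ~~ a.2) w.

Lemma word_act_weighted N (w : word N) f :
  weighted_seq f -> weighted_seq (word_act w f).
Proof.
move=> fw; elim: w => //= -[i []] w IH; rewrite /letter_act /=.
  exact: nf_act_weighted.
by do 2!apply: nf_act_weighted.
Qed.

Lemma full_twist_act_weighted N n (f : nat -> 'S_N) :
  weighted_seq f -> weighted_seq (iter n (@full_twist_act N) f).
Proof. by move=> fw; elim: n => //= n IH; do 2!apply: nf_act_weighted. Qed.

Lemma nf_act_flip_inj N (f g : nat -> 'S_N) : nf_act (flip N) f = nf_act (flip
  N) g ->
  weighted_seq f -> weighted_seq g -> f = g.
Proof. by move=> fg fw gw; move: fg; rewrite !nf_act_flip // => /scons_inj. Qed.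

Lemma full_twist_act_inj N n (f g : nat -> 'S_N) :
  weighted_seq f -> weighted_seq g ->
  iter n (@full_twist_act N) f = iter n (@full_twist_act N) g -> f = g.
Proof.
move=> fw gw; elim: n => //= n IH.
have fw' := full_twist_act_weighted n fw; have gw' := full_twist_act_weighted n
  gw.
by move=> E; apply: IH; do 2!apply: nf_act_flip_inj => //; apply:
  nf_act_weighted.
Qed.

Lemma nf_act_flip_conj N (s : 'S_N) f : weighted_seq f ->
  nf_act s (nf_act (flip N) f) = nf_act (flip N) (nf_act (conj_flip s) f).
Proof.
move=> fw; rewrite !nf_act_flip ?nf_act_scons_flip //; exact: nf_act_weighted.
Qed.

Lemma nf_act_full_twist N (s : 'S_N) f : weighted_seq f ->
  nf_act s (full_twist_act f) = full_twist_act (nf_act s f).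
Proof.
move=> fw; have sfw : weighted_seq (nf_act s f) by apply: nf_act_weighted.
rewrite /full_twist_act !nf_act_flip_conj ?conj_flipK //; exact:
  nf_act_weighted.
Qed.

Lemma word_act_full_twist N (w : word N) n f : weighted_seq f ->
  word_act w (iter n (@full_twist_act N) f) = iter n (@full_twist_act N)
    (word_act w f).
Proof.
move=> fw; elim: w => //= -[i e] w ->.
have := word_act_weighted w fw; move: (word_act w f) => g gw.
elim: n => //= n <-; rewrite /letter_act /=.
by case: e; rewrite !nf_act_full_twist //; do ?[apply: nf_act_weighted|apply:
  full_twist_act_weighted].
Qed.

Lemma reduced_compl N (s : 'S_N) : reduced s (s^-1 * flip N).
Proof. exact/reduced_quot/prefix_le_flip. Qed.

Lemma transpV N (i : 'I_N.-1) : (transp i)^-1 = transp i.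
Proof. exact: tpermV. Qed.

(** Each side receives the surplus twists of the other word, so that both contain the same number of
    them. *)
Lemma word_act_rel N (u v : word N) f : braid_rel u v -> weighted_seq f ->
  iter (negatives v) (@full_twist_act N) (word_act u f) =
  iter (negatives u) (@full_twist_act N) (word_act v f).
Proof.
move=> uv; elim: uv f => {u v} //.
- by move=> u v _ IH f fw; rewrite IH.
(* The twists of the middle word [v] appear on both sides and are cancelled by injectivity. *)
- move=> u v w _ IHu _ IHv f fw.
  apply: (@full_twist_act_inj _ (negatives v)).
  - exact/full_twist_act_weighted/word_act_weighted.
  - exact/full_twist_act_weighted/word_act_weighted.
  by rewrite -!iterD addnC iterD IHu // -iterD addnC iterD IHv // -!iterD addnC.
- move=> a b u v _ IH f fw.
  rewrite /negatives !count_cat -!/(negatives _) /word_act !foldr_cat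
    -!/(word_act _ _).
  set g := word_act b f; have gw : weighted_seq g by apply: word_act_weighted.
  have := congr1 (word_act a) (IH g gw).
  rewrite !word_act_full_twist //; try by apply: word_act_weighted.
  move=> E; rewrite !(addnC (negatives a)) -!(addnA _ (negatives b)) !(addnC _
    (negatives b + negatives a)%N).
  by rewrite !iterD E.
- move=> i e f fw; rewrite /negatives /= /letter_act /=; case: e => /=.
    rewrite nf_act_flip_conj; last exact: nf_act_weighted.
    rewrite (nf_actM f); last first.
      have := @reduced_compl _ (conj_flip (transp i)).
      by rewrite /conj_flip !invMg flipV transpV -!mulgA flipK mulg1.
    by rewrite /conj_flip -!mulgA (mulgA (flip N) (flip N)) flipK mul1g /transp
      tperm2 mulg1.
  rewrite (nf_actM f); last first.
    have := @reduced_compl _ (flip N * transp i).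
    by rewrite invMg flipV -mulgA flipK mulg1 transpV.
  by rewrite -mulgA /transp tperm2 mulg1.
(* In both braid relations all words are reduced, so each side acts as a single permutation. *)
- move=> i j ij f fw; rewrite /negatives /= /letter_act /= !nf_actM.
  + congr nf_act; apply/permP => x; rewrite !permM; apply/val_inj => /=.
    by apply: (step_far ij); apply: stepP.
  + apply/reduced_transp.
    move: (stepP i (pos_l j)) (stepP i (pos_r j)); rewrite /step /transp /=.
    by move: (nat_of_ord (tperm _ _ _)) (nat_of_ord (tperm _ _ _)) => *; lia.
  apply/reduced_transp.
  move: (stepP j (pos_l i)) (stepP j (pos_r i)); rewrite /step /transp /=.
  by move: (nat_of_ord (tperm _ _ _)) (nat_of_ord (tperm _ _ _)) => *; lia.
- move=> i j ij f fw; rewrite /negatives /= /letter_act /= !(nf_actM f).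
  + congr nf_act; apply/permP => x; rewrite !permM; apply/val_inj => /=.
    by apply: (step_adj ij); apply: stepP.
  + apply/reduced_transp; rewrite !permM /transp.
    move: (stepP i (pos_l j)) (stepP i (pos_r j)).
    move: (stepP j (tperm (pos_l i) (pos_r i) (pos_l j))).
    move: (stepP j (tperm (pos_l i) (pos_r i) (pos_r j))); rewrite /step /=.
    by do 4!move: (nat_of_ord (tperm _ _ _)) => ?; lia.
  + apply/reduced_transp; rewrite /transp.
    move: (stepP j (pos_l i)) (stepP j (pos_r i)); rewrite /step /=.
    by move: (nat_of_ord (tperm _ _ _)) (nat_of_ord (tperm _ _ _)) => *; lia.
  + apply/reduced_transp; rewrite !permM /transp.
    move: (stepP j (pos_l i)) (stepP j (pos_r i)).
    move: (stepP i (tperm (pos_l j) (pos_r j) (pos_l i))).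
    move: (stepP i (tperm (pos_l j) (pos_r j) (pos_r i))); rewrite /step /=.
    by do 4!move: (nat_of_ord (tperm _ _ _)) => ?; lia.
  apply/reduced_transp; rewrite /transp.
  move: (stepP i (pos_l j)) (stepP i (pos_r j)); rewrite /step /=.
  by move: (nat_of_ord (tperm _ _ _)) (nat_of_ord (tperm _ _ _)) => *; lia.
Qed.

Lemma nf_act_pos_rel N (u v : seq 'I_N.-1) f :
  of_word (pos_word u) = of_word (pos_word v) -> weighted_seq f ->
  word_act (pos_word u) f = word_act (pos_word v) f.
Proof.
have neg0 (w : seq 'I_N.-1) : negatives (pos_word w) = 0%N.
  by rewrite /negatives count_map; apply/eqP; rewrite -leqn0 leqNgt -has_count;
    apply/hasPn.
by move=> /of_wordP uv /(word_act_rel uv); rewrite !neg0.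
Qed.

(** * Matsumoto's theorem and uniqueness of normal forms *)

Definition wperm N (w : seq 'I_N.-1) : 'S_N := word_perm (pos_word w).

Lemma wperm_cons N (i : 'I_N.-1) w : wperm (i :: w) = transp i * wperm w.
Proof. by rewrite /wperm /word_perm /= big_cons. Qed.

Lemma wperm_nil N : wperm [::] = 1 :> 'S_N.
Proof. by rewrite /wperm /word_perm big_nil. Qed.

Lemma cross_transpE N (i : 'I_N.-1) a b : a != b ->
  ([set a; b] == [set pos_l i; pos_r i])%SET = cross (transp i) a b.
Proof.
move=> ab; rewrite cross_transp; apply/eqP/orP => [E|[]/andP[/eqP E1 /eqP E2]].
- have := set21 a b; have := set22 a b; rewrite E !inE -!val_eqE /=.
  by move: ab; rewrite -val_eqE /=; lia.
- by congr ([set _; _])%SET; apply: val_inj.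
- by rewrite finset.setUC; congr ([set _; _])%SET; apply: val_inj.
Qed.

Definition reduced_word N (w : seq 'I_N.-1) : Prop :=
  forall a b, a != b -> crossings w a b <= 1.

Lemma odd_crossings N (w : seq 'I_N.-1) a b : a != b ->
  odd (crossings w a b) = cross (wperm w) a b.
Proof.
elim: w a b => [|i w IH] a b ab /=; first by rewrite wperm_nil cross1.
rewrite wperm_cons crossM oddD IH ?(inj_eq perm_inj) // cross_transpE //.
by case: cross.
Qed.

Lemma crossings_reduced N (w : seq 'I_N.-1) a b : a != b ->
  reduced_word w -> crossings w a b = cross (wperm w) a b :> nat.
Proof.
move=> ab /(_ a b ab); rewrite -odd_crossings //.
by case: crossings => [|[]].
Qed.

Lemma reduced_word_cons N (i : 'I_N.-1) w :
  reduced_word (i :: w) <-> reduced_word w /\ reduced (transp i) (wperm w).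
Proof.
split=> [iw|[rw riw] a b ab /=].
  have rw : reduced_word w.
    move=> a b ab; rewrite -[a](permK (transp i)) -[b](permK (transp i))
      transpV.
    apply: leq_trans (iw (transp i a) (transp i b) _); rewrite ?(inj_eq
      perm_inj) //=.
    exact: leq_addl.
  split=> // a b iab; have ab := cross_neq iab; have := iw _ _ ab => /=.
  rewrite -/(transp i) (crossings_reduced _ rw) ?(inj_eq perm_inj) //.
  by rewrite cross_transpE // iab; case: cross.
rewrite -/(transp i) (crossings_reduced _ rw) ?(inj_eq perm_inj) //
  cross_transpE //.
by have := riw a b; case: cross => //; case: cross => // /(_ isT isT).
Qed.

Lemma reduced_word_of_perm N (s : 'S_N) :
  exists2 w : seq 'I_N.-1, wperm w = s & reduced_word w.
Proof.
have [w ws wc] := pos_word_of_perm s; exists w => // a b ab.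
by rewrite wc //; case: addb.
Qed.

Lemma reduced_word1 N (w : seq 'I_N.-1) : reduced_word w -> wperm w = 1 -> w =
  [::].
Proof.
case: w => // i w /reduced_word_cons[_ /reduced_transp] + E.
have -> : wperm w = transp i.
  by rewrite -[RHS]mulg1 -E wperm_cons mulgA tperm2 mul1g.
by rewrite tpermL tpermR /= ltnNge leqnSn.
Qed.

Lemma size_braid_rel N (u v : seq 'I_N.-1) :
  braid_rel (pos_word u) (pos_word v) -> size u = size v.
Proof.
by move=> /of_wordP E; apply/eqP; rewrite -eqz_nat -!crossing_number_pos E.
Qed.

Lemma braid_rel_cons N (i : 'I_N.-1) (u v : seq 'I_N.-1) :
  braid_rel (pos_word u) (pos_word v) ->
  braid_rel (pos_word (i :: u)) (pos_word (i :: v)).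
Proof. by move=> uv; have := braid_cat (pos_word [:: i]) [::] uv; rewrite
  !cats0. Qed.

Lemma braid_rel_front N (u u' v : seq 'I_N.-1) :
  braid_rel (pos_word u) (pos_word u') ->
  braid_rel (pos_word (u ++ v)) (pos_word (u' ++ v)).
Proof. by move=> uu'; rewrite /pos_word !map_cat; apply: (braid_cat [::]). Qed.

(** Two descents force [s] to begin with the least common multiple of the two generators. Both words
    continue it by the same remainder [w], hence differ by one defining relation. *)
Lemma exchange_words N (i j : 'I_N.-1) (s : 'S_N) : i < j ->
  s (pos_r i) < s (pos_l i) -> s (pos_r j) < s (pos_l j) ->
  exists u v : seq 'I_N.-1,
    [/\ reduced_word (i :: u), wperm (i :: u) = s, reduced_word (j :: v),
        wperm (j :: v) = s & braid_rel (pos_word (i :: u)) (pos_word (j :: v))].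
Proof.
move=> ij si sj.
have [far|adj] : i.+1 < j \/ j = i.+1 :> nat by lia.
- have [w ws rw] := reduced_word_of_perm (transp j * (transp i * s)).
  have [jl ir] : pos_l j != pos_l i /\ pos_l j != pos_r i.
    by rewrite -!val_eqE /=; split; lia.
  have [jr rr] : pos_r j != pos_l i /\ pos_r j != pos_r i.
    by rewrite -!val_eqE /=; split; lia.
  have tC : transp i * transp j = transp j * transp i :> 'S_N.
    have := word_perm_rel (braid_far far).
    by rewrite -!/(wperm _) !wperm_cons !wperm_nil !mulg1.
  have wsi : wperm (j :: w) = transp i * s.
    by rewrite wperm_cons ws mulgA tperm2 mul1g.
  have wsj : wperm (i :: w) = transp j * s.
    by rewrite wperm_cons ws mulgA tC -!mulgA (mulgA (transp i)) tperm2 mul1g.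
  exists (j :: w), (i :: w); split.
  + rewrite !reduced_word_cons wsi ws; split; [split=> //|];
      apply/reduced_transp.
      by rewrite !permM /transp tpermL tpermR !tpermD // eq_sym.
    by rewrite !permM /transp tpermL tpermR.
  + by rewrite wperm_cons wsi mulgA tperm2 mul1g.
  + rewrite !reduced_word_cons wsj ws; split; [split=> //|];
      apply/reduced_transp.
      by rewrite !permM /transp [tperm (pos_l j) _ _]tpermD // [tperm (pos_l j)
        _ _]tpermD // tpermL tpermR.
    by rewrite !permM /transp tpermL tpermR.
  + by rewrite wperm_cons wsj mulgA tperm2 mul1g.
  exact: (braid_rel_front w (braid_far far)).
have bE : pos_l j = pos_r i by apply: val_inj.
have [ab ac] : pos_l i != pos_r i /\ pos_l i != pos_r j.
  by rewrite -!val_eqE /=; split; lia.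
have bc : pos_r i != pos_r j by rewrite -val_eqE /=; lia.
have tC : transp i * (transp j * transp i) = transp j * (transp i * transp j)
  :> 'S_N.
  have := word_perm_rel (braid_adj adj).
  by rewrite -!/(wperm _) !wperm_cons !wperm_nil !mulg1.
have [w ws rw] := reduced_word_of_perm (transp i * (transp j * (transp i * s))).
have ws' : wperm w = transp j * (transp i * (transp j * s)).
  by rewrite ws !mulgA -(mulgA (transp i)) tC !mulgA.
have sV k (t : 'S_N) : transp k * (transp k * t) = t by rewrite mulgA tperm2
  mul1g.
rewrite bE in sj.
have tac : tperm (pos_l i) (pos_r i) (pos_r j) = pos_r j by rewrite tpermD.
have tca : tperm (pos_r i) (pos_r j) (pos_l i) = pos_l i by rewrite tpermD //
  eq_sym.
exists (j :: i :: w), (i :: j :: w); split.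
- rewrite !reduced_word_cons !wperm_cons ws sV; split; [split; [split=> //|]|];
    apply/reduced_transp; rewrite !permM /transp ?bE ?(tac, tca, tpermL,
      tpermR) //;
    exact: ltn_trans sj si.
- by rewrite !wperm_cons ws !sV.
- rewrite !reduced_word_cons !wperm_cons ws' sV; split; [split; [split=> //|]|];
    apply/reduced_transp; rewrite !permM /transp ?bE ?(tac, tca, tpermL,
      tpermR) //;
    exact: ltn_trans sj si.
- by rewrite !wperm_cons ws' !sV.
exact: (braid_rel_front w (braid_adj adj)).
Qed.

(* Matsumoto's theorem for the symmetric group. *)
Lemma reduced_word_unique N (u v : seq 'I_N.-1) :
  reduced_word u -> reduced_word v -> wperm u = wperm v ->
  braid_rel (pos_word u) (pos_word v).
Proof.
have [n] := ubnP (size u); elim: n u v => // n IH [|i u] v.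
  move=> _ _ rv; rewrite wperm_nil => /esym/(reduced_word1 rv) ->.
  exact: braid_refl.
case: v => [|j v].
  by move=> _ ru _; rewrite wperm_nil => /(reduced_word1 ru).
move=> szu riu rjv E.
have cancel k (u' v' : seq 'I_N.-1) : wperm (k :: u') = wperm (k :: v') ->
  wperm u' = wperm v'.
  by rewrite !wperm_cons => /mulgI.
have [/reduced_word_cons[ru iu] /reduced_word_cons[rv jv]] := (riu, rjv).
have desc k w : reduced (transp k) (wperm w) ->
    wperm (k :: w) (pos_r k) < wperm (k :: w) (pos_l k).
  by move=> /reduced_transp; rewrite wperm_cons !permM tpermL tpermR.
(* [i :: u0] and [j :: v0] interpolate between the given words: they have the same permutation and
   are already related, so that the induction applies to the tails. *)
have [u0 [v0 [ru0 Eu0 rv0 Ev0 rel]]] : exists u0 v0,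
    [/\ reduced_word (i :: u0), wperm (i :: u0) = wperm (i :: u),
        reduced_word (j :: v0), wperm (j :: v0) = wperm (i :: u) &
        braid_rel (pos_word (i :: u0)) (pos_word (j :: v0))].
  have [ij|ji|/val_inj ij] := ltngtP i j.
  - by apply: exchange_words; [|apply: desc|rewrite E; apply: desc].
  - have [||u0 [v0 [? ? ? ? ?]]] := @exchange_words _ j i (wperm (i :: u)) ji.
    + by rewrite E; apply: desc.
    + exact: desc.
    by exists v0, u0; split=> //; apply: braid_sym.
  - by exists u, u; rewrite -ij; split=> //; apply: braid_refl.
have [/reduced_word_cons[ru0' _] /reduced_word_cons[rv0' _]] := (ru0, rv0).
have uu0 : braid_rel (pos_word u) (pos_word u0).
  by apply: IH => //; apply: (cancel i).
have szv0 : size v0 < n.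
  by have := size_braid_rel rel; have := size_braid_rel uu0; move: szu => /=;
    lia.
have vv0 : braid_rel (pos_word v0) (pos_word v).
  by apply: IH => //; apply: (cancel j); rewrite Ev0.
apply: braid_trans (braid_rel_cons i uu0) (braid_trans rel _).
exact: braid_rel_cons.
Qed.

(** * Simple braids, permutations and uniqueness of normal forms *)

Lemma simpleP N (x : braid N) : simple x <->
  exists2 w, x = of_word (pos_word w) & reduced_word w.
Proof. by []. Qed.

Lemma simple_eq N (x y : braid N) :
  simple x -> simple y -> braid_perm x = braid_perm y -> x = y.
Proof.
move=> [u -> ru] [v -> rv]; rewrite !braid_perm_word => E.
exact/of_wordP/reduced_word_unique.
Qed.

Lemma simple_simple_braid N (s : 'S_N) : simple (simple_braid s).
Proof. by have [] := simple_braidP s. Qed.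

Lemma perm_simple_braid N (s : 'S_N) : braid_perm (simple_braid s) = s.
Proof. by have [] := simple_braidP s. Qed.

Lemma simple_braid_perm N (x : braid N) : simple x -> simple_braid (braid_perm
  x) = x.
Proof.
move=> sx; apply: simple_eq; rewrite ?perm_simple_braid //.
exact: simple_simple_braid.
Qed.

Lemma simple_braid_word N (w : seq 'I_N.-1) :
  reduced_word w -> simple_braid (wperm w) = of_word (pos_word w).
Proof.
move=> rw; rewrite -[RHS]simple_braid_perm ?braid_perm_word //.
by apply/simpleP; exists w.
Qed.

Lemma reduced_word_cat N (u v : seq 'I_N.-1) :
  reduced_word u -> reduced_word v -> reduced (wperm u) (wperm v) ->
  wperm (u ++ v) = wperm u * wperm v /\ reduced_word (u ++ v).
Proof.
move=> + rv; elim: u => [|i u IH] /=; first by rewrite wperm_nil mul1g.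
move=> /reduced_word_cons[ru iu]; rewrite !wperm_cons => iuv.
have [uv iuv'] := (reducedA _ iu).1 iuv; have [-> ruv] := IH ru uv.
by rewrite mulgA reduced_word_cons; split=> //; split=> //; have [-> _] := IH
  ru uv.
Qed.

Lemma simple_braidM N (s t : 'S_N) : reduced s t ->
  simple_braid s * simple_braid t = simple_braid (s * t).
Proof.
have [u <- ru] := reduced_word_of_perm s; have [v <- rv] :=
  reduced_word_of_perm t.
move=> uv; have [<- ruv] := reduced_word_cat ru rv uv.
by rewrite !simple_braid_word // -of_wordM /pos_word map_cat.
Qed.

Lemma simple_braid1 N : simple_braid 1 = 1 :> braid N.
Proof.
rewrite -(wperm_nil N) simple_braid_word // => a b _.
Qed.

Lemma crossing_numberM N (x y : braid N) :
  crossing_number (x * y) = (crossing_number x + crossing_number y)%R.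
Proof.
rewrite -[x]of_wordK -[y]of_wordK -of_wordM !crossing_number_word.
by rewrite /word_expsum big_cat.
Qed.

Lemma crossing_number_simple N (s : 'S_N) :
  (0 <= crossing_number (simple_braid s))%R.
Proof.
by have [w <- rw] := reduced_word_of_perm s; rewrite simple_braid_word //
  crossing_number_pos.
Qed.

Lemma crossing_number_le N (s t : 'S_N) : prefix_le s t ->
  (crossing_number (simple_braid s) <= crossing_number (simple_braid t))%R.
Proof.
move=> st; rewrite -[t](mulKVg s) -simple_braidM; last exact: reduced_quot.
by rewrite crossing_numberM lerDl crossing_number_simple.
Qed.

Lemma word_act_reduced N (w : seq 'I_N.-1) f : reduced_word w ->
  word_act (pos_word w) f = nf_act (wperm w) f.
Proof.
elim: w => [|i w IH]; first by rewrite wperm_nil nf_act1.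
move=> /reduced_word_cons[rw iw]; rewrite wperm_cons -nf_actM // -IH //.
Qed.

Lemma nf_act_simple_braids N (l l' : seq 'S_N) f : weighted_seq f ->
  \prod_(s <- l) simple_braid s = \prod_(s <- l') simple_braid s ->
  foldr (@nf_act N) f l = foldr (@nf_act N) f l'.
Proof.
move=> fw.
have words (k : seq 'S_N) : exists2 w : seq 'I_N.-1,
    of_word (pos_word w) = \prod_(s <- k) simple_braid s &
    word_act (pos_word w) f = foldr (@nf_act N) f k.
  elim: k => [|s k [w wE aE]]; first by exists [::]; rewrite ?big_nil.
  have [u us ru] := reduced_word_of_perm s; exists (u ++ w).
    by rewrite big_cons -wE -us simple_braid_word // -of_wordM /pos_word
      map_cat.
  rewrite /pos_word map_cat /word_act foldr_cat -!/(word_act _ _) -!/(pos_word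
    _).
  by rewrite aE word_act_reduced // us.
have [u uE <-] := words l; have [v vE <-] := words l'.
by rewrite -uE -vE => /nf_act_pos_rel; apply.
Qed.

Definition weighted_list N (l : seq 'S_N) : Prop :=
  forall i, i.+1 < size l -> weighted (nth 1 l i) (nth 1 l i.+1).

Lemma weighted1 N (s : 'S_N) : weighted s 1.
Proof. by apply: weightedP => i; rewrite !perm1 /= ltnNge leqnSn. Qed.

(** Each factor finds nothing to absorb and is simply prepended, so a normal form can be read off
    from the action on the trivial sequence. *)
Lemma nf_act_weighted_list N (l : seq 'S_N) : weighted_list l ->
  foldr (@nf_act N) (fun=> 1) l = nth 1 l.
Proof.
move=> lw; have lw' n : weighted (nth 1 l n) (nth 1 l n.+1).
  have [/lw//|nl] := ltnP n.+1 (size l).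
  by rewrite (nth_default _ nl); apply: weighted1.
elim: l lw' {lw} => [|s l IH] lw; first by apply/funext => n; rewrite nth_nil.
have lw' : weighted_seq (nth 1 l) by move=> n; apply: (lw n.+1).
rewrite /= IH // nf_act_scons //; last exact: (lw 0).
by apply/funext => -[].
Qed.

(** The action only sees lists padded with 1, hence the hypothesis on the sizes. *)
Lemma weighted_list_inj N (l l' : seq 'S_N) :
  weighted_list l -> weighted_list l' -> size l = size l' ->
  \prod_(s <- l) simple_braid s = \prod_(s <- l') simple_braid s -> l = l'.
Proof.
move=> lw lw' szE E; have w1 : weighted_seq (fun=> 1 : 'S_N).
  by move=> n; apply: weighted1.
have := nf_act_simple_braids w1 E; rewrite !nf_act_weighted_list // => nE.
by apply: (@eq_from_nth _ 1) => // i _; rewrite nE.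
Qed.

(** Another factorization acts on the trivial sequence with the same result [s, t, 1, ...]; its
    first factor has become [s] by absorption, so it is a prefix of [s]. *)
Lemma weighted_left_weighted N (s t : 'S_N) :
  weighted s t -> left_weighted (simple_braid s) (simple_braid t).
Proof.
move=> st; split; try exact: simple_simple_braid.
move=> z1 z2 /simple_braid_perm <- /simple_braid_perm <-.
move: (braid_perm z1) (braid_perm z2) => p q E; apply: crossing_number_le.
have w1 : weighted_seq (fun=> 1 : 'S_N) by move=> n; apply: weighted1.
have := @nf_act_simple_braids _ [:: p; q] [:: s; t] _ w1.
rewrite !big_cons !big_nil !mulg1 => /(_ E)/(congr1 (@^~ 0)).
rewrite [RHS]/= (@nf_act_scons _ t) //; last exact: weighted1.
rewrite nf_act_scons //; last by apply: weighted_scons => //; apply: weighted1.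
move=> /= <-; exact/prefix_le_mul/reduced_absorbed.
Qed.

(** * Rotations of rigid braids *)

Lemma cross_conj_flip N (s : 'S_N) a b :
  cross (conj_flip s) a b = cross s (rev_ord a) (rev_ord b).
Proof.
have [->|ab] := eqVneq a b; first by rewrite !cross_id.
rewrite /conj_flip !crossM !cross_flip ab !flipE.
by rewrite (inj_eq perm_inj) ab addTb addbT negbK.
Qed.

Lemma conj_flipE N (s : 'S_N) a : conj_flip s a = rev_ord (s (rev_ord a)).
Proof. by rewrite !permM !flipE. Qed.

Lemma conj_flip1 N : conj_flip 1 = 1 :> 'S_N.
Proof. by rewrite /conj_flip mulg1 flipK. Qed.

Lemma conj_flip_flip N : conj_flip (flip N) = flip N.
Proof. by rewrite /conj_flip flipK mul1g. Qed.

Lemma weighted_conj_flip N (s t : 'S_N) :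
  weighted s t -> weighted (conj_flip s) (conj_flip t).
Proof.
move=> st; apply: absorbed_eq; [exact: reduced1|exact: prefix_le1|] => z sz zt.
suff -> : z = 1 by [].
rewrite -[z]conj_flipK -(conj_flip1 N); congr conj_flip.
apply: prefix_le_anti (prefix_le1 _); rewrite -[X in prefix_le _ X]st.
apply: absorbed_max => a b; last first.
  by rewrite cross_conj_flip => /zt; rewrite cross_conj_flip !rev_ordK.
move=> sab; rewrite cross_conj_flip => zab.
apply: (sz (rev_ord a) (rev_ord b)); first by rewrite cross_conj_flip !rev_ordK.
by rewrite !conj_flipE !rev_ordK.
Qed.

(** If [s'] is the complement of [s], then [Delta] is both [s . s'] and [s' . conj_flip s]. *)
Lemma simple_braid_Delta N (s : 'S_N) :
  simple_braid s * Delta N = Delta N * simple_braid (conj_flip s).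
Proof.
have sD : simple_braid s * simple_braid (s^-1 * flip N) = Delta N.
  by rewrite simple_braidM ?mulKVg //; apply: reduced_compl.
have Ds : simple_braid (s^-1 * flip N) * simple_braid (conj_flip s) = Delta N.
  have := @reduced_compl _ (s^-1 * flip N).
  rewrite invMg invgK flipV => /simple_braidM ->.
  by rewrite -!mulgA (mulgA (flip N) (flip N)) flipK mul1g mulKg.
by rewrite -{1}Ds mulgA sD.
Qed.

(* The list [l] encodes the braid with normal form [Delta . l_1 . l_2 ...]. *)
Definition braid_of N (l : seq 'S_N) : braid N :=
  Delta N * \prod_(s <- l) simple_braid s.

(** The flip conjugate of the head closes the list because the exponent of [Delta] is 1, hence
    odd. *)
Definition rigid_list N (l : seq 'S_N) : Prop :=
  [/\ l != [::], weighted_list (rcons l (conj_flip (head 1 l))) &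
      forall s, s \in l -> s != 1 /\ s != flip N].

Definition rotate N (l : seq 'S_N) : seq 'S_N :=
  if l is s :: l' then rcons l' (conj_flip s) else [::].

Lemma rigid_list_rigid N (l : seq 'S_N) : rigid_list l -> rigid (braid_of l).
Proof.
case: l => [[]//|s l] [_ lw nt].
exists (Posz 1), (simple_braid s), (map (@simple_braid N) l); split; last first.
  rewrite /= last_map.
  have -> : simple_braid s ^ Delta N = simple_braid (conj_flip s).
    by rewrite conjgE simple_braid_Delta mulKg.
  apply: weighted_left_weighted; have := lw (size l); rewrite size_rcons ltnSn
    => /(_ isT).
  rewrite !nth_rcons /= ltnS leqnn ltnn eqxx.
  by rewrite (last_nth 1).
split.
- by rewrite /braid_zexp expg1 /braid_of -map_cons big_map.
- move=> y; rewrite -map_cons => /mapP[t /nt[t1 tf] ->]; split.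
  + exact: simple_simple_braid.
  + move=> /(congr1 (@braid_perm N)); rewrite perm_simple_braid -simple_braid1.
    by rewrite perm_simple_braid; apply/eqP.
  by move=> /(congr1 (@braid_perm N)); rewrite !perm_simple_braid; apply/eqP.
move=> i; rewrite -map_cons size_map => il.
rewrite !(nth_map 1) //; last exact: ltnW.
apply: weighted_left_weighted; have := lw i; rewrite size_rcons !nth_rcons il
  (ltnW il).
by apply; apply: ltnW.
Qed.

Lemma weighted_list_behead N (s : 'S_N) l : weighted_list (s :: l) ->
  weighted_list l.
Proof. by move=> lw i il; apply: (lw i.+1). Qed.

Lemma weighted_list_rcons N (l : seq 'S_N) s t :
  weighted_list (rcons l s) -> weighted s t -> weighted_list (rcons (rcons l s)
    t).
Proof.
move=> lw st i; rewrite !size_rcons !ltnS leq_eqVlt => /orP[/eqP il|il].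
  by rewrite !nth_rcons !size_rcons il ltnn eqxx ltnS leqnn ltnn eqxx.
have := lw i; rewrite size_rcons ltnS => /(_ il).
by rewrite [nth _ (rcons (rcons _ _) _) _]nth_rcons [nth _ (rcons (rcons _ _)
  _) i.+1]nth_rcons
  size_rcons !ltnS il (ltnW il).
Qed.

Lemma rigid_list_rotate N (l : seq 'S_N) : rigid_list l -> rigid_list (rotate
  l).
Proof.
case: l => [//|s l] [_ lw nt]; split; first by rewrite -size_eq0 size_rcons.
  rewrite /=; set t := conj_flip s.
  have -> : head 1 (rcons l t) = nth 1 (rcons l t) 0 by case: l {lw nt}.
  apply: weighted_list_rcons; first exact: weighted_list_behead lw.
  by apply: weighted_conj_flip; apply: (lw 0); rewrite /= size_rcons.
move=> x; rewrite mem_rcons inE => /orP[/eqP->|xl]; last by apply: nt; rewrite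
  inE xl orbT.
have [s1 sf] := nt s (mem_head _ _).
by rewrite -conj_flip1 -[X in _ /\ _ != X]conj_flip_flip !(inj_eq (inv_inj
  (@conj_flipK N))).
Qed.

(** [Delta . s . l] equals [t . Delta . l] with [t] the flip conjugate of [s], and conjugation by
    [t] sends this factor to the end. *)
Lemma braid_of_rotate N (l : seq 'S_N) : exists g, braid_of (rotate l) =
  braid_of l ^ g.
Proof.
case: l => [|s l]; first by exists 1; rewrite conjg1.
rewrite -{2}[s]conj_flipK; set t := conj_flip s; exists (simple_braid t).
rewrite conjgE /braid_of /= -/t big_cons -cats1 big_cat big_seq1 /=.
by rewrite (mulgA (Delta N) (simple_braid _)) -simple_braid_Delta -!mulgA mulKg.
Qed.

Lemma size_rotate N (l : seq 'S_N) : size (rotate l) = size l.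
Proof. by case: l => //= s l; rewrite size_rcons. Qed.

Lemma rotate_inj N : injective (@rotate N).
Proof.
move=> [|s l] [|t l'] //= => [/(congr1 size)|/(congr1 size)|]; rewrite
  ?size_rcons //.
by move=> /rcons_inj[-> /(inv_inj (@conj_flipK N)) ->].
Qed.

Lemma iter_rotate N n (l : seq 'S_N) : n <= size l ->
  iter n (@rotate N) l = drop n l ++ map (@conj_flip N) (take n l).
Proof.
elim: n => [|n IH] nl; first by rewrite drop0 take0 cats0.
rewrite iterS IH ?(ltnW nl) // (drop_nth 1 nl) /= (take_nth 1 nl) map_rcons.
by rewrite rcons_cat.
Qed.

Lemma map_rotate N (T : Type) (f : 'S_N -> T) (l : seq 'S_N) :
  (forall s, f (conj_flip s) = f s) -> map f (rotate l) = rot 1 (map f l).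
Proof. by move=> fE; case: l => //= s l; rewrite map_rcons fE rot1_cons. Qed.

Lemma iter_rotate_conj N n (l : seq 'S_N) :
  exists g, braid_of (iter n (@rotate N) l) = braid_of l ^ g.
Proof.
elim: n => [|n [g IH]]; first by exists 1; rewrite conjg1.
have [h E] := braid_of_rotate (iter n (@rotate N) l).
by exists (g * h); rewrite iterS E IH conjgM.
Qed.

Lemma card_le_SC N (x : braid N) (T : finType) (f : T -> braid N) :
  injective f -> (forall i, SC x (f i)) -> (`I_#|T| #<= SC x)%card.
Proof.
move=> f_inj fP; case: (pickP T) => [i0 _|T0]; last first.
  by rewrite (eq_card0 T0) II0; apply: card_ge0.
have [|g] := (@injfunPex _ _ `I_#|T| (SC x)).2.
  exists (fun k => f (nth i0 (enum T) k)) => [k _|k l]; first exact: fP.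
  rewrite !inE /= => kT lT /f_inj/eqP.
  by rewrite nth_uniq ?enum_uniq -?cardE // => /eqP.
exact: inj_card_le.
Qed.

(** Three data separate the [2 * n] rotations of the lists: the place of the head, whose [stat]
    occurs once in its list, gives the shift modulo [n]; the [stat] values then give the index; and
    the flip conjugate, reached after [n] rotations, differs from the list itself. *)
Lemma rotations_SC N (x : braid N) (T : finType) (F : T -> seq 'S_N) n
    (stat : 'S_N -> nat) :
  (forall i, size (F i) = n) ->
  (forall i, rigid_list (F i)) ->
  (forall i, exists g, braid_of (F i) = x ^ g) ->
  (forall s, stat (conj_flip s) = stat s) ->
  (forall i, exists s l, F i = s :: l /\
    stat s \notin map stat l /\ map (@conj_flip N) (F i) != F i) ->
  (forall i j, map stat (F i) = map stat (F j) -> i = j) ->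
  (forall i j, stat (head 1 (F i)) = stat (head 1 (F j))) ->
  (`I_(2 * n * #|T|) #<= SC x)%card.
Proof.
move=> szF rigF conjF statF markF sepF headF.
pose f (p : 'I_(2 * n) * T) := iter p.1 (@rotate N) (F p.2).
have size_f p : size (f p) = n.
  by rewrite /f; elim: (nat_of_ord p.1) => //= k IH; rewrite size_rotate.
have f_rigid p : rigid_list (f p).
  by rewrite /f; elim: (nat_of_ord p.1) => //= k IH; apply: rigid_list_rotate.
have stat_rot k (l : seq 'S_N) : size l = n -> k <= n ->
    map stat (iter k (@rotate N) l) = rot k (map stat l).
  move=> szl; elim: k => [|k IH] kn; first by rewrite rot0.
  by rewrite iterS map_rotate // IH ?(ltnW kn) // -rotS // size_map szl.
have rot_n i : iter n (@rotate N) (F i) = map (@conj_flip N) (F i).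
  by rewrite -(szF i) iter_rotate // drop_size take_size.
have stat_n i : map stat (iter n (@rotate N) (F i)) = map stat (F i).
  by rewrite stat_rot // -{1}(szF i) -(size_map stat) rot_size.
have split_n k : k < 2 * n -> exists b r, [/\ k = (r + b * n)%N, r < n & b < 2].
  move=> kn; have n0 : 0 < n by case: (n) kn.
  exists (k %/ n), (k %% n); split; first by rewrite addnC -divn_eq.
    by rewrite ltn_mod.
  by rewrite ltn_divLR.
have stat_f b r i : r < n -> b < 2 ->
    map stat (iter (r + b * n) (@rotate N) (F i)) = rot r (map stat (F i)).
  move=> rn b2; rewrite iterD stat_rot ?(ltnW rn) //.
    by case: b b2 => [|[|]]//=; rewrite mul1n stat_n.
  by elim: (b * n)%N => //= k <-; rewrite size_rotate.
(* If the shifts differed, the head value, common to all lists by [headF], would reappear in the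
   tail of [F j]. *)
have same_shift r r' i j : r <= r' -> r' < n ->
    rot r (map stat (F i)) = rot r' (map stat (F j)) -> r = r'.
  move=> rr rn; rewrite -{1}(subnKC rr) rotD; last by rewrite size_map szF
    subnKC // ltnW.
  move=> /rot_inj; have [s [l [Fi [sl _]]]] := markF j.
  have [s' [l' [Fi' _]]] := markF i.
  have := headF i j; rewrite Fi Fi' /= => ss E.
  have dn : r' - r < n by lia.
  case: (posnP (r' - r)) => [|d0]; first by lia.
  move: E; rewrite /rot -[(r' - r)%N]prednK //=; case D : (drop _ _) => [|y m].
    move/(congr1 size): D; rewrite size_drop size_map.
    by have := szF j; rewrite Fi /=; lia.
  move=> /= [E _]; move: sl; rewrite -ss E -(cat_take_drop (r' - r).-1 (map
    stat l)) D.
  by rewrite mem_cat mem_head orbT.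
have f_inj : injective f.
  move=> [t i] [u j]; rewrite /f /= => E.
  have [b [r [tE rn b2]]] := split_n _ (ltn_ord t).
  have [b' [r' [uE rn' b2']]] := split_n _ (ltn_ord u).
  have := congr1 (map stat) E; rewrite tE uE !stat_f // => Er.
  have rr : r = r'.
    by have [rr|rr] := leqP r r'; [apply: same_shift Er|apply/esym/(same_shift
      _ _ j i) => //; apply: ltnW].
  subst r'; have ij : i = j by apply: sepF; apply: rot_inj Er.
  subst j; congr pair; apply/val_inj => /=; rewrite tE uE; congr (_ + _ * _)%N.
  have iter_inj k : injective (iter k (@rotate N)).
    by elim: k => [|k IH] l l' //=; move=> /rotate_inj/IH.
  (* Only the half turn is left to compare, and [conj_flip] detects it. *)
  move: E; rewrite tE uE !iterD => /iter_inj.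
  have [s [l [_ [_ /eqP tau]]]] := markF i.
  by case: b b2 {tE} => [|[|]]// _; case: b' b2' {uE} => [|[|]]// _; rewrite
    mul0n mul1n /= rot_n => // H; case: tau.
have -> : (2 * n * #|T| = #|{: 'I_(2 * n) * T}|)%N by rewrite card_prod
  card_ord.
apply: (card_le_SC (f := fun p => braid_of (f p))) => [p q E|p].
  have wl q' : weighted_list (f q').
    have [_ lw _] := f_rigid q'; move: lw; rewrite -cats1 => lw k kl.
    by have := lw k; rewrite size_cat addn1 ltnS !nth_cat kl (ltnW kl) => /(_
      isT).
  apply/f_inj/weighted_list_inj; rewrite ?size_f //.
  exact: (mulgI (Delta N)).
split; first exact: rigid_list_rigid.
have [g Eg] := conjF p.2; have [h Eh] := iter_rotate_conj p.1 (F p.2).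
by exists (g * h); rewrite conjgM -Eg -Eh.
Qed.

(** * States and steps *)

(* The set of labels lying on the left in a down-up sequence. *)
Notation state := (pred nat).

Definition label_at N (Q : state) (p : nat) : nat := nth 0 (down_up N Q) p.

(** The larger of two labels decides: it stands left of the smaller one exactly when it belongs to
    [Q]. *)
Definition before (Q : state) (l m : nat) : bool :=
  ((l < m) && ~~ Q m) || ((m < l) && Q l).

Lemma size_down_up N Q : size (down_up N Q) = N.
Proof. by rewrite (perm_size (perm_down_up N Q)) size_iota. Qed.

Lemma pairwise_before N Q : pairwise (before Q) (down_up N Q).
Proof.
rewrite pairwise_cat; apply/and3P; split.
- apply/allrelP => l m; rewrite mem_rev !mem_filter /before => /andP[Ql _]
    /andP[Qm _].
  by rewrite Ql Qm !andbT -neq_ltn; apply: contra Qm => /eqP<-.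
- apply: (@sub_in_pairwise _ Q gtn).
  + by move=> l m; rewrite /before -!topredE /= => Ql _ ->; rewrite Ql orbT.
  + by rewrite all_rev; apply: filter_all.
  rewrite -sorted_pairwise; last by move=> x y z /= ? ?; lia.
  by rewrite rev_sorted sorted_filter ?iota_ltn_sorted //; apply: ltn_trans.
apply: (@sub_in_pairwise _ (fun l => ~~ Q l) ltn).
- by move=> l m; rewrite /before -!topredE /= => _ Qm ->; rewrite Qm.
- exact: filter_all.
rewrite -sorted_pairwise; last exact: ltn_trans.
by rewrite sorted_filter ?iota_ltn_sorted //; apply: ltn_trans.
Qed.

Lemma label_at_range N Q (p : 'I_N) : 0 < label_at N Q p <= N.
Proof.
have : label_at N Q p \in down_up N Q by rewrite mem_nth // size_down_up.
by rewrite (perm_mem (perm_down_up N Q)) mem_iota add1n ltnS.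
Qed.

Lemma label_at_inj N Q (p q : 'I_N) : label_at N Q p = label_at N Q q -> p = q.
Proof.
move=> /eqP; rewrite /label_at nth_uniq ?size_down_up //; first by
  move/eqP/val_inj.
by rewrite (perm_uniq (perm_down_up N Q)) iota_uniq.
Qed.

Lemma label_at_surj N Q l : 0 < l <= N -> exists p : 'I_N, label_at N Q p = l.
Proof.
move=> lN; have lS : l \in down_up N Q.
  by rewrite (perm_mem (perm_down_up N Q)) mem_iota add1n ltnS.
have lt : index l (down_up N Q) < N by rewrite -[X in _ < X](size_down_up N Q)
  index_mem.
by exists (Ordinal lt); rewrite /label_at nth_index.
Qed.

Lemma lt_label_at N Q (p q : 'I_N) : (p < q) = before Q (label_at N Q p)
  (label_at N Q q).
Proof.
have lt_before (a b : 'I_N) : a < b -> before Q (label_at N Q a) (label_at N Q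
  b).
  move=> ab; have /(pairwiseP 0) := pairwise_before N Q.
  by apply; rewrite ?inE ?size_down_up.
have [pq|qp|/val_inj->] := ltngtP p q; first by rewrite lt_before.
  have := lt_before _ _ qp; rewrite /before.
  by case: (Q (label_at N Q p)); case: (Q (label_at N Q q)); case: ltngtP.
by rewrite /before ltnn.
Qed.

Definition valid N (f : nat -> nat) : Prop :=
  {in iota 1 N, forall l, f l \in iota 1 N} /\ {in iota 1 N &, injective f}.

Definition state_perm N (Q : state) (f : nat -> nat) (Q' : state) : 'S_N :=
  connecting_perm N (down_up N Q) (down_up N Q') f.

Lemma state_permE N Q f Q' p : valid N f -> label_at N Q' (state_perm N Q f Q'
  p) = f (label_at N Q p).
Proof. by move=> [f1 f2]; apply: connecting_permP => //; apply: perm_down_up.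
  Qed.

Definition swap_labels i l := if l == i then i.-1 else if l == i.-1 then i else
  l.

Lemma valid_id N : valid N id.
Proof. by split=> // l m. Qed.

Lemma valid_swap N i : 1 < i <= N -> valid N (swap_labels i).
Proof.
move=> iN; split=> [l|l m]; rewrite !mem_iota /swap_labels.
  by do 2?case: ifP => ?; lia.
by do 4?case: ifP => ?; lia.
Qed.

Lemma valid_comp N f g : valid N f -> valid N g -> valid N (g \o f).
Proof.
move=> [f1 f2] [g1 g2]; split=> [l /f1/g1//|l m lN mN /= /g2 E].
by apply: f2 => //; apply: E; apply: f1.
Qed.

Lemma state_permM N Q f Q' g Q'' : valid N f -> valid N g ->
  state_perm N Q f Q' * state_perm N Q' g Q'' = state_perm N Q (g \o f) Q''.
Proof.
move=> vf vg; apply/permP => p; apply: (@label_at_inj _ Q'').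
by rewrite permM !state_permE //; apply: valid_comp.
Qed.

Definition label_cross (Q : state) f (Q' : state) l m : bool :=
  before Q l m (+) before Q' (f l) (f m).

Lemma cross_state_perm N Q f Q' p q : valid N f ->
  cross (state_perm N Q f Q') p q = label_cross Q f Q' (label_at N Q p)
    (label_at N Q q).
Proof. by move=> vf; rewrite /cross (lt_label_at Q) (lt_label_at Q')
  !state_permE. Qed.

(** Label 1 sits at the bottom of the arrangement whatever its side; this is why conditions on
    states start at label 2. *)
Lemma down_up_ext N (Q Q' : state) :
  (forall l, 1 < l <= N -> Q l = Q' l) -> down_up N Q = down_up N Q'.
Proof.
case: N => // N QQ'; rewrite /down_up /=.
have E : {in iota 2 N, Q =1 Q'} by move=> l; rewrite mem_iota => ?; apply: QQ';
  lia.
have E' : {in iota 2 N, (fun l => ~~ Q l) =1 (fun l => ~~ Q' l)}.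
  by move=> l lN /=; rewrite E.
rewrite (eq_in_filter E) (eq_in_filter E').
by case: (Q 1%N); case: (Q' 1%N); rewrite //= rev_cons cat_rcons.
Qed.

Lemma state_perm_ext N (Q1 Q2 Q1' Q2' : state) f g : valid N f ->
  (forall l, 1 < l <= N -> Q1 l = Q2 l) -> (forall l, 1 < l <= N -> Q1' l = Q2'
    l) ->
  (forall l, 0 < l <= N -> f l = g l) -> state_perm N Q1 f Q1' = state_perm N
    Q2 g Q2'.
Proof.
move=> vf E1 E2 fg; have vg : valid N g.
  have fgi l : l \in iota 1 N -> f l = g l by rewrite mem_iota => ?; apply: fg;
    lia.
  case: vf => [f1 f2]; split=> [l lN|l m lN mN]; first by rewrite -fgi ?f1.
  by rewrite -!fgi //; apply: f2.
apply/permP => p; apply: (@label_at_inj _ Q2').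
by rewrite state_permE // -fg ?label_at_range // -(state_permE Q2 Q2') //
  /state_perm -(down_up_ext E1) -(down_up_ext E2).
Qed.

Lemma before_lt (Q : state) l m : l < m -> before Q l m = ~~ Q m.
Proof. by rewrite /before; case: ltngtP; rewrite ?orbF. Qed.

Lemma before_gt (Q : state) l m : l < m -> before Q m l = Q m.
Proof. by rewrite /before; case: ltngtP. Qed.

Lemma before_sym Q l m : l != m -> before Q l m = ~~ before Q m l.
Proof.
by rewrite /before; case: ltngtP => //= _ _; rewrite ?orbF ?negbK.
Qed.

Lemma label_cross_sym N Q f Q' l m : valid N f -> 0 < l <= N -> 0 < m <= N ->
  label_cross Q f Q' l m = label_cross Q f Q' m l.
Proof.
move=> [_ f_inj] lN mN; have [->//|lm] := eqVneq l m.
have fm : f l != f m.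
  by apply: contra lm => /eqP/f_inj ->; rewrite // mem_iota; lia.
by rewrite /label_cross before_sym // (before_sym _ fm) addbN addNb negbK.
Qed.

Lemma reduced_state_perm N Q f Q' g Q'' : valid N f -> valid N g ->
  (forall l m, 0 < l -> l < m -> m <= N ->
     label_cross Q f Q' l m -> label_cross Q' g Q'' (f l) (f m) -> False) ->
  reduced (state_perm N Q f Q') (state_perm N Q' g Q'').
Proof.
move=> vf vg H.
have wlog (a b : 'I_N) : label_at N Q a < label_at N Q b -> cross (state_perm N
  Q f Q') a b ->
    cross (state_perm N Q' g Q'') (state_perm N Q f Q' a) (state_perm N Q f Q'
      b) -> False.
  move=> ab; rewrite !cross_state_perm // !state_permE //; apply: H => //.
    by have /andP[] := label_at_range Q a.
  by have /andP[] := label_at_range Q b.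
move=> a b; have [ab|ba|/label_at_inj ->] := ltngtP (label_at N Q a) (label_at
  N Q b).
- exact: wlog.
- by rewrite (cross_sym (state_perm N Q f Q')) (cross_sym (state_perm N Q' g
    Q'')); apply: wlog.
by rewrite cross_id.
Qed.

Definition maybe_swap (b : bool) i : nat -> nat := if b then swap_labels i else
  id.

Lemma valid_maybe_swap N b i : 1 < i <= N -> valid N (maybe_swap b i).
Proof. by case: b => iN; [apply: valid_swap|apply: valid_id]. Qed.

Lemma swap_labelsK i : 0 < i -> involutive (swap_labels i).
Proof.
move=> i0 l; rewrite /swap_labels; have [->|li] := eqVneq l i.
  by rewrite eqxx; case: eqP => //; lia.
have [->|li'] := eqVneq l i.-1; first by rewrite eqxx.
by rewrite (negbTE li) (negbTE li').
Qed.

Lemma maybe_swapD a b i : 0 < i ->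
  maybe_swap b i \o maybe_swap a i = maybe_swap (a (+) b) i.
Proof.
move=> i0; apply/funext => l; case: a; case: b => //=.
exact: swap_labelsK.
Qed.

Lemma swap_side (Q : state) i l : Q i.-1 = Q i -> Q (swap_labels i l) = Q l.
Proof. by move=> Qi; rewrite /swap_labels; do 2?case: eqP => [->//|_]. Qed.

Lemma maybe_swap_lt b i l m : 1 < i -> l < m ->
  if b && (m == i) && (l == i.-1) then maybe_swap b i l = i /\ maybe_swap b i m
    = i.-1
  else maybe_swap b i l < maybe_swap b i m.
Proof.
case: b => //= i1 lm; rewrite /swap_labels.
by do 5?case: ifP => ?; lia.
Qed.

(** Two labels cross when the larger one changes sides. Swapping [i - 1] and [i], which share a side
    at both ends, only toggles the crossing of this pair. *)
Lemma label_crossE Q b i Q' l m : 1 < i -> Q i.-1 = Q i -> Q' i.-1 = Q' i -> l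
  < m ->
  label_cross Q (maybe_swap b i) Q' l m =
  Q m (+) Q' m (+) (b && (m == i) && (l == i.-1)).
Proof.
move=> i1 Qi Qi' lm; have := maybe_swap_lt b i1 lm; rewrite /label_cross
  before_lt //.
case: ifP => [/andP[/andP[-> /eqP->] _] [-> ->]|_ flm].
  by rewrite before_gt ?addbT ?addNb // ltn_predL ltnW.
rewrite before_lt // addbF.
have -> : Q' (maybe_swap b i m) = Q' m by case: b {flm} => //; apply: swap_side.
by rewrite addbN addNb negbK.
Qed.

Lemma label_cross_preE Q a b i Q' l m : 1 < i -> Q i.-1 = Q i -> Q' i.-1 = Q' i
  ->
  l < m ->
  label_cross Q (maybe_swap b i) Q' (maybe_swap a i l) (maybe_swap a i m) =
  Q m (+) Q' m (+) (b && (m == i) && (l == i.-1)).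
Proof.
move=> i1 Qi Qi' lm; have := maybe_swap_lt a i1 lm.
case: ifP => [/andP[/andP[-> /eqP->] /eqP->] [-> ->]|H flm].
  have v : valid i (maybe_swap b i) by apply: valid_maybe_swap; rewrite i1
    leqnn.
  by rewrite (label_cross_sym _ _ v) ?label_crossE ?eqxx //; lia.
rewrite label_crossE //.
case: a H flm => //= H flm; rewrite !swap_side //; congr (_ (+) _).
case: b {Qi Qi'} => //=; move: H flm; rewrite /swap_labels.
by do 5?case: eqP => ? /=; lia.
Qed.

(** * Full twists of the lowest strands *)

Definition state_braid N Q f Q' : braid N := simple_braid (state_perm N Q f Q').

(** A plain move, all labels being kept. The 2 is a placeholder: [maybe_swap false i] is the
    identity for every [i], which lets [state_braidM] be used with any [i]. *)
Notation flip_braid N Q Q' := (state_braid N Q (maybe_swap false 2) Q').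

(** The product stays simple if no label changes sides twice; the pair [i - 1, i] has its own
    condition, because swaps contribute to its crossings. *)
Lemma state_braidM N Q a i Q' b Q'' : 1 < i <= N ->
  Q i.-1 = Q i -> Q' i.-1 = Q' i -> Q'' i.-1 = Q'' i ->
  (forall m, 1 < m <= N -> Q m != Q' m -> Q' m != Q'' m -> False) ->
  ~~ ((Q i (+) Q' i (+) a) && (Q' i (+) Q'' i (+) b)) ->
  state_braid N Q (maybe_swap a i) Q' * state_braid N Q' (maybe_swap b i) Q'' =
  state_braid N Q (maybe_swap (a (+) b) i) Q''.
Proof.
move=> iN Qi Qi' Qi'' H1 H2; have [i1 i0] : 1 < i /\ 0 < i by lia.
have [va vb] : valid N (maybe_swap a i) /\ valid N (maybe_swap b i).
  by split; apply: valid_maybe_swap.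
rewrite /state_braid simple_braidM ?state_permM ?maybe_swapD //.
apply: reduced_state_perm => // l m l0 lm mN; rewrite label_crossE //
  label_cross_preE //.
case: (boolP ((m == i) && (l == i.-1))) => [/andP[/eqP-> /eqP->]|E].
  rewrite !eqxx !andbT => C1 C2; move: H2; by rewrite C1 C2.
rewrite -!andbA (negbTE E) !andbF !addbF => C1 C2; apply: (H1 m).
- by rewrite mN andbT (leq_ltn_trans l0 lm).
- by move: C1; case: (Q m); case: (Q' m).
- by move: C2; case: (Q' m); case: (Q'' m).
Qed.

Lemma flip_braidM N Q Q' Q'' : (forall m, 1 < m <= N -> Q m != Q' m -> Q' m !=
  Q'' m -> False) ->
  flip_braid N Q Q' * flip_braid N Q' Q'' = flip_braid N Q Q''.
Proof.
move=> H; rewrite /state_braid simple_braidM ?state_permM //; try exact: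
  valid_id.
apply: reduced_state_perm; try exact: valid_id.
move=> l m l0 lm mN; rewrite /label_cross /= !before_lt // addbN addNb negbK
  addbN addNb negbK.
move=> C1 C2; apply: (H m); first lia.
- by move: C1; case: (Q m); case: (Q' m).
by move: C2; case: (Q' m); case: (Q'' m).
Qed.

Lemma flip_braid1 N Q Q' : (forall m, 1 < m <= N -> Q m = Q' m) -> flip_braid N
  Q Q' = 1.
Proof.
move=> QQ'; rewrite -simple_braid1; congr simple_braid.
apply/permP => p; apply: (@label_at_inj _ Q'); rewrite state_permE ?perm1; last
  exact: valid_id.
by rewrite /label_at (down_up_ext QQ').
Qed.

Lemma state_braid_ext N Q1 Q2 Q1' Q2' f : valid N f ->
  (forall m, 1 < m <= N -> Q1 m = Q2 m) -> (forall m, 1 < m <= N -> Q1' m = Q2'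
    m) ->
  state_braid N Q1 f Q1' = state_braid N Q2 f Q2'.
Proof. by move=> vf E1 E2; rewrite /state_braid (state_perm_ext vf E1 E2 (fun _
  _ => erefl)). Qed.

(** The labels up to [b] occupy a block of consecutive positions; switching them all reverses the
    block, a half-twist. *)
Definition flip_low b (Q : state) : state := fun l => Q l (+) (l <= b).

Lemma flip_lowK b : involutive (flip_low b).
Proof. by move=> Q; apply/funext => l; rewrite /flip_low -addbA addbb addbF.
  Qed.

(* The full twist of the strands with labels at most [b]. *)
Definition twist N b Q : braid N := flip_braid N Q (flip_low b Q) * flip_braid
  N (flip_low b Q) Q.

Definition passes N b (x : braid N) Q Q' : Prop := x * twist N b Q' = twist N b
  Q * x.

Lemma passes1 N b Q : passes b (1 : braid N) Q Q.
Proof. by rewrite /passes mul1g mulg1. Qed.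

Lemma passesM N b (x y : braid N) Q Q' Q'' :
  passes b x Q Q' -> passes b y Q' Q'' -> passes b (x * y) Q Q''.
Proof.
by rewrite /passes => px py; rewrite -(mulgA x) py (mulgA x) px mulgA.
Qed.

Lemma passesV N b (x : braid N) Q Q' : passes b x Q Q' -> passes b x^-1 Q' Q.
Proof.
by rewrite /passes => px; apply: (mulgI x); rewrite mulKVg mulgA px mulgK.
Qed.

(** A full twist is a half-twist from [Q] to [flip_low b Q] and one back, so [x] has to pass a
    half-twist starting from either state; [x] is a family because its positions change in
    between. *)
Lemma passes_half N b (x : state -> state -> braid N) Q Q' :
  (forall R R', (R = Q /\ R' = Q') \/ (R = flip_low b Q /\ R' = flip_low b Q')
    ->
  x R R' * flip_braid N R' (flip_low b R') = flip_braid N R (flip_low b R) * x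
    (flip_low b R) (flip_low b R')) ->
  passes b (x Q Q') Q Q'.
Proof.
move=> H; rewrite /passes /twist mulgA H; last by left.
rewrite -mulgA; have := H (flip_low b Q) (flip_low b Q'); rewrite !flip_lowK =>
  -> //.
  by rewrite mulgA.
by right.
Qed.

(** The intermediate state [R] lets the labels above [b] move first and the others afterwards. High
    moves and the half-twist concern different labels, so either order gives the same simple braid;
    a low move is completed to the half-twist from either end, as when a simple braid passes
    [Delta]. *)
Lemma passes_flip_braid N b Q Q' : passes b (flip_braid N Q Q') Q Q'.
Proof.
apply: (passes_half (x := fun R R' => flip_braid N R R')) => {}Q {}Q' _.
have high R R' : (forall m, 1 < m <= N -> m <= b -> R m = R' m) ->
    flip_braid N R R' * flip_braid N R' (flip_low b R') = flip_braid N R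
      (flip_low b R) * flip_braid N (flip_low b R) (flip_low b R').
  move=> E; rewrite !flip_braidM // => m mN; rewrite /flip_low; have := E m mN;
    case: (m <= b) => [->//|_]; rewrite ?addbT ?addbF ?eqxx //.
have low R R' : (forall m, 1 < m <= N -> b < m -> R m = R' m) ->
    flip_braid N R R' * flip_braid N R' (flip_low b R') = flip_braid N R
      (flip_low b R) * flip_braid N (flip_low b R) (flip_low b R').
  move=> E; rewrite -(@flip_braidM _ R' (flip_low b R)) ?mulgA ?(@flip_braidM _
    R R') //.
    move=> m mN; rewrite /flip_low; have [mb|mb] := leqP m b; last by rewrite E
      // eqxx.
    by rewrite addbT; case: (R m); case: (R' m).
  move=> m mN; rewrite /flip_low; have [mb|mb] := leqP m b; last by rewrite E
    // addbF eqxx.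
  by rewrite !addbT; case: (R m); case: (R' m).
pose R m := if m <= b then Q m else Q' m.
have QR : flip_braid N Q R * flip_braid N R Q' = flip_braid N Q Q'.
  by apply: flip_braidM => m mN; rewrite /R; case: ifP; rewrite eqxx.
have QRb : flip_braid N (flip_low b Q) (flip_low b R) * flip_braid N (flip_low
  b R) (flip_low b Q') =
    flip_braid N (flip_low b Q) (flip_low b Q').
  by apply: flip_braidM => m mN; rewrite /flip_low /R; case: ifP; rewrite eqxx.
rewrite -QR -mulgA low; last by move=> m mN mb; rewrite /R leqNgt mb.
rewrite mulgA high; last by move=> m mN mb; rewrite /R mb.
by rewrite -mulgA QRb.
Qed.

Lemma state_braid_even N i Q Q' : 1 < i <= N -> Q i.-1 = Q i -> Q' i.-1 = Q' i
  -> Q i = Q' i ->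
  state_braid N Q (maybe_swap true i) Q' = state_braid N Q (maybe_swap true i)
    Q * flip_braid N Q Q'.
Proof.
move=> iN Qi Qi' QQ'; rewrite [flip_braid N Q Q'](_ : _ = state_braid N Q
  (maybe_swap false i) Q') // state_braidM //.
- by move=> m _; rewrite eqxx.
by rewrite QQ' !addbb.
Qed.

(** If [i] changes sides, a plain move crosses the neighbours [i - 1] and [i], and the exchange is
    this move with that crossing removed from its beginning. In [state_braid_even] it is added
    instead. *)
Lemma state_braid_odd N i Q Q' : 1 < i <= N -> Q i.-1 = Q i -> Q' i.-1 = Q' i
  -> Q i != Q' i ->
  state_braid N Q (maybe_swap true i) Q' = (state_braid N Q (maybe_swap true i)
    Q)^-1 * flip_braid N Q Q'.
Proof.
move=> iN Qi Qi' QQ'; apply: (mulgI (state_braid N Q (maybe_swap true i) Q)).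
rewrite mulKVg state_braidM //; first by move=> m _; rewrite eqxx.
by move: QQ'; case: (Q i); case: (Q' i).
Qed.

(** The crossing of the neighbours [i - 1] and [i] lies inside or outside the block of the labels up
    to [b]; only [b = i - 1] separates them. *)
Lemma passes_swap N b i Q : 1 < i <= N -> Q i.-1 = Q i -> b != i.-1 ->
  passes b (state_braid N Q (maybe_swap true i) Q) Q Q.
Proof.
move=> iN Qi bi.
apply: (passes_half (x := fun R _ => state_braid N R (maybe_swap true i) R)) =>
  R R' RQ.
have [Ri {RQ}->] : R i.-1 = R i /\ R' = R.
  by case: RQ => -[-> ->]; split; rewrite // /flip_low Qi; congr (_ (+) _); lia.
have Rbi : flip_low b R i.-1 = flip_low b R i.
  by rewrite /flip_low Ri; congr (_ (+) _); lia.
have [bi'|bi'] := leqP i b.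
  (* Inside the block, the half-twist lacking one crossing is completed by that crossing from either
     end. *)
  have eu : state_braid N R (maybe_swap true i) R * state_braid N R (maybe_swap
    true i) (flip_low b R) =
      flip_braid N R (flip_low b R).
    apply: (@state_braidM _ _ true i _ true) => // [m _|]; first by rewrite
      eqxx.
    by rewrite /flip_low bi'; case: (R i).
  have ue : state_braid N R (maybe_swap true i) (flip_low b R) *
      state_braid N (flip_low b R) (maybe_swap true i) (flip_low b R) =
        flip_braid N R (flip_low b R).
    apply: (@state_braidM _ _ true i _ true) => // [m _ _|]; first by rewrite
      eqxx.
    by rewrite /flip_low bi'; case: (R i).
  by rewrite -{1}ue mulgA eu.
rewrite (_ : flip_braid N R _ = state_braid N R (maybe_swap false i) (flip_low
  b R)) // !state_braidM //.
- by move=> m _ _; rewrite eqxx.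
- by rewrite /flip_low leqNgt bi' /=; case: (R i).
- by move=> m _; rewrite eqxx.
by rewrite /flip_low leqNgt bi' /=; case: (R i).
Qed.

Lemma passes_state_braid N b i Q Q' : 1 < i <= N -> Q i.-1 = Q i -> Q' i.-1 =
  Q' i ->
  b != i.-1 -> passes b (state_braid N Q (maybe_swap true i) Q') Q Q'.
Proof.
move=> iN Qi Qi' bi; have pe := passes_swap iN Qi bi; have pw :=
  @passes_flip_braid N b Q Q'.
have [QQ'|QQ'] := eqVneq (Q i) (Q' i).
  by rewrite state_braid_even //; apply: passesM pw.
by rewrite state_braid_odd //; apply: passesM pw; apply: passesV.
Qed.

Lemma passes_twist N b c Q : passes b (twist N c Q) Q Q.
Proof. by apply: passesM; apply: passes_flip_braid. Qed.

Lemma flip_braid_Delta N Q : flip_braid N Q (fun l => ~~ Q l) = Delta N.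
Proof.
congr simple_braid; apply: prefix_le_anti; first exact: prefix_le_flip.
move=> p q; rewrite cross_flip cross_state_perm; last exact: valid_id.
move=> pq; rewrite /label_cross /= /before.
have : label_at N Q p != label_at N Q q by apply: contra pq =>
  /eqP/label_at_inj->.
by case: ltngtP => // _ _ /=; case: (Q (label_at N Q p)); case: (Q (label_at N
  Q q)).
Qed.

(* The labels 1 and 2 only name the two positions in the middle. *)
Lemma state_perm_swap2 N (R R' : state) : 1 < N -> (forall m, 2 < m <= N -> R m
  = R' m) ->
  R 2 != R' 2 -> state_perm N R (swap_labels 2) R' = 1.
Proof.
move=> N1 RR' R2; have v2 : valid N (swap_labels 2) by apply: valid_swap.
apply: no_cross1 => p q.
  have lt l m : 0 < l -> l < m -> m <= N -> label_cross R (swap_labels 2) R' l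
    m = false.
    move=> l0 lm mN; rewrite /label_cross; case: m lm mN => [|[|[|m]]] lm mN;
      try lia.
      have -> : l = 1%N by lia.
      by rewrite /swap_labels /= before_lt // before_gt //; move: R2; case: (R
        2); case: (R' 2).
    rewrite before_lt // /(swap_labels 2 m.+3) /= before_lt ?RR' ?addbb //.
    by rewrite /swap_labels; do 2?case: ifP; lia.
  rewrite cross_state_perm //; have := label_at_range R p; have :=
    label_at_range R q.
  case: (ltngtP (label_at N R p) (label_at N R q)) => [pq|qp|->] qN pN.
  - by apply: lt => //; lia.
  - by rewrite (label_cross_sym _ _ v2) //; apply: lt => //; lia.
  by rewrite /label_cross /before !ltnn.
Qed.

(** For [b > 1] the block contains labels 1 and 2, and a different side of label 2 only exchanges
    the names of the two middle strands. Needed where the end of the sequence of stages is joined to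
    its beginning. *)
Lemma twist_ext N b Q Q' : 1 < b -> (forall m, 2 < m <= N -> Q m = Q' m) ->
  twist N b Q = twist N b Q'.
Proof.
move=> b1 QQ'; have [N1|N1] := leqP N 1.
  by rewrite /twist !(@state_braid_ext _ Q Q' _ (flip_low b Q')) 
    ?(@state_braid_ext _ (flip_low b Q) (flip_low b Q') Q Q') //; try exact:
    valid_id; move=> m; lia.
have v2 : valid N (swap_labels 2) by apply: valid_swap.
have key (R R' : state) : (forall m, 2 < m <= N -> R m = R' m) ->
    flip_braid N R (flip_low b R) = flip_braid N R' (flip_low b R').
  move=> RR'; have RbR' m : 2 < m <= N -> flip_low b R m = flip_low b R' m.
    by move=> mN; rewrite /flip_low RR'.
  have [R2|R2] := eqVneq (R 2) (R' 2).
    apply: state_braid_ext; first exact: valid_id.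
      by move=> m mN; have [->//|m2] := eqVneq m 2; apply: RR'; lia.
    move=> m mN; have [->|m2] := eqVneq m 2; first by rewrite /flip_low R2.
    by apply: RbR'; lia.
  congr simple_braid; have := state_permM R (flip_low b R) (flip_low b R')
    (@valid_id N) v2.
  rewrite state_perm_swap2 ?mulg1 //; last by move: R2; rewrite /flip_low b1;
    case: (R 2); case: (R' 2).
  move=> ->; rewrite -[RHS]mul1g -(@state_perm_swap2 N R R') // state_permM //;
    last exact: valid_id.
rewrite /twist (key Q Q') //; congr (_ * _).
have := key (flip_low b Q) (flip_low b Q'); rewrite !flip_lowK; apply.
by move=> m mN; rewrite /flip_low QQ'.
Qed.

(** * The double switch as an alternating product of twists *)

Definition flip_even B (Q : state) : state := fun l => Q l (+) (~~ odd l && (l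
  <= B)).

Definition signed_twist N b Q : braid N :=
  if odd b then (twist N b Q)^-1 else twist N b Q.

Lemma passes_signed N b (x : braid N) Q Q' : passes b x Q Q' ->
  x * signed_twist N b Q' = signed_twist N b Q * x.
Proof.
rewrite /signed_twist; case: ifP => // _ px.
by apply: (mulgI (twist N b Q)); rewrite mulKVg mulgA -[twist N b Q * x]px
  mulgK.
Qed.

Lemma passes_prod N (s : seq nat) (x : braid N) Q Q' :
  (forall b, b \in s -> passes b x Q Q') ->
  x * \prod_(b <- s) signed_twist N b Q' = (\prod_(b <- s) signed_twist N b Q)
    * x.
Proof.
elim: s => [|b s IH] H; first by rewrite !big_nil mul1g mulg1.
rewrite !big_cons mulgA (passes_signed (H b (mem_head _ _))) -!mulgA IH //.
by move=> c cs; apply: H; rewrite inE cs orbT.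
Qed.

Lemma passes_signed_twist N b c Q : passes b (signed_twist N c Q) Q Q.
Proof.
rewrite /signed_twist; case: ifP => _; last exact: passes_twist.
exact/passesV/passes_twist.
Qed.

(** The full twist of [B] strands is that of the [B - 1] lower ones together with the last strand
    circling them, i.e. label [B] switching sides and returning. *)
Lemma twist_step N B Q : 0 < B ->
  twist N B Q = twist N B.-1 Q *
    (flip_braid N Q (fun l => Q l (+) (l == B)) * flip_braid N (fun l => Q l
      (+) (l == B)) Q).
Proof.
move=> B0; set Q' := fun l => _.
have QQ' : flip_low B Q = flip_low B.-1 Q'.
  apply/funext => l; rewrite /flip_low /Q' -addbA; congr (_ (+) _).
  by case: ltngtP; case: ltngtP; lia.
have kF : (B <= B.-1) = false by lia.
have E1 : flip_braid N Q Q' * flip_braid N Q' (flip_low B Q) = flip_braid N Q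
  (flip_low B Q).
  apply: flip_braidM => m mN; rewrite QQ' /flip_low /Q' /=.
  by case: (eqVneq m B) => [->|_]; rewrite ?kF addbF eqxx.
have E2 : flip_braid N (flip_low B Q) Q' * flip_braid N Q' Q = flip_braid N
  (flip_low B Q) Q.
  apply: flip_braidM => m mN; rewrite QQ' /flip_low /Q' /=.
  by case: (eqVneq m B) => [->|_]; rewrite ?kF ?addbF eqxx.
by rewrite mulgA -(@passes_flip_braid N B.-1 Q Q') {2}/twist -QQ' !mulgA E1
  -mulgA E2.
Qed.

(** The highest even label is peeled off: it moves first and returns last. The inner double switch,
    a product of twists by induction, passes its first move, and what remains is a loop given by
    [twist_step]. *)
Lemma pair_even N k Q : flip_braid N Q (flip_even k.*2 Q) * flip_braid N
  (flip_even k.*2 Q) Q =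
  \prod_(b <- iota 1 k.*2) signed_twist N b Q.
Proof.
elim: k Q => [|k IH] Q.
  rewrite big_nil flip_braidM ?flip_braid1 // => m mN; rewrite /flip_even; last
    first.
    by rewrite (_ : (m <= 0) = false) ?andbF ?addbF ?eqxx //; lia.
set B := k.+1.*2; set Q' : state := fun l => Q l (+) (l == B).
have QQ' : flip_even B Q = flip_even k.*2 Q'.
  apply/funext => l; rewrite /flip_even /Q' -addbA; congr (_ (+) _).
  have [->|lB] := eqVneq l B; first by rewrite /B doubleS /= !negbK odd_double
    leqnn /= ltnNge leqnSn.
  have [ol|ol] := boolP (odd l) => //=; move: lB ol; rewrite /B; lia.
have kF : (B <= k.*2) = false by rewrite /B; lia.
have -> : flip_braid N Q (flip_even B Q) = flip_braid N Q Q' * flip_braid N Q'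
  (flip_even k.*2 Q').
  rewrite flip_braidM ?QQ' // => m mN; rewrite /flip_even /Q' /=; case: (eqVneq
    m B) => [->|_]; last by rewrite addbF eqxx.
  by rewrite kF andbF addbF eqxx.
have -> : flip_braid N (flip_even B Q) Q = flip_braid N (flip_even k.*2 Q') Q'
  * flip_braid N Q' Q.
  rewrite flip_braidM ?QQ' // => m mN; rewrite /flip_even /Q' /=; case: (eqVneq
    m B) => [->|_]; last by rewrite addbF eqxx.
  by rewrite kF andbF addbF eqxx.
have E := @passes_prod N (iota 1 k.*2) _ _ _ (fun b _ => @passes_flip_braid N b
  Q Q').
have assoc (a b c d : braid N) : (a * b) * (c * d) = a * (b * c) * d.
  by rewrite !mulgA.
rewrite assoc IH E -mulgA.
rewrite (_ : iota 1 B = iota 1 k.*2 ++ [:: k.*2.+1; k.*2.+2]); last first.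
  by have := iotaD 1 k.*2 2; rewrite addn2 add1n /B doubleS.
rewrite big_cat /= !big_cons big_nil mulg1.
congr (_ * _); rewrite /signed_twist /= odd_double /=.
by rewrite (@twist_step N k.*2.+2) // mulKg.
Qed.

Lemma prod_split N (s : seq nat) b Q : b \in s ->
  \prod_(c <- s) signed_twist N c Q =
  signed_twist N b Q * \prod_(c <- rem b s) signed_twist N c Q.
Proof.
elim: s => //= c s IH; rewrite inE eq_sym; case: eqVneq => [-> _|cb /= bs].
  by rewrite big_cons.
rewrite !big_cons IH // !mulgA; congr (_ * _).
exact: passes_signed (@passes_signed_twist N b c Q).
Qed.

Definition pair_braid N Q : braid N := \prod_(b <- iota 1 N) signed_twist N b Q.

(** Every twist but that for [b = j - 1] passes [X]. The remaining one goes left through [U], is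
    conjugated to the right end as a twist in [Q0], and returns through [V] to the right of [X]. *)
Lemma shift_pair N j Q Q' Q0 (U V : braid N) : 1 < j <= N ->
  Q j.-1 = Q j -> Q' j.-1 = Q' j ->
  passes j.-1 U Q0 Q -> passes j.-1 V Q' Q0 ->
  let X := state_braid N Q (maybe_swap true j) Q' in
  exists g, U * pair_braid N Q * X * V = (U * X * pair_braid N Q' * V) ^ g.
Proof.
move=> jN Qj Qj' pU pV X; set b := j.-1.
have bN : b \in iota 1 N by rewrite mem_iota; lia.
rewrite /pair_braid !(prod_split _ _ bN).
set R := \prod_(c <- rem b _) _; set R' := \prod_(c <- rem b _) _.
have XR : X * R' = R * X.
  apply: passes_prod => c; rewrite mem_rem_uniq ?iota_uniq // inE => /andP[cb
    _].
  exact: passes_state_braid.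
have TR : signed_twist N b Q' * R' = R' * signed_twist N b Q'.
  by apply: passes_prod => c _; apply: passes_signed_twist.
exists (signed_twist N b Q0)^-1.
have EU := passes_signed pU; have EV := passes_signed pV.
rewrite conjgE invgK TR -!mulgA (mulgA X) XR.
rewrite (mulgA U) EU -!mulgA; congr (_ * (_ * (_ * (_ * _)))).
by rewrite -[V in LHS](mulgK (signed_twist N b Q0)) EV -!mulgA.
Qed.

(** * The family of conjugates *)

(* [stage i] is the state before the exchange step of the labels [i - 1, i]. *)
Definition stage i : state := fun l =>
  ~~ ((l %% 4 == 0) || (l %% 4 == 3)) (+) (i < l) (+) (~~ odd l && odd i).

(** Here the residues 0 and 3 modulo 4 matter: [i - 1] and [i] have the same type if [i] is even; if
    [i] is odd the types differ, but the even label [i - 1] is then switched. *)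
Lemma stage_side i : 1 < i -> stage i i.-1 = stage i i.
Proof.
case: i => // i _; rewrite /stage /= ltnn ltnNge leqnSn /=.
have : i.+1 %% 4 = (i %% 4 + 1) %% 4 by rewrite modnDml addn1.
have : odd i = odd (i %% 4) by rewrite odd_mod.
move=> -> ->; have := ltn_pmod i (isT : 0 < 4).
by case: (i %% 4) => [|[|[|[|]]]].
Qed.

Lemma stage_side' i : 1 < i -> stage i.-1 i.-1 = stage i.-1 i.
Proof.
case: i => // i _; rewrite /stage /= ltnn ltnSn /=.
have : i.+1 %% 4 = (i %% 4 + 1) %% 4 by rewrite modnDml addn1.
have : odd i = odd (i %% 4) by rewrite odd_mod.
move=> -> ->; have := ltn_pmod i (isT : 0 < 4).
by case: (i %% 4) => [|[|[|[|]]]].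
Qed.

Lemma stage_flip i m : 0 < i -> stage i m (+) stage i.-1 m = ~~ odd m (+) (m ==
  i).
Proof.
case: i => // i _; rewrite /stage /=; move: ((m %% 4 == 0) || _) => X.
have -> : (i < m) = (m == i.+1) || (i.+1 < m) by rewrite leq_eqVlt eq_sym.
have : ((m == i.+1) && (i.+1 < m)) = false by case: ltngtP.
by case: (m == _); case: (i.+1 < m); case: (odd m); case: (odd i); case: X.
Qed.

Definition exchange N i : 'S_N := state_perm N (stage i) (maybe_swap true i)
  (stage i.-1).
Definition go N i : 'S_N := state_perm N (stage i) (maybe_swap false 2)
  (flip_even N (stage i)).
Definition back N i : 'S_N := state_perm N (flip_even N (stage i)) (maybe_swap
  false 2) (stage i).

(* [c i] double switches follow the exchange step [i], for [i >= 3]. *)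
Fixpoint steps N (c : nat -> nat) i : seq 'S_N :=
  if i is i'.+1 then
    if i' < 2 then [::]
    else exchange N i :: flatten (nseq (c i) [:: go N i'; back N i']) ++ steps
      N c i'
  else [::].

Definition steps_braid N c i : braid N := \prod_(s <- steps N c i) simple_braid
  s.

Lemma prod_nseq_pair N n (x y : 'S_N) :
  \prod_(s <- flatten (nseq n [:: x; y])) simple_braid s =
  (simple_braid x * simple_braid y) ^+ n.
Proof.
elim: n => [|n IH]; first by rewrite big_nil expg0.
by rewrite /= !big_cons IH mulgA expgS.
Qed.

Lemma go_back N i : ~~ odd N ->
  simple_braid (go N i) * simple_braid (back N i) = pair_braid N (stage i).
Proof.
move=> N_even; have NE : N = (N./2).*2.
  by rewrite -{1}(odd_double_half N) (negbTE N_even).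
by have := pair_even N N./2 (stage i); rewrite -NE.
Qed.

Lemma steps_braidS N c i : ~~ odd N -> 1 < i ->
  steps_braid N c i.+1 = simple_braid (exchange N i.+1) * pair_braid N (stage
    i) ^+ c i.+1 *
    steps_braid N c i.
Proof.
move=> N_even i1; rewrite /steps_braid /= ltnNge i1 /= big_cons big_cat /=
  prod_nseq_pair.
by rewrite go_back // !mulgA.
Qed.

Lemma passes_pair N b Q n : passes b (pair_braid N Q ^+ n) Q Q.
Proof.
have p1 : passes b (pair_braid N Q) Q Q.
  rewrite /pair_braid; elim: (iota 1 N) => [|k s IH]; first by rewrite big_nil;
    apply: passes1.
  by rewrite big_cons; apply: passesM IH; apply: passes_signed_twist.
elim: n => [|n IH]; first by rewrite expg0; apply: passes1.
by rewrite expgS; apply: passesM IH.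
Qed.

Lemma passes_exchange N b i : 1 < i <= N -> b != i.-1 ->
  passes b (simple_braid (exchange N i)) (stage i) (stage i.-1).
Proof.
move=> iN bi; have i1 : 1 < i by lia.
by apply: passes_state_braid => //; [apply: stage_side|apply: stage_side'].
Qed.

Lemma passes_steps N c b i : ~~ odd N -> 1 < i <= N -> i <= b ->
  passes b (steps_braid N c i) (stage i) (stage 2).
Proof.
move=> N_even; elim: i => // i IH iN ib; have [i2|i2] := leqP i 1.
  have -> : i = 1%N by lia.
  by rewrite /steps_braid /= big_nil; apply: passes1.
rewrite steps_braidS //; apply: (passesM (Q' := stage i)); last by apply: IH;
  lia.
apply: (passesM (Q' := stage i)); last exact: passes_pair.
by apply: (@passes_exchange N b i.+1); lia.
Qed.

(** For even [N], [stage 2] is the complement of [stage N] above label 2, so [Delta] is the plain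
    move joining the last state to the first one; [twist_ext] takes care of label 2. *)
Lemma passes_Delta N b : ~~ odd N -> 1 < b -> passes b (Delta N) (stage 2)
  (stage N).
Proof.
move=> N_even b1; have := @passes_flip_braid N b (fun l => ~~ stage N l) (stage
  N).
have -> : flip_braid N (fun l => ~~ stage N l) (stage N) = Delta N.
  rewrite -(flip_braid_Delta N (fun l => ~~ stage N l)); apply:
    state_braid_ext; first exact: valid_id.
    by [].
  by move=> m _; rewrite negbK.
rewrite /passes => ->; congr (_ * _); apply: twist_ext => // m mN.
have [Nm m2] : (N < m) = false /\ (2 < m) = true by lia.
by rewrite /stage (negbTE N_even) Nm m2 !andbF /=; case: (_ || _).
Qed.

(* A double switch is moved past the exchange step [i] by conjugating with the
   full twist [twist N i.-1], which passes all the other steps. *)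
Lemma move_pairs N i a d (U V : braid N) : ~~ odd N -> 2 < i <= N ->
  passes i.-1 U (stage 2) (stage i) -> passes i.-1 V (stage i.-1) (stage 2) ->
  exists g, U * pair_braid N (stage i) ^+ a * simple_braid (exchange N i) *
    pair_braid N (stage i.-1) ^+ d * V =
  (U * simple_braid (exchange N i) * pair_braid N (stage i.-1) ^+ (a + d) * V)
    ^ g.
Proof.
move=> N_even iN pU; have i1 : 1 < i by lia.
elim: a d V => [|a IH] d V pV; first by exists 1; rewrite conjg1 expg0 mulg1.
have pP n Q := @passes_pair N i.-1 Q n.
have [] := @shift_pair N i (stage i) (stage i.-1) (stage 2) (U * pair_braid N
  (stage i) ^+ a)
  (pair_braid N (stage i.-1) ^+ d * V) _ (stage_side i1) (stage_side' i1).
- by lia.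
- by apply: passesM pU (pP _ _).
- by apply: passesM (pP _ _) pV.
rewrite -[state_braid _ _ _ _]/(simple_braid (exchange N i)) => g Eg; have [h
  Eh] := IH d.+1 V pV.
exists (h * g); rewrite conjgM addSnnS -Eh.
by rewrite (expgSr _ a) (expgS _ d); rewrite !mulgA in Eg *.
Qed.

(** All double switches are pushed to the end. [U] collects the steps already treated; the twists it
    must pass, [1 < b < i], are those used for the exchanges still to come. *)
Lemma steps_conj N i c (U : braid N) : ~~ odd N -> 2 < i <= N ->
  (forall b, 1 < b -> b < i -> passes b U (stage 2) (stage i)) ->
  exists g, U * steps_braid N c i =
    (U * steps_braid N (fun k => if k == 3 then \sum_(3 <= j < i.+1) c j else
      0)%N i) ^ g.
Proof.
move=> N_even; elim: i c U => // i IH c U iN pU.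
have [i2|i2] := eqVneq i 2.
  by exists 1; rewrite conjg1 i2 big_nat1 [in LHS]steps_braidS // [in
    RHS]steps_braidS //=.
have iN' : 2 < i <= N by lia.
have {IH}IH := IH _ _ iN' _.
set X := simple_braid (exchange N i.+1).
have pUX b : 1 < b -> b < i -> passes b (U * X) (stage 2) (stage i).
  move=> b1 bi; apply: (passesM (Q' := stage i.+1)); first by apply: pU; lia.
  by apply: (@passes_exchange N b i.+1); lia.
(* The double switches after the exchange of [i + 1] join those after the exchange of [i]. *)
pose c' k := (if k == i then c i.+1 + c i else c k)%N.
have [g Eg] : exists g, U * steps_braid N c i.+1 = (U * X * steps_braid N c' i)
  ^ g.
  rewrite steps_braidS //; last by lia.
  have [k Ek] : exists k, i = k.+1 by exists i.-1; lia.
  have k1 : 1 < k by lia.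
  have sc : steps_braid N c' k = steps_braid N c k.
    have : k < i by rewrite Ek.
    rewrite /steps_braid; elim: k {Ek k1} => //= k IHk ki.
    case: ifP => // _; rewrite !big_cons !big_cat /= IHk ?(ltnW ki) //.
    by rewrite /c' (ltn_eqF ki).
  have [||g Eg] := @move_pairs N i (c i.+1) (c i) (U * X) (steps_braid N c k)
    N_even iN'.
  - by apply: pUX; lia.
  - by rewrite Ek /=; apply: passes_steps => //; lia.
  have Si c0 : steps_braid N c0 i = simple_braid (exchange N i) *
      pair_braid N (stage k) ^+ c0 i * steps_braid N c0 k.
    by rewrite Ek steps_braidS.
  have ki : i.-1 = k by rewrite Ek.
  have c'i : c' i = (c i.+1 + c i)%N by rewrite /c' eqxx.
  by exists g; rewrite ki in Eg; rewrite !Si sc c'i; rewrite !mulgA in Eg *.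
have [h Eh] := IH c' _ pUX.
exists (h * g); rewrite conjgM Eg Eh; congr ((_ ^ _) ^ _).
rewrite steps_braidS //; last lia.
rewrite (_ : i.+1 == 3 = false) ?expg0 ?mulg1 ?mulgA; last by apply/eqP; lia.
congr (_ * _); congr steps_braid; apply/funext => k; case: ifP => // _.
have i3 : 2 < i by lia.
rewrite big_nat_recr //= [RHS]big_nat_recr /=; last exact: leqW.
rewrite [in RHS]big_nat_recr //= /c' eqxx -addnA (addnC (c i)); congr (_ + _)%N.
by apply: eq_big_nat => j /andP[_ ji]; rewrite (ltn_eqF ji).
Qed.

(** * Left-weightedness and rigidity of the family *)

(* Whether the labels [l < m] cross during the exchange step [i]; during a plain
   step, coded by [i = 0], exactly the even labels cross all the lower ones. *)
Definition step_cross i l m : bool := ~~ odd m (+) ((m == i) && (l != i.-1)).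

(** The crossings of a step are recorded by labels in the state it ends in, and by [departs] in the
    state it starts from, so that consecutive steps are compared in their common state. *)
Definition arrives N (i : nat) (Q : state) (s : 'S_N) : Prop :=
  (i != 0 -> Q i.-1 = Q i) /\
  forall p q : 'I_N, label_at N Q p < label_at N Q q ->
    cross s^-1 p q = step_cross i (label_at N Q p) (label_at N Q q).

Definition departs N (i : nat) (Q : state) (s : 'S_N) : Prop :=
  (i != 0 -> Q i.-1 = Q i) /\
  forall p q : 'I_N, label_at N Q p < label_at N Q q ->
    cross s p q = step_cross i (label_at N Q p) (label_at N Q q).

Lemma adjacent_label_between N (Q : state) (p q : 'I_N) l m :
  label_at N Q p = l -> label_at N Q q = m -> 0 < l -> l < m.-1 -> Q m.-1 = Q m
    ->
  exists r : 'I_N, (p < r < q) || (q < r < p).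
Proof.
move=> pl qm l0 lm Qm; have mN : m <= N by rewrite -qm; have /andP[] :=
  label_at_range Q q.
have [r rm] : exists r : 'I_N, label_at N Q r = m.-1 by apply: label_at_surj;
  lia.
exists r; rewrite !(lt_label_at Q) pl qm rm !(before_lt _ lm) !(before_gt _ lm).
have mm : m.-1 < m by lia.
by rewrite before_lt // before_gt // Qm; case: (Q m).
Qed.

(* The exchanged labels [i - 1] and [i] lie on the same side, hence [i] is only
   adjacent to one lower label, namely [i - 1]. *)
Lemma weighted_at N i j Q (s t : 'S_N) : arrives i Q s -> departs j Q t ->
  weighted s t.
Proof.
move=> [Qi sE] [Qj tE]; apply: weightedP => k.
set p := pos_l k; set q := pos_r k; have pq : p < q by rewrite /=.
rewrite -!cross_lt //.
have main (a b : 'I_N) : (a = p /\ b = q) \/ (a = q /\ b = p) -> label_at N Q a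
  < label_at N Q b ->
    cross t a b -> cross s^-1 a b.
  move=> ab lt; rewrite sE // tE //; have /andP[la _] := label_at_range Q a.
  move El : (label_at N Q a) la lt => l l0; move Em : (label_at N Q b) => m lm.
  have far : l < m.-1 -> Q m.-1 = Q m -> False.
    move=> lm' Qm; have [r] := adjacent_label_between El Em l0 lm' Qm.
    by case: ab => -[-> ->]; rewrite /p /q /=; lia.
  (* Exceptional pairs are not neighbours, by [far]; for all others both steps cross according to
     the parity of [m]. *)
  rewrite /step_cross; have [mj|_] := boolP ((m == j) && (l != j.-1)).
    move: mj => /andP[/eqP mj lj]; case: far; rewrite ?mj ?Qj //; lia.
  have [mi|_] := boolP ((m == i) && (l != i.-1)); last by rewrite !addbF.
  by move: mi => /andP[/eqP mi li]; case: far; rewrite ?mi ?Qi //; lia.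
have [lt|gt|/label_at_inj E] := ltngtP (label_at N Q p) (label_at N Q q).
- by apply: main lt; left.
- by rewrite cross_sym (cross_sym s^-1); apply: main gt; right.
by rewrite E ltnn in pq.
Qed.

Lemma perm_preimage N (s : 'S_N) p : exists a, p = s a.
Proof. by exists (s^-1 p); rewrite permKV. Qed.

Lemma step_cross0 l m : 0 < m -> step_cross 0 l m = ~~ odd m.
Proof. by case: m => // m _; rewrite /step_cross addbF. Qed.

Lemma departs_exchange N i : 2 < i <= N -> departs i (stage i) (exchange N i).
Proof.
move=> iN; have i1 : 1 < i by lia.
split=> [_|p q pq]; first exact: stage_side.
rewrite cross_state_perm; last by apply: valid_maybe_swap; lia.
rewrite label_crossE ?stage_side ?stage_side' // stage_flip ?(ltnW i1) //
  /step_cross.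
by case: (odd _); case: eqP; case: eqP.
Qed.

Lemma arrives_exchange N i : 2 < i <= N -> arrives i (stage i.-1) (exchange N
  i).
Proof.
move=> iN; have i1 : 1 < i by lia.
have v : valid N (maybe_swap true i) by apply: valid_maybe_swap; lia.
split=> [_|p q]; first exact: stage_side'.
have [a ->] := perm_preimage (exchange N i) p; have [b ->] := perm_preimage
  (exchange N i) q.
rewrite cross_inv cross_state_perm // !state_permE //.
set l := maybe_swap _ _ _; set m := maybe_swap _ _ (label_at _ _ b) => lm.
have El : label_at N (stage i) a = maybe_swap true i l by rewrite /l /=
  swap_labelsK // ltnW.
have Em : label_at N (stage i) b = maybe_swap true i m by rewrite /m /=
  swap_labelsK // ltnW.
rewrite El Em label_cross_preE ?stage_side ?stage_side' //.
rewrite stage_flip ?(ltnW i1) // /step_cross.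
by case: (odd _); case: eqP; case: eqP.
Qed.

Lemma departs_plain N Q Q' : (forall m, m <= N -> Q m (+) Q' m = ~~ odd m) ->
  departs 0 Q (state_perm N Q (maybe_swap false 2) Q').
Proof.
move=> QQ'; split=> // p q pq; rewrite cross_state_perm; last exact: valid_id.
rewrite /label_cross /= !before_lt // addbN addNb negbK step_cross0; last lia.
by apply: QQ'; have /andP[] := label_at_range Q q.
Qed.

Lemma arrives_plain N Q Q' : (forall m, m <= N -> Q m (+) Q' m = ~~ odd m) ->
  arrives 0 Q' (state_perm N Q (maybe_swap false 2) Q').
Proof.
move=> QQ'; set s := state_perm _ _ _ _; split=> // p q.
have [a ->] := perm_preimage s p; have [b ->] := perm_preimage s q.
rewrite cross_inv cross_state_perm ?state_permE; try exact: valid_id.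
move=> /= ab; rewrite /label_cross /= !before_lt // addbN addNb negbK
  step_cross0; last lia.
by apply: QQ'; have /andP[] := label_at_range Q b.
Qed.

Lemma flip_even_plain N Q m : m <= N -> Q m (+) flip_even N Q m = ~~ odd m.
Proof. by move=> mN; rewrite /flip_even mN andbT addbA addbb. Qed.

Lemma departs_go N i : departs 0 (stage i) (go N i).
Proof. by apply: departs_plain => m; apply: flip_even_plain. Qed.

Lemma arrives_go N i : arrives 0 (flip_even N (stage i)) (go N i).
Proof. by apply: arrives_plain => m; apply: flip_even_plain. Qed.

Lemma departs_back N i : departs 0 (flip_even N (stage i)) (back N i).
Proof. by apply: departs_plain => m mN; rewrite addbC flip_even_plain. Qed.

Lemma arrives_back N i : arrives 0 (stage i) (back N i).
Proof. by apply: arrives_plain => m mN; rewrite addbC flip_even_plain. Qed.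

Lemma label_at_compl N Q (p : 'I_N) : label_at N (fun l => ~~ Q l) p = label_at
  N Q (rev_ord p).
Proof.
rewrite /label_at; have -> : down_up N (fun l => ~~ Q l) = rev (down_up N Q).
  rewrite /down_up rev_cat revK; congr (_ ++ _).
  by apply: eq_filter => l; rewrite negbK.
by rewrite nth_rev ?size_down_up.
Qed.

(** The factor following the last step is the flip conjugate of the first. Its labels, read in the
    complement of [stage N], are those of [stage 2] with 1 and 2 interchanged; since [N > 3], the
    exceptional labels [N - 1] and [N] are not affected. *)
Lemma departs_wrap N : ~~ odd N -> 3 < N ->
  departs N (stage 2) (conj_flip (exchange N N)).
Proof.
move=> N_even N3; have N1 : 1 < N by lia.
pose Q := (fun l => ~~ stage N l) : state.
have v2 : valid N (swap_labels 2) by apply: valid_swap.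
have sQ m : 2 < m <= N -> stage 2 m = Q m.
  move=> mN; have [Nm m2] : (N < m) = false /\ (2 < m) = true by lia.
  by rewrite /Q /stage (negbTE N_even) Nm m2 !andbF /=; case: (_ || _).
have Q1 : state_perm N (stage 2) (swap_labels 2) Q = 1.
  apply: state_perm_swap2 => //; rewrite /Q /stage (negbTE N_even) /=.
  by rewrite (_ : (N < 2) = false) //; lia.
have labQ (p : 'I_N) : label_at N Q p = swap_labels 2 (label_at N (stage 2) p).
  by rewrite -(@state_permE N (stage 2) _ Q) // Q1 perm1.
have NN : 2 < N <= N by lia.
have [_ dN] := departs_exchange NN.
split=> [_|p q pq].
  rewrite !sQ; try lia; by rewrite /Q stage_side.
have cE : cross (conj_flip (exchange N N)) p q =
    label_cross (stage N) (swap_labels N) (stage N.-1) (label_at N Q p)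
      (label_at N Q q).
  by rewrite cross_conj_flip cross_state_perm ?label_at_compl //; apply:
    valid_swap; lia.
move: pq (label_at_range (stage 2) p) (label_at_range (stage 2) q); rewrite cE
  !labQ.
move: (label_at _ _ p) (label_at _ _ q) => l m lm lN mN.
have vN : valid N (swap_labels N) by apply: valid_swap; lia.
have dE l' m' : l' < m' -> label_cross (stage N) (swap_labels N) (stage N.-1)
  l' m' = step_cross N l' m'.
  move=> lm'; rewrite (@label_crossE (stage N) true N (stage N.-1)) ?stage_side
    ?stage_side' //.
  rewrite stage_flip ?(ltnW N1) // /step_cross.
  by case: (odd _); case: eqP; case: eqP.
have [m2|m2] := leqP m 2.
  have [-> ->] : l = 1%N /\ m = 2 by lia.
  rewrite (label_cross_sym _ _ vN) ?dE // /swap_labels /=; lia.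
have -> : swap_labels 2 m = m by rewrite /swap_labels; case: eqP => [?|_];
  [lia|case: eqP => //= ?; lia].
rewrite dE; last by rewrite /swap_labels; do 2?case: eqP => ?; lia.
rewrite /step_cross; congr (_ (+) (_ && _)).
rewrite /swap_labels /=; have [->|_] := eqVneq l 2; first lia.
by have [->|_] := eqVneq l 1%N; first lia.
Qed.

Lemma weighted_list_cons N (s : 'S_N) l :
  weighted s (head 1 l) -> weighted_list l -> weighted_list (s :: l).
Proof. by move=> sl lw [|i]; [case: l sl {lw}|move=> il; apply: lw]. Qed.

Lemma weighted_steps N c i (s z : 'S_N) k : 1 < i <= N ->
  arrives k (stage i) s -> departs N (stage 2) z ->
  weighted_list (s :: steps N c i ++ [:: z]).
Proof.
elim: i s k => // i IH s k iN sa zd; have [i1|i1] := leqP i 1.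
  have Ei : i = 1%N by lia.
  rewrite Ei /= in sa *; apply: weighted_list_cons; first exact: weighted_at sa
    zd.
  by case.
rewrite /= ltnNge i1 /=; apply: weighted_list_cons.
  by apply: weighted_at sa _; apply: departs_exchange; lia.
rewrite -catA; have main n t j : arrives j (stage i) t ->
    weighted_list (t :: flatten (nseq n [:: go N i; back N i]) ++ steps N c i
      ++ [:: z]).
  elim: n t j => [|n IHn] t j ta /=; first by apply: (IH _ j) => //; lia.
  apply: weighted_list_cons; first exact: weighted_at ta (departs_go _ _).
  apply: weighted_list_cons; first exact: weighted_at (arrives_go _ _)
    (departs_back _ _).
  exact: IHn (arrives_back _ _).
by apply: (main _ _ i.+1); apply: (@arrives_exchange N i.+1); lia.
Qed.

Lemma departs_steps N c i (s : 'S_N) : i <= N -> s \in steps N c i ->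
  exists j Q, departs j Q s /\ (j = 0%N \/ 2 < j <= i).
Proof.
elim: i => // i IH iN /=; case: ltnP => // i1; rewrite inE mem_cat =>
  /or3P[/eqP->|/flattenP[x]|si].
- by exists i.+1, (stage i.+1); split; [apply: departs_exchange; lia|right;
    lia].
- rewrite mem_nseq => /andP[_ /eqP->]; rewrite !inE => /orP[]/eqP->; exists 0%N.
    by exists (stage i); split; [apply: departs_go|left].
  by exists (flip_even N (stage i)); split; [apply: departs_back|left].
by have [|j [Q [sj ji]]] := IH _ si; [lia|exists j, Q; split=> //; lia].
Qed.

(** Labels 1 and 2 cross, so [s] is not 1; label 3 fails to cross 2 if [j = 3] and 1 otherwise, so
    [s] is not the flip. *)
Lemma departs_nontrivial N j Q (s : 'S_N) : 2 < N -> departs j Q s -> j != 2 ->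
  s != 1 /\ s != flip N.
Proof.
move=> N2 [_ sE] j2.
have [p1 l1] : exists p : 'I_N, label_at N Q p = 1%N by apply: label_at_surj;
  lia.
have [p2 l2] : exists p : 'I_N, label_at N Q p = 2 by apply: label_at_surj; lia.
have [p3 l3] : exists p : 'I_N, label_at N Q p = 3 by apply: label_at_surj; lia.
have c12 : cross s p1 p2.
  by rewrite sE l1 l2 // /step_cross (eq_sym 2) (negbTE j2).
split; first by apply: contraTneq c12 => ->; rewrite cross1.
have no (p q : 'I_N) : p != q -> cross s p q = false -> s != flip N.
  by move=> pq; apply: contraFneq => ->; rewrite cross_flip.
have neq (p q : 'I_N) : label_at N Q p != label_at N Q q -> p != q by apply:
  contraNneq => ->.
have [j3|j3] := eqVneq j 3.
  apply: (no p2 p3); first by apply: neq; rewrite l2 l3.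
  by rewrite sE l2 l3 // j3.
apply: (no p1 p3); first by apply: neq; rewrite l1 l3.
by rewrite sE l1 l3 // /step_cross (eq_sym 3) (negbTE j3).
Qed.

Lemma rigid_steps N c : ~~ odd N -> 3 < N -> rigid_list (steps N c N).
Proof.
move=> N_even N3; split.
- by case: N N3 {N_even} => //= N N3; rewrite (_ : (N < 2) = false) //; lia.
(* [back N N] serves as an auxiliary predecessor arriving at [stage N]. *)
- rewrite -cats1; apply: (@weighted_list_behead _ (back N N)).
  apply: (@weighted_steps _ _ _ _ _ 0%N); [lia|exact: arrives_back|].
  have -> : head 1 (steps N c N) = exchange N N.
    by case: N N3 {N_even} => //= N N3; rewrite (_ : (N < 2) = false) //; lia.
  exact: departs_wrap.
move=> s /departs_steps[//|j [Q [sj jN]]].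
by apply: departs_nontrivial sj _; lia.
Qed.

(** * Telling steps apart by their numbers of crossings *)

(* Twice the number of crossings. *)
Definition cross_count N (s : 'S_N) : nat := \sum_(p < N) \sum_(q < N) cross s
  p q.

Lemma cross_count_conj_flip N (s : 'S_N) : cross_count (conj_flip s) =
  cross_count s.
Proof.
rewrite /cross_count [RHS](reindex_inj (@rev_ord_inj N)); apply: eq_bigr => p _.
rewrite [RHS](reindex_inj (@rev_ord_inj N)); apply: eq_bigr => q _.
by rewrite cross_conj_flip.
Qed.

Definition step_count N j : nat := \sum_(m < N) \sum_(l < m) step_cross j l.+1
  m.+1.

Lemma cross_count_departs N j Q (s : 'S_N) : departs j Q s ->
  cross_count s = (step_count N j).*2.
Proof.
move=> [_ sE].
have [h h_inj hE] : exists2 h : 'I_N -> 'I_N, injective h &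
    forall p : 'I_N, label_at N Q p = (h p).+1.
  have lt (p : 'I_N) : (label_at N Q p).-1 < N by have := label_at_range Q p;
    lia.
  exists (fun p => Ordinal (lt p)) => [p q /(congr1 val) /= E|p /=]; last by
    have := label_at_range Q p; lia.
  by apply: (@label_at_inj _ Q); have := label_at_range Q p; have :=
    label_at_range Q q; lia.
pose C (l m : nat) : bool := if l < m then step_cross j l.+1 m.+1 else
  if m < l then step_cross j m.+1 l.+1 else false.
have cE p q : cross s p q = C (h p) (h q).
  rewrite /C; case: ltngtP => [lt|lt|/val_inj/h_inj ->]; last by rewrite
    cross_id.
  - by rewrite sE ?hE.
  - by rewrite cross_sym sE ?hE.
have -> : cross_count s = \sum_(l < N) \sum_(m < N) C l m.
  rewrite /cross_count [RHS](reindex_inj h_inj); apply: eq_bigr => p _.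
  by rewrite [RHS](reindex_inj h_inj); apply: eq_bigr => q _; rewrite cE.
have half : step_count N j = \sum_(m < N) \sum_(l < N | l < m) C l m.
  apply: eq_bigr => m _; rewrite (big_ord_widen _ (fun l => nat_of_bool
    (step_cross j l.+1 m.+1)) (ltnW (ltn_ord m))).
  by apply: eq_bigr => l lm; rewrite /C lm.
rewrite -addnn {1}half half [X in (X + _)%N](exchange_big_dep predT) //=
  -big_split /=.
apply: eq_bigr => l _.
rewrite (bigID (fun m : 'I_N => l < m)) /=; congr (_ + _)%N.
rewrite (bigID (fun m : 'I_N => m < l)) /= [X in (_ + X)%N]big1 ?addn0 => [|m
  /andP[lm ml]]; last first.
  by rewrite /C (negbTE lm) (negbTE ml).
apply: eq_big => m; first by case: ltngtP.
by move=> /andP[lm ml]; rewrite /C (negbTE lm) ml.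
Qed.

(** Label [j] toggles its crossings with the [j - 2] labels below [j - 1]: they appear if [j] is odd
    and disappear if [j] is even. *)
Lemma step_count_exchange N j : 2 < j <= N ->
  (step_count N j + (if odd j then 0 else j - 2) = step_count N 0 + (if odd j
    then j - 2 else 0))%N.
Proof.
move=> jN; have jlt : j.-1 < N by lia.
pose k := Ordinal jlt; rewrite /step_count (bigD1 k) // [in RHS](bigD1 k) //=.
have E : \sum_(m < N | m != k) \sum_(l < m) step_cross j l.+1 m.+1 =
    \sum_(m < N | m != k) \sum_(l < m) step_cross 0 l.+1 m.+1.
  apply: eq_bigr => m; rewrite -val_eqE /= => mk; apply: eq_bigr => l _.
  by rewrite /step_cross (_ : (m.+1 == j) = false) //; lia.
rewrite {}E; move: (\sum_(m < N | m != k) _) => R.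
have [i [Ej i0]] : exists i, j = i.+2 /\ 0 < i by exists (j - 2)%N; lia.
subst j; rewrite /= subn2 /=.
have -> : \sum_(l < i.+1) step_cross i.+2 l.+1 i.+2 = (if odd i then i else
  1)%N.
  rewrite big_ord_recr /= {2}/step_cross /= !eqxx /= !negbK addbF.
  have -> : \sum_(l < i) step_cross i.+2 l.+1 i.+2 = \sum_(l < i) odd i.
    apply: eq_bigr => l _; rewrite /step_cross /= eqxx eqSS (ltn_eqF (ltn_ord
      l)).
    by rewrite addbT !negbK.
  by rewrite sum_nat_const card_ord; case: (odd i); rewrite ?muln1 ?muln0
    ?addn0.
have -> : \sum_(l < i.+1) step_cross 0 l.+1 i.+2 = (if odd i then 0 else
  i.+1)%N.
  rewrite (eq_bigr (fun=> ~~ odd i : nat)); last first.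
    by move=> l _; rewrite step_cross0 //= !negbK.
  by rewrite sum_nat_const card_ord; case: (odd i); rewrite ?muln1 ?muln0.
by rewrite !negbK; case: (odd i); lia.
Qed.

Lemma step_count_inj_exchange N j : 2 < j <= N -> step_count N j != step_count
  N 0.
Proof. by move=> jN; have := step_count_exchange jN; case: (odd j); lia. Qed.

(** As [N] is even, its exchange loses [N - 2] crossings, more than any other step. *)
Lemma step_count_last N j : ~~ odd N -> 2 < j < N -> step_count N j !=
  step_count N N.
Proof.
move=> N_even jN; have jN' : 2 < j <= N by lia.
have NN : 2 < N <= N by lia.
have := step_count_exchange jN'; have := step_count_exchange NN.
by rewrite (negbTE N_even); case: (odd j); lia.
Qed.

(* The strand labelled [N] is the only one crossing all the others, so a
   [conj_flip]-invariant permutation would fix its position. *)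
Lemma departs_conj_flip N j Q (s : 'S_N) : ~~ odd N -> 3 < N -> j != 3 -> j !=
  N ->
  departs j Q s -> conj_flip s != s.
Proof.
move=> N_even N3 j3 jN [_ sE]; apply/eqP => ss.
have cs p q : cross s (rev_ord p) (rev_ord q) = cross s p q by rewrite
  -cross_conj_flip ss.
have [p lp] : exists p : 'I_N, label_at N Q p = N by apply: label_at_surj; lia.
have allp (q : 'I_N) : q != p -> cross s q p.
  move=> qp; have lq : label_at N Q q < N.
    have := label_at_range Q q; have : label_at N Q q != N by apply: contra qp
      => /eqP E; apply/eqP/(@label_at_inj _ Q); rewrite E lp.
    by lia.
  by rewrite sE lp // /step_cross N_even eq_sym (negbTE jN).
(* By symmetry the strand at [r] would also cross all others. But each label below [N] misses some
   other label: 1 misses 3, another odd label misses its predecessor, an even label its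
   successor. *)
set r := rev_ord p; have rp : r != p by rewrite -val_eqE /=; lia.
have allr (q : 'I_N) : q != r -> cross s q r.
  move=> qr; rewrite -cs rev_ordK; apply: allp.
  by apply: contra qr => /eqP E; rewrite /r -E rev_ordK.
have lr : label_at N Q r < N.
  have := label_at_range Q r; have : label_at N Q r != N by apply: contra rp =>
    /eqP E; apply/eqP/(@label_at_inj _ Q); rewrite E lp.
  by lia.
have noncross (q : 'I_N) : label_at N Q q != label_at N Q r -> cross s q r =
  false -> False.
  by move=> qr; rewrite allr //; apply: contra qr => /eqP->.
have rN := label_at_range Q r.
have exl l : 0 < l <= N -> exists q : 'I_N, label_at N Q q = l by apply:
  label_at_surj.
have [r1|r1] := eqVneq (label_at N Q r) 1%N.
  have [q lq] := exl 3 ltac:(lia); apply: (noncross q); rewrite ?lq ?r1 //.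
  by rewrite cross_sym sE lq r1 // /step_cross (eq_sym 3) (negbTE j3).
have [odd_r|even_r] := boolP (odd (label_at N Q r)).
  have [q lq] := exl (label_at N Q r).-1 ltac:(lia); apply: (noncross q); first
    by rewrite lq; lia.
  rewrite sE lq; last lia.
  by rewrite /step_cross odd_r; case: eqP => [->|//]; rewrite eqxx.
have [q lq] := exl (label_at N Q r).+1 ltac:(lia); apply: (noncross q); first
  by rewrite lq; lia.
rewrite cross_sym sE lq; last lia.
by rewrite /step_cross /= even_r /=; case: eqP => [<-|//]; rewrite eqxx.
Qed.

Lemma cat_nseq_inj (T : eqType) (x : T) a b (u v : seq T) :
  (forall y, ohead u = Some y -> y != x) -> (forall y, ohead v = Some y -> y !=
    x) ->
  nseq a x ++ u = nseq b x ++ v -> a = b /\ u = v.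
Proof.
move=> ux vx; elim: a b => [|a IH] [|b] //= => [E|E|[/IH[-> ->]//]].
  by have := ux x; rewrite E /= eqxx => /(_ erefl).
by have := vx x; rewrite -E /= eqxx => /(_ erefl).
Qed.

Lemma counts_steps N c i : 1 < i < N ->
  map (@cross_count N) (steps N c i.+1) =
  (step_count N i.+1).*2 :: nseq (c i.+1).*2 (step_count N 0).*2 ++ map
    (@cross_count N) (steps N c i).
Proof.
move=> iN; rewrite /= (_ : (i < 2) = false) /=; last by lia.
have iN' : 2 < i.+1 <= N by lia.
rewrite (cross_count_departs (departs_exchange iN')) map_cat; congr (_ :: _ ++
  _).
elim: (c i.+1) => //= n ->.
by rewrite (cross_count_departs (departs_go N i)) (cross_count_departs
  (departs_back N i)).
Qed.

(** Exchanges never have the count of a plain step, so they delimit runs of plain steps, whose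
    lengths are the doubled exponents. *)
Lemma counts_steps_inj N c c' i : i <= N ->
  map (@cross_count N) (steps N c i) = map (@cross_count N) (steps N c' i) ->
  forall k, 2 < k <= i -> c k = c' k.
Proof.
elim: i => [|i IH] iN; first by lia.
have [i1|i1] := leqP i 1; first by lia.
rewrite !counts_steps ?i1 // => -[] /cat_nseq_inj E k ki.
have hd d y : ohead (map (@cross_count N) (steps N d i)) = Some y -> y !=
  (step_count N 0).*2.
  case: i i1 iN {IH E ki} => // i i1 iN; have [i2|i2] := leqP i 1.
    by have -> : i = 1%N by lia.
  rewrite counts_steps /=; last by lia.
  by move=> [<-]; rewrite (inj_eq double_inj); apply: step_count_inj_exchange;
    lia.
have [/double_inj ci cs] := E (hd c) (hd c').
have [->//|ki'] := eqVneq k i.+1; apply: IH => //; lia.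
Qed.

(** * The braid gamma *)

Lemma index_down_up N Q l m : 0 < l <= N -> 0 < m <= N ->
  (index l (down_up N Q) < index m (down_up N Q)) = before Q l m.
Proof.
have idx (p : 'I_N) : index (label_at N Q p) (down_up N Q) = p.
  by rewrite index_uniq ?size_down_up // (perm_uniq (perm_down_up N Q))
    iota_uniq.
move=> lN mN; have [p <-] := label_at_surj Q lN; have [q <-] := label_at_surj Q
  mN.
by rewrite !idx (lt_label_at Q).
Qed.

Lemma left_of_lower_down_up N Q l : 1 < l <= N -> left_of_lower (down_up N Q) l
  = Q l.
Proof.
move=> lN; rewrite /left_of_lower.
rewrite (eq_in_all (a2 := fun=> Q l)); last first.
  by move=> m; rewrite mem_iota => ml; rewrite index_down_up ?before_gt //; lia.
by case: l lN => [|[|l]] //= _; case: (Q _); rewrite //= all_predT.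
Qed.

Lemma switch_down_up N A Q Q' : (forall l, 1 < l <= N -> Q' l = Q l (+) A l) ->
  switch N A (down_up N Q) = down_up N Q'.
Proof.
move=> H; apply: down_up_ext => l lN; rewrite left_of_lower_down_up // H //.
by rewrite addbC.
Qed.

Lemma label_seqS N j : 1 < j ->
  label_seq N j.+1 = switch N (switched_labels N j) (label_seq N j).
Proof. by case: j => [|[|j]]. Qed.

Lemma label_seq1 N : label_seq N 1 = down_up N (fun l => (l %% 4 == 0) || (l %%
  4 == 3)).
Proof. by []. Qed.

Lemma label_seq2 N : label_seq N 2 =
  down_up N (fun l => ~~ ((l %% 4 == 0) || (l %% 4 == 3))).
Proof.
rewrite /= /down_up rev_cat revK; congr (_ ++ _).
by apply: eq_filter => l; rewrite negbK.
Qed.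

(** The exchange of [i] is the step leaving S_(N+2-i); descending from [i = N], where the sequence
    is S_2, [stage_flip] reproduces [switched_labels]. *)
Lemma label_seq_stage N i : ~~ odd N -> 1 < i <= N ->
  label_seq N (N + 2 - i) = down_up N (stage i).
Proof.
move=> N_even iN; have [d dE] : exists d, i = (N - d)%N by exists (N - i)%N;
  lia.
elim: d i iN dE => [|d IH] i iN dE.
  rewrite dE subn0 addKn label_seq2; apply: down_up_ext => l lN.
  by rewrite /stage (negbTE N_even) andbF addbF (_ : (N < l) = false) ?addbF
    //; lia.
have -> : (N + 2 - i = (N + 2 - i.+1).+1)%N by lia.
rewrite label_seqS ?IH; try lia.
have e1 : (N + 2 - i.+1 < N) = true by lia.
have e2 : (N + 2 - (N + 2 - i.+1))%N = i.+1 by lia.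
apply: switch_down_up => l lN; rewrite /switched_labels /special e1 e2.
have := stage_flip l (ltn0Sn i); rewrite [i.+1.-1]/=.
move: (stage i l) (stage i.+1 l) => x y; rewrite [odd i.+1]/=.
have [->|_] := eqVneq l i.+1; rewrite /= ?orbF ?andbT ?orbT ?andbF.
  by case: (odd i); case: x; case: y.
by rewrite if_same; case: (odd l); case: x; case: y.
Qed.

Lemma label_seq_end N k : ~~ odd N -> 1 < N ->
  label_seq N (N + k.*2) = down_up N (stage 2) /\
  label_seq N (N + k.*2).+1 = down_up N (flip_even N (stage 2)).
Proof.
move=> N_even N1.
have E k' : label_seq N (N + k'.*2) = down_up N (stage 2) ->
    label_seq N (N + k'.*2).+1 = down_up N (flip_even N (stage 2)).
  move=> E; rewrite label_seqS ?E; last lia.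
  apply: switch_down_up => l lN; rewrite /switched_labels ltnNge leq_addr /=.
  by rewrite /flip_even (_ : l <= N) ?andbT //; lia.
elim: k => [|k [_ IH]].
  have := label_seq_stage N_even (_ : 1 < 2 <= N); rewrite addnK addn0 => E2.
  by split; [apply: E2|have := E 0%N; rewrite addn0; apply; apply: E2].
suff H : label_seq N (N + k.+1.*2) = down_up N (stage 2) by split=> //; apply:
  E.
rewrite doubleS !addnS label_seqS ?IH; last lia.
apply: switch_down_up => l lN; rewrite /switched_labels ltnNge (leq_trans
  (leq_addr k.*2 N)) //=.
by rewrite /flip_even (_ : l <= N) ?andbT ?addbK //; lia.
Qed.

Lemma factor_Delta N : factor N 1 = Delta N.
Proof.
rewrite /factor label_seq2 label_seq1.
by rewrite -(flip_braid_Delta N (fun l => (l %% 4 == 0) || (l %% 4 == 3))).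
Qed.

Lemma factor_exchange N i : ~~ odd N -> 2 < i <= N ->
  factor N (N + 2 - i) = simple_braid (exchange N i).
Proof.
move=> N_even iN; rewrite /factor /exchange /state_perm.
have -> : ((N + 2 - i).+1 = N + 2 - i.-1)%N by lia.
rewrite !label_seq_stage //; try lia.
have e1 : 2 <= N + 2 - i < N by lia.
have e2 : (N + 2 - (N + 2 - i))%N = i by lia.
congr (simple_braid (connecting_perm _ _ _ _)); apply/funext => l.
by rewrite /end_label /special e1 e2.
Qed.

Lemma factor_end N k : ~~ odd N -> 1 < N ->
  factor N (N + k.*2) = simple_braid (go N 2) /\
  factor N (N + k.*2).+1 = simple_braid (back N 2).
Proof.
move=> N_even N1; have [E1 E2] := label_seq_end k N_even N1.
have [E3 _] := label_seq_end k.+1 N_even N1; rewrite doubleS !addnS in E3.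
have idE j : N <= j -> end_label N j = id.
  by move=> Nj; apply/funext => l; rewrite /end_label (ltnNge j) Nj andbF.
rewrite /factor E1 E2 E3 !idE ?leq_addr //.
exact: leqW (leq_addr _ _).
Qed.

(** gamma is the member of the family with all [K] double switches placed after the last exchange,
    that of label 3. *)
Lemma gammaE N K : ~~ odd N -> 2 < N -> 
  gamma N (N - 1 + 2 * K) = Delta N * steps_braid N (fun k => if k == 3 then K
    else 0%N) N.
Proof.
move=> N_even N2; rewrite /gamma (_ : (N - 1 + 2 * K).+1 = N + K.*2)%N; last
  lia.
rewrite big_ltn ?factor_Delta; last lia.
rewrite (@big_cat_nat _ _ _ N) /=; try lia; congr (_ * _).
have -> : \prod_(N <= j < N + K.*2) factor N j = pair_braid N (stage 2) ^+ K.
  elim: K => [|K IH]; first by rewrite addn0 big_geq.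
  have [Eg Eb] := factor_end K N_even (ltnW N2).
  have le1 : N <= N + K.*2 by apply: leq_addr.
  rewrite doubleS !addnS big_nat_recr /=; last exact: leqW.
  rewrite big_nat_recr //=.
  by rewrite IH Eg Eb -mulgA go_back // expgSr.
set c := fun k : nat => if k == 3 then K else 0%N.
have main i : 2 < i <= N -> steps_braid N c i =
    (\prod_(N + 2 - i <= j < N) factor N j) * pair_braid N (stage 2) ^+ K.
  elim: i => // i IH iN; rewrite steps_braidS //; last lia.
  have [Ei|i2] := eqVneq i 2.
    have n1 : (N + 2 - 3).+1 = N by lia.
    have e0 : steps_braid N c 2 = 1 by rewrite /steps_braid /= big_nil.
    by rewrite Ei e0 mulg1 /c /= -[in X in index_iota _ X]n1 big_nat1
      factor_exchange // -Ei.
  rewrite IH; last lia.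
  rewrite (_ : c i.+1 = 0%N) ?expg0 ?mulg1; last by rewrite /c; case: eqP =>
    //; lia.
  rewrite [in RHS]big_ltn; last lia.
  have e1 : (N + 2 - i.+1).+1 = (N + 2 - i)%N by lia.
  by rewrite factor_exchange // mulgA e1.
by rewrite main ?addnK ?addKn //; lia.
Qed.

Lemma steps_last N c : 2 < N -> steps N c N =
  exchange N N :: flatten (nseq (c N) [:: go N N.-1; back N N.-1]) ++ steps N c
    N.-1.
Proof. by case: N => //= N N2; rewrite (_ : (N < 2) = false) //; lia. Qed.

Lemma size_steps N c i : 1 < i ->
  size (steps N c i) = (i - 2 + 2 * \sum_(3 <= k < i.+1) c k)%N.
Proof.
elim: i => // i IH i1; rewrite /=; case: ltnP => i2.
  have -> : i = 1%N by lia.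
  by rewrite big_geq.
rewrite /= size_cat IH // size_flatten /shape map_nseq sumn_nseq /=.
rewrite [in RHS]big_nat_recr //=; lia.
Qed.

Lemma mem_steps_exchange N c i k : 2 < k <= i -> exchange N k \in steps N c i.
Proof.
elim: i => [|i IH] ki; first by lia.
rewrite /= (_ : (i < 2) = false); last by lia.
have [->|ki'] := eqVneq k i.+1; first exact: mem_head.
by rewrite inE mem_cat IH ?orbT //; lia.
Qed.

Lemma mem_steps_go N c i k : 2 < k <= i -> 0 < c k -> go N k.-1 \in steps N c i.
Proof.
move=> + ck; elim: i => [|i IH] ki; first by lia.
rewrite /= (_ : (i < 2) = false); last by lia.
rewrite inE mem_cat; have [Ek|ki'] := eqVneq k i.+1; last by rewrite IH ?orbT
  //; lia.
by rewrite -Ek; case: (c k) ck => //= n _; rewrite Ek /= !inE eqxx /= orbT.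
Qed.

(** A factor not fixed by the flip is needed: the exchange of 4, when it is not the first step, or
    else a plain step. *)
Lemma conj_flip_steps N c : ~~ odd N -> 3 < N ->
  4 < N \/ (exists2 k, 2 < k <= N & 0 < c k) ->
  map (@conj_flip N) (steps N c N) != steps N c N.
Proof.
move=> N_even N3 H; apply/eqP; rewrite -[RHS]map_id => /eq_in_map fix_all.
have [N4|[k kN ck]] := H.
  have N4' : 2 < 4 <= N by lia.
  have /eqP := fix_all _ (@mem_steps_exchange N c N 4 N4').
  by apply/negP; apply: departs_conj_flip (departs_exchange N4') => //; lia.
have /eqP := fix_all _ (@mem_steps_go N c N k kN ck).
by apply/negP; apply: departs_conj_flip (departs_go N k.-1) => //; lia.
Qed.

Lemma SC_bound N K : ~~ odd N -> 3 < N -> 4 < N \/ 0 < K ->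
  (`I_(2 * (N - 1 + 2 * K - 1) * 'C(K + N - 3, N - 3))%N #<= SC (gamma N (N - 1
    + 2 * K)))%card.
Proof.
move=> N_even N3 NK; set m := (N - 3)%N.
(* One exponent for each of the [m + 1 = N - 2] exchanges, with sum [K]. The shift by 3 in [c]
   reflects that the lowest exchange is that of label 3. *)
pose A := [set t : m.+1.-tuple 'I_K.+1 | \sum_(i <- t) i == K :> nat]%SET.
pose c (t : {t | t \in A}) k := nth 0%N (map val (val t)) (k - 3).
have sum_c t : \sum_(3 <= k < N.+1) c t k = K.
  have := valP t; rewrite inE => /eqP sE; rewrite -[RHS]sE.
  have -> : \sum_(i <- val t) (i : nat) = \sum_(n <- map val (val t)) n by
    rewrite big_map.
  rewrite [in RHS](big_nth 0%N) size_map size_tuple.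
  rewrite -{1}[3]add0n big_addn (_ : (N.+1 - 3 = m.+1)%N); last by rewrite /m;
    lia.
  by apply: eq_bigr => i _; rewrite /c addnK.
have c_pos t : 0 < K -> exists2 k, 2 < k <= N & 0 < c t k.
  move=> K0; apply/not_exists2P => none; move: K0; rewrite -(sum_c t)
    big_nat_cond big1 // => k /andP[/andP[k3 kN] _].
  by have [//|] := none k; [lia|move/negP; lia].
have cardA : #|{: {t | t \in A}}| = 'C(K + N - 3, N - 3).
  rewrite card_sig (eq_card (B := A)) // card_ord_partitions.
  by rewrite (_ : (m + K = K + N - 3)%N) // /m; lia.
have -> : (2 * (N - 1 + 2 * K - 1) * 'C(K + N - 3, N - 3) =
    2 * (N - 2 + 2 * K) * #|{: {t | t \in A}}|)%N.
  by rewrite cardA; congr (2 * _ * _)%N; lia.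
have N2 : 2 < N by apply: ltnW.
have head_steps t : head 1 (steps N (c t) N) = exchange N N by rewrite
  steps_last.
apply: (@rotations_SC _ _ _ (fun t => steps N (c t) N) _ (@cross_count N)).
- by move=> t; rewrite size_steps ?sum_c //; lia.
- by move=> t; apply: rigid_steps.
- move=> t; rewrite gammaE //.
  have [|b b1 bN|g Eg] := @steps_conj N N (c t) (Delta N) N_even; first by
    rewrite N2 leqnn.
    exact: passes_Delta.
  by exists g; rewrite sum_c in Eg.
- exact: cross_count_conj_flip.
- move=> t; exists (exchange N N); eexists; split; first exact: steps_last.
  split; last by apply: conj_flip_steps => //; case: NK => [|/(c_pos t)];
    [left|right].
  have NN : 2 < N <= N by rewrite N2 leqnn.
  rewrite (cross_count_departs (departs_exchange NN)) map_cat mem_cat negb_or.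
  have zero (s : 'S_N) : departs 0 (stage N.-1) s \/ departs 0 (flip_even N
    (stage N.-1)) s ->
      cross_count s != (step_count N N).*2.
    case=> /cross_count_departs ->; rewrite (inj_eq double_inj) eq_sym;
    exact: step_count_inj_exchange NN.
  apply/andP; split; apply/mapP => -[s].
    move=> /flattenP[x]; rewrite mem_nseq => /andP[_ /eqP->]; rewrite !inE =>
      /orP[]/eqP-> /eqP.
      by apply/negP; rewrite eq_sym; apply: zero; left; apply: departs_go.
    by apply/negP; rewrite eq_sym; apply: zero; right; apply: departs_back.
  move=> /departs_steps[|j [Q [/cross_count_departs-> jN]]]; first lia.
  move=> /double_inj/esym/eqP; apply/negP; case: jN => [->|jN].
    by rewrite eq_sym; apply: step_count_inj_exchange NN.
  by apply: step_count_last => //; lia.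
- move=> t u /(counts_steps_inj (leqnn N)) cE; apply/val_inj/val_inj/(inj_map
    val_inj).
  apply: (@eq_from_nth _ 0%N); first by rewrite !size_map !size_tuple.
  move=> i; rewrite size_map size_tuple => im.
  by have := cE (i + 3)%N; rewrite /c addnK; apply; rewrite /m in im; lia.
by move=> t u; rewrite !head_steps.
Qed.

(** * Four strands without double switches *)

(** The permutation of a word on plain numbers, so that facts about four strands can be checked by
    evaluation. *)
Definition word_pos (w : seq nat) (p : nat) : nat :=
  foldl (fun x i => if x == i then i.+1 else if x == i.+1 then i else x) p w.

Lemma wperm_pos N (w : seq 'I_N.-1) (p : 'I_N) :
  wperm w p = word_pos (map val w) p :> nat.
Proof.
elim: w p => [|i w IH] p; first by rewrite wperm_nil perm1.
rewrite wperm_cons permM IH /=; congr foldl.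
have := stepP i p; rewrite /step -/(transp i).
move: (nat_of_ord (transp i p)) => x; case: eqP; [lia|case: eqP; lia].
Qed.

Lemma wpermV N (w : seq 'I_N.-1) : (wperm w)^-1 = wperm (rev w).
Proof.
elim: w => [|i w IH]; first by rewrite wperm_nil invg1.
rewrite wperm_cons invMg IH rev_cons -cats1 transpV.
elim: (rev w) => [|j u IHu]; first by rewrite /= wperm_cons !wperm_nil mulg1
  mul1g.
by rewrite /= !wperm_cons -mulgA IHu.
Qed.

Definition g4 (i : nat) : 'I_4.-1 := inord i.

Lemma val_g4 i : i < 3 -> val (g4 i) = i.
Proof. exact: inordK. Qed.

(* [Delta . x4 . y4] is the conjugate of [gamma 4 3] by the third generator. *)
Definition x4 : seq 'I_4.-1 := map g4 [:: 0; 1; 2; 1]%N.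
Definition y4 : seq 'I_4.-1 := map g4 [:: 1; 0; 2]%N.

Lemma word_pos4 (w : seq nat) (p : 'I_4) : all (gtn 3) w ->
  wperm (map g4 w) p = word_pos w p :> nat.
Proof.
move=> w3; rewrite wperm_pos -map_comp; congr word_pos.
by rewrite -[RHS]map_id; apply/eq_in_map => i iw /=; rewrite val_g4 //; apply:
  (allP w3).
Qed.

Lemma reduced_word4 (w : seq nat) : all (gtn 3) w ->
  all (fun k => let u := drop k w in
    word_pos (behead u) (head 0 u) < word_pos (behead u) (head 0 u).+1) (iota 0
      (size w)) ->
  reduced_word (map g4 w).
Proof.
elim: w => [|i w IH] /=; first by move=> _ _ a b _.
move=> /andP[i3 w3] /andP[iw].
rewrite (iotaDl 1 0) all_map => rw; apply/reduced_word_cons; split; first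
  exact: IH.
by apply/reduced_transp; rewrite !word_pos4 //= val_g4.
Qed.

Lemma exchange44 : exchange 4 4 = wperm (map g4 [:: 0; 2]%N).
Proof.
apply/permP => p; apply: (@label_at_inj _ (stage 3)); rewrite state_permE; last
  exact: valid_swap.
by rewrite word_pos4 //; case: p => [[|[|[|[|]]]]] //= ?; vm_compute.
Qed.

Lemma exchange43 : exchange 4 3 = wperm (map g4 [:: 0; 1; 2; 1; 0]%N).
Proof.
apply/permP => p; apply: (@label_at_inj _ (stage 2)); rewrite state_permE; last
  exact: valid_swap.
by rewrite word_pos4 //; case: p => [[|[|[|[|]]]]] //= ?; vm_compute.
Qed.

Definition sg4 i : braid 4 := of_word (pos_word [:: g4 i]).

Lemma of_word_cons4 i (w : seq nat) :
  of_word (pos_word (map g4 (i :: w))) = sg4 i * of_word (pos_word (map g4 w)).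
Proof. by rewrite /sg4 -of_wordM. Qed.

Lemma of_word_nil N : of_word (pos_word [::]) = 1 :> braid N. Proof. by []. Qed.

Lemma sg4_braid i : i < 3 -> sg4 i = simple_braid (transp (g4 i)).
Proof.
move=> i3; rewrite /sg4 -simple_braid_word; last by apply: (@reduced_word4 [::
  i]); rewrite /= ?i3 ?ltnSn.
by rewrite wperm_cons wperm_nil mulg1.
Qed.

Lemma conj_gamma40 : exists g, braid_of [:: wperm x4; wperm y4] = gamma 4 3 ^ g.
Proof.
have -> : gamma 4 3 = Delta 4 * (sg4 0 * (sg4 2 * (sg4 0 * (sg4 1%N * (sg4 2 *
  (sg4 1%N * sg4 0)))))).
  rewrite (@gammaE 4 0) //; congr (_ * _); rewrite /steps_braid /= !big_cons
    big_nil mulg1.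
  rewrite exchange44 exchange43 !simple_braid_word; try exact: reduced_word4.
  by rewrite !of_word_cons4 !of_word_nil !mulg1 !mulgA.
have -> : braid_of [:: wperm x4; wperm y4] =
    Delta 4 * (sg4 0 * (sg4 1%N * (sg4 2 * (sg4 1%N * (sg4 1%N * (sg4 0 * sg4
      2)))))).
  rewrite /braid_of !big_cons big_nil mulg1 /x4 /y4 !simple_braid_word; try
    exact: reduced_word4.
  by rewrite !of_word_cons4 !of_word_nil !mulg1 !mulgA.
have far : sg4 0 * sg4 2 = sg4 2 * sg4 0.
  by rewrite /sg4 -!of_wordM; apply/of_wordP; apply: (@braid_far 4); rewrite
    !val_g4.
have adj : sg4 1%N * (sg4 2 * sg4 1%N) = sg4 2 * (sg4 1%N * sg4 2).
  by rewrite /sg4 -!of_wordM; apply/of_wordP; apply: (@braid_adj 4); rewrite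
    !val_g4.
have D : Delta 4 * sg4 0 = sg4 2 * Delta 4.
  rewrite !sg4_braid // simple_braid_Delta; congr (_ * simple_braid _).
  apply/permP => p; rewrite conj_flipE; apply/val_inj => /=.
  have tE i (q : 'I_4) : i < 3 -> transp (g4 i) q = word_pos [:: i] q :> nat.
    by move=> i3; rewrite -word_pos4 /= ?i3 // wperm_cons wperm_nil mulg1.
  by rewrite !tE //; case: p => [[|[|[|[|]]]]] //= ?; vm_compute.
(* By [D], the first generator after [Delta] can be moved in front of it as the third generator, and
   conjugation sends that to the end; [far] and [adj] then rearrange the word. *)
exists (sg4 2); rewrite conjgE -!mulgA.
rewrite [in RHS](mulgA (Delta 4)) D -!mulgA mulKg; congr (_ * _).
rewrite (mulgA (sg4 2) (sg4 0)) -far -!mulgA; congr (_ * _).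
by have := congr1 (fun x => x * (sg4 1%N * (sg4 0 * sg4 2))) adj; rewrite
  -!mulgA.
Qed.

Lemma rigid_list40 : rigid_list [:: wperm x4; wperm y4].
Proof.
have xE (p : 'I_4) : wperm x4 p = word_pos [:: 0; 1; 2; 1]%N p :> nat by apply:
  word_pos4.
have yE (p : 'I_4) : wperm y4 p = word_pos [:: 1; 0; 2]%N p :> nat by apply:
  word_pos4.
have xVE (p : 'I_4) : (wperm x4)^-1 p = word_pos [:: 1; 2; 1; 0]%N p :> nat.
  by rewrite wpermV -map_rev; apply: word_pos4.
have yVE (p : 'I_4) : (wperm y4)^-1 p = word_pos [:: 2; 0; 1]%N p :> nat.
  by rewrite wpermV -map_rev; apply: word_pos4.
split=> //.
- case=> [_|[_|]] //=; apply: weightedP => i.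
    by rewrite !yE !xVE; case: i => [[|[|[|]]]].
  by rewrite !conj_flipE /= !xE !yVE; case: i => [[|[|[|]]]].
have neq (s t : 'S_4) p : s p != t p :> nat -> s != t by apply: contraNneq =>
  ->.
move=> s; rewrite !inE => /orP[]/eqP->; split.
- by apply: (neq _ _ ord0); rewrite xE perm1.
- by apply: (neq _ _ ord_max); rewrite xE flipE.
- by apply: (neq _ _ ord0); rewrite yE perm1.
by apply: (neq _ _ ord0); rewrite yE flipE.
Qed.

Lemma SC_bound40 : (`I_4 #<= SC (gamma 4 3))%card.
Proof.
have xE (p : 'I_4) : wperm x4 p = word_pos [:: 0; 1; 2; 1]%N p :> nat by apply:
  word_pos4.
have yE (p : 'I_4) : wperm y4 p = word_pos [:: 1; 0; 2]%N p :> nat by apply: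
  word_pos4.
(* Counts the outer strands that end at the opposite side, which the flip respects: it is 1 for [x4]
   and 0 for [y4]. *)
pose stat (s : 'S_4) : nat := ((s ord0 == 3 :> nat) + (s ord_max == 0 :>
  nat))%N.
suff : (`I_(2 * 2 * #|{: unit}|)%N #<= SC (gamma 4 3))%card by rewrite
  card_unit.
apply: (@rotations_SC _ _ _ (fun=> [:: wperm x4; wperm y4]) _ stat) => //.
- by move=> _; apply: rigid_list40.
- by move=> _; apply: conj_gamma40.
- move=> s; rewrite /stat !conj_flipE addnC /=.
  have -> : rev_ord ord0 = ord_max :> 'I_4 by apply: val_inj.
  have -> : rev_ord ord_max = ord0 :> 'I_4 by apply: val_inj.
  by have := ltn_ord (s ord0); have := ltn_ord (s ord_max); lia.
- move=> _; exists (wperm x4), [:: wperm y4]; split=> //; split.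
    by rewrite inE /stat !xE !yE.
  apply/eqP => -[] /(congr1 (fun s : 'S_4 => nat_of_ord (s ord0))).
  by rewrite conj_flipE /= !xE.
by move=> [] [].
Qed.

(** * The bound in all cases and its growth *)

Lemma expn_le_ffact k n : k.+1 ^ n <= (k + n) ^_ n.
Proof.
elim: n => [|n IH] //; rewrite addnS ffactnS expnS /=.
by apply: leq_mul => //; lia.
Qed.

Lemma SC_bound_all N K L : ~~ odd N -> 3 < N -> L = (N - 1 + 2 * K)%N ->
  (`I_(2 * (L - 1) * 'C(K + N - 3, N - 3))%N #<= SC (gamma N L))%card.
Proof.
move=> N_even N3 ->; have [N4|] := ltnP 4 N; first by apply: SC_bound => //;
  left.
have [->|K0 _] := posnP K; last by apply: SC_bound => //; right.
move=> N4; have -> : N = 4 by lia.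
exact: SC_bound40.
Qed.

(** One factor of the power is bounded by [L <= 2 * (L - 1)], the other [N - 3] by [L <= 4 * K.+1],
    which holds as [2 * N <= L]. The binomial coefficient times the factorial of [N - 3] is a
    falling factorial whose factors are at least [K.+1]. *)
Lemma SC_bound_poly N K L : 3 < N -> L = (N - 1 + 2 * K)%N -> 2 * N <= L ->
  L ^ (N - 2) <= 2 * (L - 1) * 'C(K + N - 3, N - 3) * (4 ^ (N - 3) * (N - 3)`!).
Proof.
move=> N3 LE NL; have -> : (N - 2 = (N - 3).+1)%N by lia.
have -> : (K + N - 3 = K + (N - 3))%N by lia.
have L1 : L <= 2 * (L - 1) by lia.
have L4 : L <= 4 * K.+1 by lia.
move: (N - 3)%N => n; rewrite (mulnC (4 ^ n)%N) mulnA -(mulnA _ 'C(_, _))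
  bin_ffact.
rewrite expnS -mulnA; apply: leq_mul => //.
apply: (@leq_trans ((4 * K.+1) ^ n)); first by case: n => // n; rewrite
  leq_exp2r.
by rewrite expnMn mulnC leq_mul2r expn_le_ffact orbT.
Qed.

Local Open Scope ring_scope.
Local Open Scope classical_set_scope.
Local Open Scope card_scope.

Theorem lemma3p5 (R : realType) (N : nat) (N_ge4 : (4 <= N)%N)
    (N_even : ~~ odd N) :
  (forall K L : nat, L = (N - 1 + 2 * K)%N ->
     `I_(2 * (L - 1) * 'C(K + N - 3, N - 3))%N #<= SC (gamma N L) /\
     (2 * (L - 1) * 'C(K + N - 3, N - 3))%N =
     (2 * (L - 1) * 'C((L + N - 5) %/ 2, N - 3))%N) /\
  (exists2 c : R, 0 < c &
     exists L0 : nat, forall L : nat, (N - 1 <= L)%N -> odd L -> (L0 <= L)%N ->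
       exists2 m : nat, c * L%:R ^+ (N - 2) <= m%:R &
         `I_m #<= SC (gamma N L)).
Proof.
split.
  move=> K L LE; split; first exact: SC_bound_all.
  have -> : (L + N - 5 = (K + N - 3) * 2)%N by lia.
  by rewrite mulnK.
pose d := (4 ^ (N - 3) * (N - 3)`!)%N.
have d0 : (0 < d)%N by rewrite muln_gt0 expn_gt0 fact_gt0.
exists (d%:R^-1); first by rewrite invr_gt0 ltr0n.
exists (2 * N)%N => L NL oddL L2N.
have [K LE] : exists K, L = (N - 1 + 2 * K)%N.
  exists ((L - (N - 1))./2); have := odd_double_half (L - (N - 1)).
  by rewrite oddB // oddL oddB ?(ltnW (ltnW (ltnW N_ge4))) // (negbTE N_even)
    /=; lia.
exists (2 * (L - 1) * 'C(K + N - 3, N - 3))%N; last exact: SC_bound_all.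
rewrite mulrC ler_pdivrMr ?ltr0n // -natrX -natrM ler_nat.
exact: SC_bound_poly.
Qed.
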